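(* For every $\epsilon>0$ there exists $c=c(\epsilon)>0$ such that $\mathbb P(\sigma^{\Lambda_N,+}_o\neq\sigma^{\Lambda_N,-}_o)\leq c^{-1}e^{-cN}$ for all integers $N\geq1$.
   Context: Let $\{h_v:v\in\mathbb Z^2\}$ be i.i.d. Gaussian with mean zero and variance $\epsilon^2>0$, with law $\mathbb P$. Write $u\sim v$ if $|u-v|_1=1$; for $A\subset\mathbb Z^2$, $\partial A=\{v\in\mathbb Z^2\setminus A: u\sim v\text{ for some }u\in A\}$. $\Lambda_N=\{v\in\mathbb Z^2:|v|_\infty\le N\}$, $o$ is the origin. For $\sigma\in\{-1,1\}^{\Lambda_N}$, $H^{\Lambda_N,\pm}(\sigma)=-\big(\sum_{u\sim v,\,u,v\in\Lambda_N}\sigma_u\sigma_v\pm\sum_{u\sim v,\,u\in\Lambda_N,v\in\partial\Lambda_N}\sigma_u+\sum_{u\in\Lambda_N}\sigma_uh_u\big)$ (each unordered pair counted once). $\sigma^{\Lambda_N,+}$ (resp. $\sigma^{\Lambda_N,-}$) denotes the ground state, i.e. the minimizer of $H^{\Lambda_N,+}$ (resp. $H^{\Lambda_N,-}$), which is unique with probability 1. *)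

(* Defs.v *)
From HB Require Import structures.
From mathcomp Require Import all_boot all_order all_algebra.
From mathcomp Require Import all_classical all_reals all_analysis.
Set Implicit Arguments. Unset Strict Implicit. Unset Printing Implicit Defensive.
Import Order.TTheory GRing.Theory Num.Theory.
Local Open Scope classical_set_scope.
Local Open Scope ring_scope.

Definition site := (int * int)%type.
Definition origin : site := (0%:Z, 0%:Z).

Definition adj (u v : site) : bool :=
  (`|u.1 - v.1| + `|u.2 - v.2| == 1)%R.

Definition nbrs (u : site) : seq site :=
  [:: (u.1 + 1, u.2); (u.1 - 1, u.2); (u.1, u.2 + 1); (u.1, u.2 - 1)].

Definition inBox (N : nat) (v : site) : bool :=
  (`|v.1| <= N%:Z) && (`|v.2| <= N%:Z).

Definition box (N : nat) : seq site :=
  [seq ((i%:Z - N%:Z), (j%:Z - N%:Z)) | i <- iota 0 (N.*2.+1), j <- iota 0 (N.*2.+1)].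

(* spin configurations: true = +1, false = -1 (only values on Lambda_N matter) *)
Definition config := site -> bool.
Definition spin {R : numDomainType} (b : bool) : R := if b then 1 else -1.

(* H^{Lambda_N, +/-}(sigma) with field h; bc = true for the + boundary condition.
   Interior pairs: each unordered nearest-neighbour pair in Lambda_N counted once
   (= half the sum over ordered pairs). Boundary: pairs u in Lambda_N, v in the
   outer boundary, u ~ v. *)
Definition hamiltonian {R : numDomainType} (N : nat) (bc : bool)
    (h : site -> R) (sigma : config) : R :=
  - ( 2^-1 * (\sum_(u <- box N) \sum_(v <- nbrs u | inBox N v)
                 spin (sigma u) * spin (sigma v))
      + spin bc * (\sum_(u <- box N) \sum_(v <- nbrs u | ~~ inBox N v) spin (sigma u))
      + \sum_(u <- box N) spin (sigma u) * h u).

Definition ground_state {R : numDomainType} (N : nat) (bc : bool)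
    (h : site -> R) (sigma : config) : Prop :=
  forall tau : config, hamiltonian N bc h sigma <= hamiltonian N bc h tau.

Definition disagree_at_origin {R : realType} {d} {Omega : measurableType d}
    (h : site -> Omega -> R) (N : nat) : set Omega :=
  [set w | exists sp sm : config,
      ground_state N true (fun v => h v w) sp /\
      ground_state N false (fun v => h v w) sm /\ sp origin != sm origin].

Definition iid_gaussian {R : realType} {d} {Omega : measurableType d}
    (P : probability Omega R) (h : site -> Omega -> R) (eps : R) : Prop :=
  (forall v, measurable_fun setT (h v)) /\
  (forall v (B : set R), measurable B ->
      P (h v @^-1` B) = normal_prob 0 eps B) /\
  (forall (s : seq site) (B : site -> set R), uniq s ->
      (forall v, measurable (B v)) ->
      P (\bigcap_(v in [set x | x \in s]) (h v @^-1` B v)) =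
      (\prod_(v <- s) P (h v @^-1` B v))%E).

(* Main.v *)
Require Import Defs.
From HB Require Import structures.
From mathcomp Require Import all_boot all_order all_algebra finmap.
From mathcomp Require Import all_classical all_reals all_analysis measurable_realfun.
From mathcomp Require Import zify ring lra.
Set Implicit Arguments. Unset Strict Implicit. Unset Printing Implicit Defensive.
Import Order.TTheory GRing.Theory Num.Theory.
Local Open Scope classical_set_scope.
Local Open Scope ring_scope.

(** Flipping the spins of a finite set [A] against the boundary condition costs [2 (per A + h(A))],
    so the extremal ground states on [D] are minimizers of an isoperimetric energy, and the event of
    the theorem is that the origin lies in the set [C] of sites where they disagree.

    Crossings.  Suppose rectangle crossings by [C] were almost sure at some scale.  Then most sites
    are surrounded by rings of [C], also after the field is raised by an amount [Delta] inversely
    proportional to the scale, which by Cameron-Martin costs a bounded factor.  Inside such rings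
    the set [C_Delta], on which the + ground state for [h] and the - ground state for [h + Delta]
    disagree, does not depend on the domain, so its sizes in disjoint squares are exchangeable.  On
    the other hand the isoperimetric inequality [Delta |A| <= 2 |edges from A to C_Delta \ A|] makes
    the outer squares win, a contradiction.  Hence crossings have probability at most [1 - delta].

    Tortuosity.  A path that is nearly straight at some scale crosses many disjoint rectangles.
    Renormalizing over the scales [b ^ j], a [C]-path of diameter [n] has length at least
    [n ^ (1 + c)], with high probability.  As [C_Delta] has exponential growth in its graph metric,
    the origin is unlikely to be in [C_Delta] with [Delta] much smaller than [1 / n].

    Decay.  Raising the field by [Delta] one annulus after the other, and noting that the shift of
    an annulus is felt at the origin only if the origin is a disagreement site for the ball inside
    it, one finds a scale [n] at which the disagreement probability is much less than [1 / n].
    A Peierls argument at this scale concludes. *)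

(** * Gaussian shifts and their Radon-Nikodym densities *)

(** Dimension two is critical. A shift of the field by [1 / n] on a box of side [n] has bounded
    Cameron-Martin cost, and its total is of the order of the perimeter, so an argument at one scale
    yields only constants. Without a shift the isoperimetric inequality has left side zero; the
    shift serves to make that side positive. The contradiction for crossings is a count: the
    competing inner squares grow like [q ^ 2], the shell squares like [q]. The gain in the exponent
    is [(b - 1) * (b + 4) > b ^ 2]: a path that is straight on at most half of the scales is still
    longer than its diameter by a power. Hence a shift far below [1 / n] suffices at scale [n], and
    its cost, weighted by the disagreement probabilities of the inner balls, closes a summable
    recursion. A nearly straight path may point in any direction, whence squares and rectangles
    along an arbitrary integer vector [a]. The constant of the theorem precedes the probability
    space, so every scale is chosen from [eps] alone and works for all laws at once. *)

Section Density.
Context d (T : measurableType d) (R : realType).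
Variables (mu nu : {measure set T -> \bar R}) (f : T -> R).
Hypotheses (f0 : forall x, 0 <= f x) (mf : measurable_fun setT f).
Hypothesis nuE : forall A, measurable A -> nu A = (\int[mu]_(x in A) (f x)%:E)%E.
Local Open Scope ereal_scope.
Import HBNNSimple.

Lemma ge0_integral_density (g : T -> \bar R) : measurable_fun setT g ->
  (forall x, 0 <= g x) -> \int[nu]_x g x = \int[mu]_x (g x * (f x)%:E).
Proof.
move=> mg g0; pose h := nnsfun_approx measurableT mg.
have -> : \int[nu]_x g x = lim (\int[nu]_x (EFin \o h n) x @[n --> \oo]).
  have gE x : [set: T] x -> g x = lim ((EFin \o h n) x @[n --> \oo]).
    by move=> _; apply/esym/cvg_lim => //; exact: cvg_nnsfun_approx.
  under eq_integral => x _ do rewrite (gE x) //.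
  apply: monotone_convergence => //.
  - by move=> n; apply/measurable_EFinP; exact/measurable_funP.
  - by move=> n x _ /=; rewrite lee_fin.
  - by move=> x _ a b ab; rewrite lee_fin; exact/lefP/nd_nnsfun_approx.
have -> : \int[mu]_x (g x * (f x)%:E) =
    lim (\int[mu]_x ((EFin \o h n) x * (f x)%:E) @[n --> \oo]).
  have gE x : [set: T] x -> g x * (f x)%:E = lim ((EFin \o h n) x * (f x)%:E @[n --> \oo]).
    by move=> _; apply/esym/cvg_lim => //; apply: cvgeZr => //; exact: cvg_nnsfun_approx.
  under eq_integral => x _ do rewrite (gE x) //.
  apply: monotone_convergence => //.
  - by move=> n; apply: emeasurable_funM; apply/measurable_EFinP => //; exact/measurable_funP.
  - by move=> n x _ /=; rewrite mule_ge0 ?lee_fin.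
  - move=> x _ a b ab /=; rewrite lee_wpmul2r ?lee_fin //.
    exact/lefP/nd_nnsfun_approx.
suff suf n : \int[mu]_x ((EFin \o h n) x * (f x)%:E) = \int[nu]_x (EFin \o h n) x.
  by under eq_fun do rewrite -suf.
have mi r : measurable (h n @^-1` [set r]) by exact: measurable_sfunP.
have indich r : measurable_fun setT (fun x => (r * \1_(h n @^-1` [set r]) x)%:E).
  by apply/measurable_EFinP; exact: measurable_funM.
transitivity (\int[nu]_x (\sum_(y \in range (h n)) (y * \1_(h n @^-1` [set y]) x)%:E)); last first.
  by apply: eq_integral => t _; rewrite /= fimfunE -fsumEFin.
rewrite ge0_integral_fsum//; last by move=> m y Ey; exact: nnfun_muleindic_ge0.
transitivity (\int[mu]_x (\sum_(y \in range (h n))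
    (y * \1_(h n @^-1` [set y]) x)%:E * (f x)%:E)).
  apply: eq_integral => x _; rewrite /= fimfunE -fsumEFin // ge0_mule_fsuml // => y.
  exact: nnfun_muleindic_ge0.
rewrite ge0_integral_fsum//; last 2 first.
  - by move=> y; apply: emeasurable_funM => //; exact/measurable_EFinP.
  - by move=> m y Ey; rewrite mule_ge0 ?lee_fin //; exact: nnfun_muleindic_ge0.
apply: eq_fsbigr => r; rewrite inE => -[t _ <-]; set y := h n t.
have y0 : (0 <= y)%R by exact: fun_ge0.
under eq_integral do rewrite EFinM -muleA.
rewrite ge0_integralZl //; last first.
- by move=> x _; rewrite mule_ge0 ?lee_fin.
- by apply: emeasurable_funM => //; apply/measurable_EFinP => //; exact: measurable_indic.
under [RHS]eq_integral do rewrite EFinM.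
rewrite ge0_integralZl //; last by apply/measurable_EFinP; exact: measurable_indic.
congr (_ * _); rewrite integral_indic // setIT nuE //.
under eq_integral do rewrite muleC.
by rewrite [RHS]integral_mkcond; apply: eq_integral => x _; rewrite epatch_indic.
Qed.

End Density.

Section DensityMeasure.
Context d (T : measurableType d) (R : realType).
Variables (mu : {measure set T -> \bar R}) (f : T -> R).
Hypotheses (f0 : forall x, 0 <= f x) (mf : measurable_fun setT f).
Local Open Scope ereal_scope.

Definition density_measure (_ : forall x, (0 <= f x)%R) (_ : measurable_fun setT f)
  (A : set T) : \bar R := \int[mu]_(x in A) (f x)%:E.

Local Notation nu := (density_measure f0 mf).

Let nu0 : nu set0 = 0. Proof. exact: integral_set0. Qed.

Let nu_ge0 A : 0 <= nu A.
Proof. by apply: integral_ge0 => x _; rewrite lee_fin. Qed.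

Let nu_sigma_additive : semi_sigma_additive nu.
Proof.
move=> F mF tF mUF; rewrite /density_measure ge0_integral_bigcup //=.
- by apply: is_cvg_ereal_nneg_natsum_cond => n _ _; exact: nu_ge0.
- by apply/measurable_EFinP; exact: measurable_funS mf.
- by move=> x _; rewrite lee_fin.
Qed.

HB.instance Definition _ := isMeasure.Build _ _ _ nu nu0 nu_ge0 nu_sigma_additive.

End DensityMeasure.

Definition image_measure d d' (T1 : measurableType d) (T2 : measurableType d')
  (R : realType) (m : {measure set T1 -> \bar R}) (f : T1 -> T2)
  (mf : measurable_fun setT f) : {measure set T2 -> \bar R}.
Proof. by refine (pushforward m f : {measure set T2 -> \bar R}). Defined.

Lemma image_measureE d d' (T1 : measurableType d) (T2 : measurableType d')
  (R : realType) (m : {measure set T1 -> \bar R}) (f : T1 -> T2)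
  (mf : measurable_fun setT f) A : image_measure m mf A = m (f @^-1` A).
Proof. by []. Qed.

Section GaussianShift.
Context (R : realType) (eps : R).
Hypothesis eps_gt0 : 0 < eps.
Local Notation mu := (@lebesgue_measure R).

(** The Radon-Nikodym density of the normal law of mean [c] and variance [eps ^+ 2] with respect to
    the centred one. *)
Definition tilt (c x : R) : R := expR (c / eps ^+ 2 * x - c ^+ 2 / (2 * eps ^+ 2)).

Lemma tilt_ge0 c x : 0 <= tilt c x. Proof. exact: expR_ge0. Qed.

Lemma measurable_tilt c : measurable_fun setT (tilt c).
Proof.
by apply: measurableT_comp => //; apply: measurable_funB.
Qed.

Lemma normal_pdf_shift c x : normal_pdf 0 eps (x - c) = tilt c x * normal_pdf 0 eps x.
Proof.
have e0 : eps != 0 by rewrite gt_eqF.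
rewrite /normal_pdf (negbTE e0) /normal_fun /tilt mulrCA -expRD; congr (_ * expR _).
by field.
Qed.

Lemma lebesgue_measureD c (A : set R) : measurable A ->
  pushforward mu ((fun x => x + c) : _ -> measurableTypeR R) A = mu A.
Proof.
move=> mA; have ms : measurable_fun setT ((fun x => x + c) : R -> measurableTypeR R).
  exact: measurable_funD.
apply/esym; apply: lebesgue_measure_unique => // _ [[a b]] _ <-.
rewrite /= /pushforward.
have -> : (fun x : R => x + c) @^-1` [set` `]a, b]%R] = [set` `]a - c, b - c]%R].
  apply/seteqP; split=> x /=; rewrite !in_itv /=; lra.
rewrite !lebesgue_measure_itv /= !lte_fin ltrD2r; case: ifP => // _.
by rewrite -!EFinB; congr EFin; ring.
Qed.

Lemma normal_prob_shift c (B : set R) : measurable B ->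
  normal_prob 0 eps [set x | B (x + c)] =
  (\int[normal_prob 0 eps]_(x in B) (tilt c x)%:E)%E.
Proof.
move=> mB; have mt := measurable_tilt c.
have mp : measurable_fun setT (normal_pdf (0:R) eps) := measurable_normal_pdf _ _.
have ms : measurable_fun setT (fun x : R => x + c) by exact: measurable_funD.
transitivity (\int[mu]_(y in B) (normal_pdf 0 eps (y - c))%:E)%E; last first.
  rewrite [RHS]integral_mkcond.
  rewrite (@ge0_integral_density _ _ _ mu _ (normal_pdf 0 eps)) //.
  - rewrite [LHS]integral_mkcond; apply: eq_integral => x _.
    rewrite !patchE; case: ifP => _; last by rewrite mul0e.
    by rewrite -EFinM normal_pdf_shift.
  - by move=> x; exact: normal_pdf_ge0.
  - apply/(measurable_restrict _ mB measurableT); rewrite setTI.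
    by apply/measurable_EFinP; exact: measurable_funS mt.
  - by move=> x; rewrite patchE; case: ifP => // _; rewrite lee_fin tilt_ge0.
rewrite /normal_prob.
have -> : (\int[mu]_(y in B) (normal_pdf 0 eps (y - c))%:E =
  \int[pushforward mu ((fun x => (x + c)%R) : _ -> measurableTypeR R)]_(y in B)
     (normal_pdf 0 eps (y - c))%:E)%E.
  by apply: eq_measure_integral => //= A mA AS; exact/esym/lebesgue_measureD.
rewrite ge0_integral_pushforward //.
- by apply: eq_integral => x _ /=; rewrite addrK.
- apply/measurable_EFinP; apply: (@measurable_funS _ _ _ _ setT) => //.
  apply: measurableT_comp => //; exact: measurable_funB.
- by move=> y _; rewrite lee_fin normal_pdf_ge0.
Qed.

End GaussianShift.

(** * Events of the field and its law *)

Definition fld (R : realType) : Type := site -> R.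
HB.instance Definition _ (R : realType) := gen_eqMixin (fld R).
HB.instance Definition _ (R : realType) := gen_choiceMixin (fld R).
HB.instance Definition _ (R : realType) := isPointed.Build (fld R) (fun=> 0).

Section Fields.
Variable R : realType.

Definition cyl (S : set site) : set (set (fld R)) :=
  [set F | exists v B, [/\ S v, measurable B & F = [set eta : fld R | B (eta v)]]].

Local Notation field S := (g_sigma_algebraType (cyl S)).

(** Membership in the sigma-algebra of the coordinates in [S], kept as a predicate on events of the
    whole field so that one event can be seen as local to several sets; independence is stated
    through it. *)
Definition ms (S : set site) (F : set (fld R)) : Prop := <<s cyl S >> F.

Lemma ms_cyl (S : set site) v (B : set R) : S v -> measurable B -> ms S [set eta : fld R | B (eta v)].
Proof. by move=> Sv mB; apply: sub_sigma_algebra; exists v, B. Qed.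

Lemma msC S F : ms S F -> ms S (~` F).
Proof. by move=> mF; exact: (@measurableC _ (field S) F mF). Qed.

Lemma msT S : ms S setT.
Proof. exact: (@measurableT _ (field S)). Qed.

Lemma ms0 S : ms S set0.
Proof. exact: (@measurable0 _ (field S)). Qed.

Lemma msI S F G : ms S F -> ms S G -> ms S (F `&` G).
Proof. by move=> mF mG; exact: (@measurableI _ (field S) F G mF mG). Qed.

Lemma msU S F G : ms S F -> ms S G -> ms S (F `|` G).
Proof. by move=> mF mG; exact: (@measurableU _ (field S) F G mF mG). Qed.

Lemma msD S F G : ms S F -> ms S G -> ms S (F `\` G).
Proof. by move=> mF mG; exact: (@measurableD _ (field S) F G mF mG). Qed.

Lemma ms_sub S S' F : S `<=` S' -> ms S F -> ms S' F.
Proof.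
move=> SS'; apply: smallest_sub; first exact: smallest_sigma_algebra.
by move=> _ [v [B [Sv mB ->]]]; apply: sub_sigma_algebra; exists v, B; split=> //; exact: SS'.
Qed.

Lemma ms_forall S (T : eqType) (s : seq T) (F : T -> set (fld R)) :
  (forall x, x \in s -> ms S (F x)) -> ms S [set eta : fld R | forall x, x \in s -> F x eta].
Proof.
elim: s => [|a s IH] h.
  by rewrite (_ : [set _ | _] = setT); [exact: msT|apply/seteqP; split].
rewrite (_ : [set _ | _] = F a `&` [set eta : fld R | forall x, x \in s -> F x eta]).
  by apply: msI; [apply: h; rewrite mem_head|apply: IH => x xs; apply: h; rewrite inE xs orbT].
apply/seteqP; split=> [eta H|eta [Ha H] x].
  by split=> [|x xs]; apply: H; rewrite inE ?eqxx // xs orbT.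
by rewrite inE => /orP[/eqP->|/H].
Qed.

Lemma ms_exists S (T : eqType) (s : seq T) (F : T -> set (fld R)) :
  (forall x, x \in s -> ms S (F x)) -> ms S [set eta : fld R | exists2 x, x \in s & F x eta].
Proof.
move=> h; rewrite (_ : [set _ | _] = ~` [set eta : fld R | forall x, x \in s -> (~` F x) eta]).
  by apply: msC; apply: ms_forall => x xs; apply: msC; exact: h.
apply/seteqP; split=> [eta [x xs Fx] H|eta /existsNP[x /not_implyP[xs /contrapT Fx]]].
  exact: (H _ xs).
by exists x.
Qed.

Definition mdisc S (K : Type) (T : (fld R) -> K) := forall k, ms S [set eta : fld R | T eta = k].

(** A countable target turns any predicate of the variable into a countable union of fibres. *)
Lemma mdisc_pred S (K : countType) (T : (fld R) -> K) (Phi : K -> Prop) :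
  mdisc S T -> ms S [set eta : fld R | Phi (T eta)].
Proof.
move=> mT; rewrite (_ : [set _ | _] =
    \bigcup_n [set eta : fld R | choice.pickle (T eta) = n /\ Phi (T eta)]).
  apply: (@bigcupT_measurable _ (field S)) => n.
  have [[k [kn Pk]]|H] := pselect (exists k : K, choice.pickle k = n /\ Phi k).
    rewrite (_ : [set _ | _] = [set eta : fld R | T eta = k]); first exact: mT.
    apply/seteqP; split=> eta /=; last by move=> ->.
    by rewrite -kn => -[/(pcan_inj choice.pickleK)].
  rewrite (_ : [set _ | _] = set0); first exact: ms0.
  by apply/seteqP; split=> eta //= H'; apply: H; exists (T eta).
apply/seteqP; split=> [eta /= H|eta [n _ []] //]; by exists (choice.pickle (T eta)).
Qed.

Lemma mdisc_pair S (K K' : Type) (T : (fld R) -> K) (T' : (fld R) -> K') :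
  mdisc S T -> mdisc S T' -> mdisc S (fun eta => (T eta, T' eta)).
Proof.
move=> mT mT' [k k']; rewrite (_ : [set _ | _] = [set eta : fld R | T eta = k] `&` [set eta : fld R | T' eta = k']).
  exact: msI.
by apply/seteqP; split=> eta /=; [case|move=> [-> ->]].
Qed.

(** Unlike the generators [cyl S], these finite products are stable under intersection; they are the
    pi-system on which two laws are compared. *)
Definition rect (S : set site) : set (set (fld R)) :=
  [set F | exists (s : seq site) (B : site -> set R),
    [/\ uniq s, forall v, v \in s -> S v, forall v, measurable (B v) &
        F = [set eta : fld R | forall v, v \in s -> B v (eta v)]]].

Lemma rect_ms S F : rect S F -> ms S F.
Proof. by case=> s [B [us sS mB ->]]; apply: ms_forall => v vs; apply: ms_cyl; [exact: sS|]. Qed.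

Lemma rectI S : setI_closed (rect S).
Proof.
move=> _ _ [s [B [us sS mB ->]]] [s' [B' [us' sS' mB' ->]]].
exists (undup (s ++ s')), (fun v => (if v \in s then B v else setT) `&`
                                    (if v \in s' then B' v else setT)).
split; first exact: undup_uniq.
- by move=> v; rewrite mem_undup mem_cat => /orP[/sS|/sS'].
- by move=> v; apply: measurableI; case: ifP.
apply/seteqP; split=> [eta [H H'] v vs|eta H].
  by split; case: ifP => // vs'; [exact: H|exact: H'].
split=> v vs; have /H [] : v \in undup (s ++ s') by rewrite mem_undup mem_cat vs ?orbT.
  by rewrite vs.
by rewrite vs.
Qed.

Lemma rect_gen S : <<s cyl S >> = <<s rect S >>.
Proof.
apply/seteqP; split.
  apply: smallest_sub; first exact: smallest_sigma_algebra.
  move=> _ [v [B [Sv mB ->]]]; apply: sub_sigma_algebra; exists [:: v], (fun=> B); split=> //.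
    by move=> u; rewrite inE => /eqP->.
  by apply/seteqP; split=> [eta H u|eta]; [rewrite inE => /eqP->|apply; rewrite inE].
apply: smallest_sub; first exact: smallest_sigma_algebra.
by move=> F /rect_ms.
Qed.

Lemma field_measure_unique S (m1 m2 : {measure set (field S) -> \bar R}) :
  (forall F, rect S F -> m1 F = m2 F) -> (m1 setT < +oo)%E ->
  forall F, ms S F -> m1 F = m2 F.
Proof.
have rT : rect S setT by exists [::], (fun=> setT); split=> //; apply/seteqP; split.
move=> h fin F mF; apply: (@measure_unique _ R (field S) (rect S) (fun=> setT)) => //.
- exact: rect_gen.
- exact: rectI.
- by apply/seteqP; split=> // x _; exists 0%N.
Qed.

Lemma measurable_coord S v : S v -> measurable_fun [set: field S] (fun eta : fld R => eta v).
Proof.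
by move=> Sv _ B mB; rewrite setTI; apply: (ms_cyl Sv).
Qed.

Lemma measurable_to_field d (T : measurableType d) S (X : T -> field S) :
  (forall v, S v -> measurable_fun setT (fun w => X w v)) -> measurable_fun setT X.
Proof.
move=> h; apply: (@measurability _ _ T (field S) setT X (cyl S)) => //.
move=> _ [_ [v [B [Sv mB ->]]] <-]; have := h v Sv measurableT B mB.
by rewrite !setTI.
Qed.

End Fields.

Section Law.
Variables (R : realType) (eps : R).
Hypothesis eps_gt0 : 0 < eps.
Local Notation field S := (g_sigma_algebraType (cyl S : set (set (fld R)))).
Local Notation gauss := (normal_prob (0 : R) eps).

Definition gaussian_rect (L : set (fld R) -> \bar R) :=
  forall (s : seq site) (B : site -> set R), uniq s -> (forall v, measurable (B v)) ->
    L [set eta : fld R | forall v, v \in s -> B v (eta v)] = (\prod_(v <- s) gauss (B v))%E.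

Variable L : {measure set (field [set: site]) -> \bar R}.
Hypothesis Lrect : gaussian_rect L.

Lemma LT : L setT = 1%E.
Proof.
have := @Lrect [::] (fun=> setT) isT (fun=> measurableT); rewrite big_nil => <-.
by congr (L _); apply/seteqP; split.
Qed.

Lemma L_unique (m : {measure set (field [set: site]) -> \bar R}) :
  gaussian_rect m -> forall F, ms setT F -> m F = L F.
Proof.
move=> mr F mF; apply/esym; apply: (field_measure_unique (S := setT)) => //.
  by move=> _ [s [B [us _ mB ->]]]; rewrite Lrect // mr.
by rewrite LT ltry.
Qed.

Lemma msT_sub S (F : set (fld R)) : ms S F -> ms setT F.
Proof. exact: ms_sub. Qed.

(** Site permutations cover translations, quarter turns and the exchange of two disjoint squares. *)
Lemma L_perm (pi pi' : site -> site) : cancel pi pi' -> cancel pi' pi ->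
  forall F, ms setT F -> L [set eta : fld R | F (eta \o pi)] = L F.
Proof.
move=> pK p'K F mF.
have mX : measurable_fun setT ((fun eta : fld R => eta \o pi) : field setT -> field setT).
  by apply: measurable_to_field => v _; exact: measurable_coord.
rewrite -[LHS](image_measureE L mX); apply: L_unique => // s B us mB.
rewrite image_measureE.
have -> : (fun eta : fld R => eta \o pi) @^-1` [set eta : fld R | forall v, v \in s -> B v (eta v)]
   = [set eta : fld R | forall v, v \in map pi s -> B (pi' v) (eta v)].
  apply/seteqP; split=> eta /= H v.
    by move=> /mapP[u us' ->]; rewrite pK; exact: H.
  by move=> vs; have := H _ (map_f pi vs); rewrite pK.
transitivity (\prod_(v <- map pi s) gauss (B (pi' v)))%E.
  by apply: (Lrect (B := B \o pi')) => [|v /=]; [rewrite map_inj_uniq //; exact: can_inj pK|].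
by rewrite big_map; apply: eq_bigr => v _; rewrite pK.
Qed.

Lemma L_indep S S' F G : S `&` S' = set0 -> ms S F -> ms S' G ->
  L (F `&` G) = (L F * L G)%E.
Proof.
move=> SS'.
(* One event is extended at a time: for fixed [E], both sides are finite measures in the other
   event, so agreement on rectangles suffices. *)
have gen (S1 S2 : set site) (E : set (fld R)) : ms setT E ->
   (forall F, rect S1 F -> L (F `&` E) = (L F * L E)%E) ->
   forall F, ms S1 F -> L (F `&` E) = (L F * L E)%E.
  move=> mE hE F0 mF0.
  have LEfin : L E \is a fin_num.
    rewrite ge0_fin_numE //; apply: le_lt_trans (ltry 1).
    by rewrite -LT; apply: le_measure; rewrite ?inE //; exact: msT.
  have r0 : 0 <= fine (L E) by rewrite fine_ge0.
  have mid : measurable_fun setT (idfun : field setT -> field S1).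
    by apply: measurable_to_field => v _; exact: measurable_coord.
  pose m1 : {measure set (field S1) -> \bar R} := image_measure (mrestr L mE) mid.
  pose m2 : {measure set (field S1) -> \bar R} := mscale (NngNum r0) (image_measure L mid).
  have m2E A : m2 A = (L A * L E)%E by rewrite /m2 /= /mscale /= fineK // muleC.
  rewrite -m2E -[LHS]/(m1 F0); apply: (field_measure_unique (S := S1)) => //.
    by move=> A rA; rewrite m2E -hE.
  rewrite image_measureE /= /mrestr /= preimage_setT setTI.
  by rewrite -ge0_fin_numE.
have rr F1 G1 : rect S F1 -> rect S' G1 -> L (F1 `&` G1) = (L F1 * L G1)%E.
  move=> [s [B [us sS mB ->]]] [s' [B' [us' sS' mB' ->]]].
  have dis v : v \in s -> v \notin s'.
    move=> vs; apply/negP => vs'; have : (S `&` S') v by split; [exact: sS|exact: sS'].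
    by rewrite SS'.
  rewrite !Lrect //.
  transitivity (L [set eta : fld R | forall v, v \in s ++ s' ->
       (if v \in s then B v else B' v) (eta v)]).
    congr (L _); apply/seteqP; split=> [eta [H H'] v|eta H].
      by rewrite mem_cat; case: ifP => [vs _|_ /= vs']; [exact: H|exact: H'].
    split=> v vs; have := H v; rewrite mem_cat vs ?orbT => /(_ isT) //.
    by case: ifP => // /dis; rewrite vs.
  transitivity (\prod_(v <- s ++ s') gauss (if v \in s then B v else B' v))%E.
    apply: (Lrect (B := fun v => if v \in s then B v else B' v)); last by move=> v; case: ifP.
    rewrite cat_uniq us us' andbT; apply/hasPn => v vs'; apply/negP => /dis.
    by rewrite vs'.
  rewrite big_cat /=; congr (_ * _)%E; apply: eq_big_seq => v vs; first by rewrite vs.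
  by case: ifP => // /dis; rewrite vs.
move=> mF mG; rewrite setIC muleC; apply: (gen S' S) => //; first exact: msT_sub mF.
move=> G1 rG1; rewrite setIC muleC; apply: (gen S S') => //.
  by apply: msT_sub; exact: rect_ms rG1.
by move=> F1 rF1; exact: rr.
Qed.

End Law.

(** * Cameron-Martin estimates *)

Lemma ge0_integral_lin2 d (T : measurableType d) (R : realType)
    (mu : {measure set T -> \bar R}) (a b : R) (f g : T -> R) :
  0 <= a -> 0 <= b -> (forall x, 0 <= f x) -> (forall x, 0 <= g x) ->
  measurable_fun setT f -> measurable_fun setT g ->
  (\int[mu]_x (a * f x + b * g x)%:E = a%:E * \int[mu]_x (f x)%:E + b%:E * \int[mu]_x (g x)%:E)%E.
Proof.
move=> a0 b0 f0 g0 mf mg; under eq_integral do rewrite EFinD !EFinM.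
have mf' : measurable_fun setT (EFin \o f) by exact/measurable_EFinP.
have mg' : measurable_fun setT (EFin \o g) by exact/measurable_EFinP.
rewrite ge0_integralD //.
- by congr (_ + _)%E; rewrite ge0_integralZl // => x _; rewrite lee_fin.
- by move=> x _; rewrite -EFinM lee_fin mulr_ge0.
- by apply: emeasurable_funM.
- by move=> x _; rewrite -EFinM lee_fin mulr_ge0.
- by apply: emeasurable_funM.
Qed.

Section Tilting.
Variables (R : realType) (eps : R).
Hypothesis eps_gt0 : 0 < eps.
Local Notation field S := (g_sigma_algebraType (cyl S : set (set (fld R)))).
Local Notation gauss := (normal_prob (0 : R) eps).
Variable L : {measure set (field [set: site]) -> \bar R}.
Hypothesis Lrect : gaussian_rect eps L.
Local Notation FT := (field [set: site]).

Lemma mcoord v : measurable_fun [set: FT] (fun eta : fld R => eta v).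
Proof. exact: measurable_coord. Qed.

Lemma L_coord_indep v (s : seq site) (B : site -> set R) (g : R -> R) :
  uniq (v :: s) -> (forall u, measurable (B u)) ->
  measurable_fun setT g -> (forall x, 0 <= g x) ->
  let E := [set eta : fld R | forall u, u \in s -> B u (eta u)] in
  (\int[L]_eta ((g (eta v))%:E * (\1_E eta)%:E) =
   (\prod_(u <- s) gauss (B u)) * \int[gauss]_x (g x)%:E)%E.
Proof.
move=> us mB mg g0 E.
have mE : measurable (E : set FT) by apply: ms_forall => u _; exact: ms_cyl.
have usq : uniq s by case/andP: us.
have LEE : L E = (\prod_(u <- s) gauss (B u))%E by rewrite Lrect.
have LEfin : L E \is a fin_num.
  rewrite ge0_fin_numE //; apply: le_lt_trans (ltry 1).
  by rewrite -(LT Lrect); apply: le_measure; rewrite ?inE //; exact: msT.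
have r0 : 0 <= fine (L E) by rewrite fine_ge0.
rewrite -(@ge0_integral_density _ FT R L (mrestr L mE) (\1_E)) //; last 3 first.
- by move=> A mA; rewrite integral_indic // setIC.
- by apply/measurable_EFinP; exact: measurableT_comp (mcoord v).
- by move=> x; rewrite lee_fin.
have mc : measurable_fun [set: FT] ((fun eta : fld R => eta v) : FT -> measurableTypeR R).
  exact: mcoord.
transitivity (\int[image_measure (mrestr L mE) mc]_x (g x)%:E)%E.
  by rewrite ge0_integral_pushforward //; [exact/measurable_EFinP|
     move=> y _; rewrite lee_fin].
transitivity (\int[mscale (NngNum r0) gauss]_x (g x)%:E)%E.
  apply: eq_measure_integral => A mA _; rewrite image_measureE /= /mrestr /mscale /= fineK // LEE.
  transitivity (L [set eta : fld R | forall u, u \in v :: s ->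
      (if u == v then A else B u) (eta u)]).
    congr (L _); apply/seteqP; split=> [eta [/= H H'] u|eta H].
      by rewrite inE; case: eqP => [-> _|_ /= ?] //; exact: H'.
    split=> [|u us'] /=; first by have := H v; rewrite inE eqxx; apply.
    have := H u; rewrite inE us' orbT => /(_ isT); case: eqP => // uv.
    by move: us; rewrite /= -uv us'.
  transitivity (\prod_(u <- v :: s) gauss (if u == v then A else B u))%E.
    by apply: (Lrect (B := fun u => if u == v then A else B u)) => // u; case: eqP.
  rewrite big_cons eqxx muleC; congr (_ * _)%E; apply: eq_big_seq => u us'.
  by case: eqP => // uv; move: us; rewrite /= -uv us'.
rewrite ge0_integral_mscale //=; last 2 first.
- exact/measurable_EFinP.
- by move=> x _; rewrite lee_fin.
by rewrite fineK // LEE.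
Qed.

Definition bump (v : site) (c : R) (eta : fld R) : fld R :=
  fun u => eta u + (if u == v then c else 0).

Lemma measurable_bump v c : measurable_fun [set: FT] (bump v c : FT -> FT).
Proof.
apply: measurable_to_field => u _; rewrite /bump.
by apply: measurable_funD; [exact: mcoord|exact: measurable_cst].
Qed.

Let mtilt v c : measurable_fun [set: FT] (fun eta : fld R => tilt eps c (eta v)).
Proof. by apply: (measurableT_comp (measurable_tilt eps c)); exact: mcoord. Qed.

(** Cameron-Martin at a single site. Both sides are finite measures in [F]; on a rectangle the
    factor of [v] splits off by independence and is given by [normal_prob_shift]. *)
Lemma L_bump v c F : ms setT F ->
  L (bump v c @^-1` F) = (\int[L]_(eta in F) (tilt eps c (eta v))%:E)%E.
Proof.
move=> mF; have t0 (eta : FT) : 0 <= tilt eps c (eta v) by exact: tilt_ge0.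
rewrite -(image_measureE L (measurable_bump v c)).
rewrite -[RHS]/(density_measure L t0 (mtilt v c) F).
apply: (field_measure_unique (S := setT)) => //; last first.
  by rewrite image_measureE preimage_setT (LT Lrect) ltry.
move=> _ [s [B [us _ mB ->]]]; rewrite image_measureE /density_measure /=.
pose s0 := [seq u <- s | u != v]; pose Bv := if v \in s then B v else setT.
have us0 : uniq (v :: s0) by rewrite /= filter_uniq // mem_filter eqxx.
have mBv : measurable Bv by rewrite /Bv; case: ifP.
pose E := [set eta : fld R | forall u, u \in s0 -> B u (eta u)].
have FE : [set eta : fld R | forall u, u \in s -> B u (eta u)] =
    [set eta : fld R | Bv (eta v)] `&` E.
  apply/seteqP; split=> [eta H|eta [/= H H'] u us'].
    split=> [|u]; first by rewrite /= /Bv; case: ifP => // /H.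
    by rewrite mem_filter => /andP[_ /H].
  have [uv|uv] := eqVneq u v; first by move: H; rewrite /Bv -uv us'.
  by apply: H'; rewrite mem_filter uv.
have mE : measurable (E : set FT) by apply: ms_forall => u _; exact: ms_cyl.
rewrite FE; pose Bc := [set x | Bv (x + c)].
transitivity (L [set eta : fld R | forall u, u \in v :: s0 ->
    (if u == v then Bc else B u) (eta u)]).
  congr (L _); apply/seteqP; split=> [eta [/= H H'] u|eta H].
    rewrite inE; case: eqP => [-> _|uv /= us']; first by move: H; rewrite /bump eqxx.
    by have := H' u us'; rewrite /bump; case: eqP => // _; rewrite addr0.
  split=> [|u us'] /=; rewrite /bump.
    by have := H v; rewrite inE !eqxx; apply.
  have := H u; rewrite inE us' orbT => /(_ isT).
  case: eqP us' => [->|uv us']; first by rewrite mem_filter eqxx.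
  by rewrite addr0.
have mshift : measurable Bc.
  have : measurable_fun setT (fun x : R => x + c) by exact: measurable_funD.
  by move=> /(_ measurableT _ mBv); rewrite setTI.
transitivity (\prod_(u <- v :: s0) gauss (if u == v then Bc else B u))%E.
  apply: (Lrect (B := fun u => if u == v then Bc else B u)) => // u.
  by case: eqP.
rewrite big_cons eqxx normal_prob_shift //.
have -> : (\prod_(u <- s0) gauss (if u == v then Bc else B u) =
           \prod_(u <- s0) gauss (B u))%E.
  by apply: eq_big_seq => u; rewrite mem_filter => /andP[/negbTE->].
have mg : measurable_fun setT (fun x => \1_Bv x * tilt eps c x).
  by apply: measurable_funM; [exact: measurable_indic|exact: measurable_tilt].
have g0 x : 0 <= \1_Bv x * tilt eps c x by rewrite mulr_ge0 // tilt_ge0.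
have := L_coord_indep us0 mB mg g0; rewrite -/E /= => H.
rewrite muleC; have -> : (\int[gauss]_(x in Bv) (tilt eps c x)%:E =
   \int[gauss]_x (\1_Bv x * tilt eps c x)%:E)%E.
  rewrite integral_mkcond; apply: eq_integral => x _.
  by rewrite patchE indicE; case: ifP => _; rewrite ?mul1r ?mul0r.
rewrite -H [RHS]integral_mkcond; apply: eq_integral => eta _.
rewrite patchE !indicE in_setI; case: (eta \in E); rewrite ?andbF ?mule0 // andbT mule1.
have -> : (eta \in [set eta0 : fld R | Bv (eta0 v)]) = (eta v \in Bv).
  by apply/idP/idP; rewrite !inE.
by case: ifP; rewrite ?mul1r ?mul0r.
Qed.

Lemma L_bump_fun v c (f : FT -> \bar R) : measurable_fun setT f -> (forall x, 0 <= f x)%E ->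
  (\int[L]_eta f (bump v c eta) = \int[L]_eta (f eta * (tilt eps c (eta v))%:E))%E.
Proof.
move=> mf f0.
rewrite -(@ge0_integral_density _ FT R L (image_measure L (measurable_bump v c))
  (fun eta => tilt eps c (eta v))) //.
- by rewrite (ge0_integral_pushforward (measurable_bump v c)).
- by move=> eta; exact: tilt_ge0.
- by move=> A mA; rewrite image_measureE; exact: L_bump.
Qed.

Definition shift (c : R) (s : seq site) (eta : fld R) : fld R :=
  fun u => eta u + (if u \in s then c else 0).

Definition rho (c : R) (s : seq site) (eta : fld R) : R := \prod_(v <- s) tilt eps c (eta v).

Lemma rho_ge0 c s eta : 0 <= rho c s eta.
Proof. by apply: prodr_ge0 => v _; exact: tilt_ge0. Qed.

Lemma measurable_rho c s : measurable_fun [set: FT] (rho c s).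
Proof.
by rewrite /rho; elim: s => [|v s IH];
  under eq_fun do rewrite ?big_nil ?big_cons; [exact: measurable_cst|exact: measurable_funM].
Qed.

Lemma measurable_shift c s : measurable_fun [set: FT] (shift c s : FT -> FT).
Proof.
apply: measurable_to_field => u _; rewrite /shift.
by apply: measurable_funD; [exact: mcoord|exact: measurable_cst].
Qed.

Lemma L_shift_fun c s (f : FT -> \bar R) : uniq s -> measurable_fun setT f ->
  (forall x, 0 <= f x)%E ->
  (\int[L]_eta f (shift c s eta) = \int[L]_eta (f eta * (rho c s eta)%:E))%E.
Proof.
elim: s f => [|v s IH] f /=.
  move=> _ mf f0; apply: eq_integral => eta _; rewrite /rho big_nil mule1; congr f.
  by apply/funext => u; rewrite /shift /= addr0.
move=> /andP[vs us] mf f0.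
have sE eta : shift c (v :: s) eta = bump v c (shift c s eta).
  apply/funext => u; rewrite /shift /bump inE; case: eqP => [->|_] /=.
    by rewrite (negbTE vs) addr0.
  by rewrite addr0.
have rE eta : rho c s (bump v c eta) = rho c s eta.
  apply: eq_big_seq => u us'; rewrite /bump; case: eqP => [uv|_]; last by rewrite addr0.
  by move: vs; rewrite -uv us'.
under eq_integral do rewrite sE.
rewrite (IH (f \o bump v c)) //=; last first.
- by apply: measurableT_comp => //; exact: measurable_bump.
under eq_integral do rewrite -rE.
rewrite (L_bump_fun v c (f := fun eta => f eta * (rho c s eta)%:E))%E.
- apply: eq_integral => eta _; rewrite /rho big_cons -muleA -EFinM; congr (_ * _%:E)%E.
  exact: mulrC.
- by apply: emeasurable_funM => //; apply/measurable_EFinP; exact: measurable_rho.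
- by move=> eta; rewrite mule_ge0 // lee_fin rho_ge0.
Qed.

(** Completing the square. As [rho (2 * c) s] is again a probability density, the exponential is the
    second moment of [rho c s]. *)
Lemma rho_sqr c s eta :
  rho c s eta ^+ 2 = expR (c ^+ 2 / eps ^+ 2 * (size s)%:R) * rho (2 * c) s eta.
Proof.
have e0 : eps != 0 by rewrite gt_eqF.
rewrite /rho; elim: s => [|v s IH]; first by rewrite !big_nil mulr0 expR0 expr1n mul1r.
rewrite !big_cons exprMn IH /= -[(size s).+1%:R]natr1 [_ * (_ + 1)]mulrDr mulr1 expRD.
have -> : tilt eps c (eta v) ^+ 2 = expR (c ^+ 2 / eps ^+ 2) * tilt eps (2 * c) (eta v).
  by rewrite /tilt expr2 -!expRD; congr expR; field.
by ring.
Qed.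

Lemma L_shift c s F : uniq s -> ms setT F ->
  L (shift c s @^-1` F) = (\int[L]_eta ((\1_F eta)%:E * (rho c s eta)%:E))%E.
Proof.
move=> us mF; have mi : measurable_fun [set: FT] (fun eta => (\1_F eta)%:E : \bar R).
  by apply/measurable_EFinP; exact: measurable_indic.
have i0 (x : FT) : (0 <= (\1_F x)%:E :> \bar R)%E by rewrite lee_fin.
rewrite -(L_shift_fun c us mi i0).
have mSF : measurable (shift c s @^-1` F : set FT).
  by have := measurable_shift c s measurableT mF; rewrite setTI.
by rewrite -[in LHS](setIT (_ @^-1` _)) -integral_indic.
Qed.

Definition pr (F : set (fld R)) : R := fine (L F).

Lemma prE F : ms setT F -> L F = (pr F)%:E.
Proof.
move=> mF; rewrite /pr fineK // ge0_fin_numE //; apply: le_lt_trans (ltry 1).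
by rewrite -(LT Lrect); apply: le_measure; rewrite ?inE //; exact: msT.
Qed.

Let mSF c s A : ms setT A -> ms setT (shift c s @^-1` A).
Proof. by move=> mA; have := measurable_shift c s measurableT mA; rewrite setTI. Qed.

Let mi A : ms setT A -> measurable_fun [set: FT] (\1_A : FT -> R).
Proof. by move=> mA; exact: measurable_indic. Qed.

Let pr_indic F : ms setT F -> (pr F)%:E = (\int[L]_eta (\1_F eta)%:E)%E.
Proof. by move=> mF; rewrite integral_indic // setIT prE. Qed.

Let pr_tilt c s F : uniq s -> ms setT F ->
  (pr (shift c s @^-1` F))%:E = (\int[L]_eta (\1_F eta * rho c s eta)%:E)%E.
Proof. by move=> us mF; rewrite -prE ?L_shift //; exact: mSF. Qed.

Let mir A c s : ms setT A -> measurable_fun [set: FT] (fun eta => \1_A eta * rho c s eta).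
Proof. by move=> mA; apply: measurable_funM; [exact: mi|exact: measurable_rho]. Qed.

Let irge A c s (x : FT) : 0 <= \1_A x * rho c s x.
Proof. by rewrite mulr_ge0 // rho_ge0. Qed.

(** Pointwise this is [(r - t) ^+ 2 >= 0] for the density [r]. It suits shifts of bounded but not
    small cost. *)
Lemma pr_shift1 c s t F : uniq s -> ms setT F -> 0 < t ->
  pr (shift c s @^-1` F) <= expR (c ^+ 2 / eps ^+ 2 * (size s)%:R) / (2 * t) + t / 2 * pr F.
Proof.
move=> us mF t0; set K := expR _.
have t2 : 0 <= (2 * t)^-1 by rewrite invr_ge0 mulr_ge0 // ltW.
have K0 : 0 <= K / (2 * t) by rewrite mulr_ge0 // expR_ge0.
have th : 0 <= t / 2 by rewrite divr_ge0 // ltW.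
have mT : ms setT (setT : set (fld R)) by exact: msT.
have prT : pr (shift (2 * c) s @^-1` setT) = 1 by rewrite /pr preimage_setT (LT Lrect).
have -> : K / (2 * t) + t / 2 * pr F =
    K / (2 * t) * pr (shift (2 * c) s @^-1` setT) + t / 2 * pr F by rewrite prT mulr1.
rewrite -lee_fin EFinD (EFinM (K / _)) (EFinM (t / 2)) (pr_indic mF) !pr_tilt //.
rewrite -(@ge0_integral_lin2 _ FT R L _ _ _ _ K0 th (irge setT (2 * c) s)
  (fun x => ler0n _ _ : 0 <= (\1_F x : R)) (mir (2 * c) s mT) (mi mF)).
apply: ge0_le_integral => //.
- by move=> x _; rewrite lee_fin irge.
- by apply/measurable_EFinP; exact: mir.
- by apply/measurable_EFinP; apply: measurable_funD; apply: measurable_funM => //; first [exact: mir|exact: mi].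
move=> eta _; rewrite lee_fin indicT mul1r.
have -> : K / (2 * t) * rho (2 * c) s eta = rho c s eta ^+ 2 / (2 * t).
  by rewrite rho_sqr /K; ring.
set r := rho c s eta.
rewrite indicE; case: (eta \in F); rewrite ?mul1r ?mul0r ?mulr1 ?mulr0; last first.
  by rewrite addr0 mulr_ge0 ?sqr_ge0.
rewrite -subr_ge0 (_ : _ - _ = (r - t) ^+ 2 / (2 * t)); last by field; rewrite gt_eqF.
by rewrite mulr_ge0 ?sqr_ge0.
Qed.

(** Pointwise this is [(r - 1 - t) ^+ 2 >= 0] on [G]. By invariance of [G] the density has on [G]
    mean [pr G] and second moment [K * pr G]. The gain over [pr_shift1] is the factor [pr G]: the
    shift is paid for only where [G] occurs. *)
Lemma pr_shift2 c s t F G : uniq s -> ms setT F -> ms setT G -> 0 < t ->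
  (forall c', shift c' s @^-1` G = G) ->
  pr (G `&` shift c s @^-1` F) - pr (G `&` F) <=
  pr G * ((expR (c ^+ 2 / eps ^+ 2 * (size s)%:R) - 1) / (2 * t) + t / 2).
Proof.
move=> us mF mG t0 invG; set K := expR _.
have mGF := msI mG mF.
have t2 : 0 <= (2 * t)^-1 by rewrite invr_ge0 mulr_ge0 // ltW.
have ti : 0 <= t^-1 by rewrite invr_ge0 ltW.
have th : 0 <= (2 * t)^-1 + t / 2 by rewrite addr_ge0 // divr_ge0 // ltW.
have K0 : 0 <= K / (2 * t) by rewrite mulr_ge0 // expR_ge0.
(* The cross term of the square is moved to the left, so that only nonnegative functions are
   integrated. *)
suff : pr (G `&` shift c s @^-1` F) + t^-1 * pr G <=
    pr (G `&` F) + 1 * (K / (2 * t) * pr G + ((2 * t)^-1 + t / 2) * pr G).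
  have -> : pr G * ((K - 1) / (2 * t) + t / 2) =
    1 * (K / (2 * t) * pr G + ((2 * t)^-1 + t / 2) * pr G) - t^-1 * pr G.
    by field; rewrite gt_eqF.
  by lra.
have e1 : (pr (G `&` shift c s @^-1` F))%:E =
    (\int[L]_eta (\1_(G `&` F) eta * rho c s eta)%:E)%E.
  by rewrite -pr_tilt // preimage_setI invG.
have e2 c' : (pr G)%:E = (\int[L]_eta (\1_G eta * rho c' s eta)%:E)%E.
  by rewrite -pr_tilt // invG.
have := @ge0_integral_lin2 _ FT R L 1 t^-1 _ _ ler01 ti (irge (G `&` F) c s) (irge G c s)
  (mir c s mGF) (mir c s mG).
rewrite -e1 -e2 -!EFinM -EFinD => E1.
have := @ge0_integral_lin2 _ FT R L (K / (2 * t)) ((2 * t)^-1 + t / 2) _ _ K0 th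
  (irge G (2 * c) s) (fun x => ler0n _ _ : 0 <= (\1_G x : R)) (mir (2 * c) s mG) (mi mG).
rewrite -e2 -pr_indic // -!EFinM -EFinD => E2.
pose f2 (x : FT) := K / (2 * t) * (\1_G x * rho (2 * c) s x) + ((2 * t)^-1 + t / 2) * \1_G x.
have f20 x : 0 <= f2 x by rewrite addr_ge0 // mulr_ge0 // irge.
have mf2 : measurable_fun setT f2.
  by apply: measurable_funD; apply: measurable_funM => //; first [exact: mir|exact: mi].
have := @ge0_integral_lin2 _ FT R L 1 1 _ _ ler01 ler01 (fun x => ler0n _ _ : 0 <= (\1_(G `&` F) x : R))
  f20 (mi mGF) mf2.
rewrite -pr_indic // E2 -!EFinM -EFinD => E3.
rewrite -[pr (G `&` shift c s @^-1` F)]mul1r -[pr (G `&` F)]mul1r -lee_fin -E1 -E3; apply: ge0_le_integral => //.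
- by move=> x _; rewrite lee_fin addr_ge0 // mulr_ge0 // irge.
- by apply/measurable_EFinP; apply: measurable_funD; apply: measurable_funM => //; exact: mir.
- by apply/measurable_EFinP; apply: measurable_funD; apply: measurable_funM => //; exact: mi.
move=> eta _; rewrite lee_fin /f2.
have -> : K / (2 * t) * (\1_G eta * rho (2 * c) s eta) = \1_G eta * (rho c s eta ^+ 2 / (2 * t)).
  by rewrite rho_sqr /K; ring.
set r := rho c s eta; rewrite !indicE in_setI.
case: (eta \in G); case: (eta \in F) => /=; rewrite ?mul1r ?mul0r ?mulr1 ?mulr0 ?add0r ?addr0 //.
- rewrite -subr_ge0 (_ : _ - _ = (r - 1 - t) ^+ 2 / (2 * t)); last by field; rewrite gt_eqF.
  by rewrite mulr_ge0 ?sqr_ge0.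
- rewrite -subr_ge0 (_ : _ - _ = ((r - 1) ^+ 2 + t ^+ 2) / (2 * t)); last by field; rewrite gt_eqF.
  by rewrite mulr_ge0 ?addr_ge0 ?sqr_ge0.
Qed.

End Tilting.

Local Open Scope fset_scope.
Local Open Scope ring_scope.

(** * Ground states of the isoperimetric energy *)

Definition nb (u v : site) : bool := v \in nbrs u.

Lemma nbE (u v : site) : nb u v =
  [|| (v.1 == u.1 + 1)%R && (v.2 == u.2), (v.1 == u.1 - 1)%R && (v.2 == u.2),
      (v.1 == u.1) && (v.2 == u.2 + 1)%R | (v.1 == u.1) && (v.2 == u.2 - 1)%R].
Proof. by case: v => c d; rewrite /nb !inE !xpair_eqE. Qed.

Lemma nb_sym (u v : site) : nb u v = nb v u.
Proof. by rewrite !nbE; lia. Qed.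

Lemma nbrs_uniq (u : site) : uniq (nbrs u).
Proof. by rewrite /= !inE !xpair_eqE; lia. Qed.

Section GroundStates.
Variable R : realType.
Implicit Types (A B D X Y Z : {fset site}) (eta : site -> R).

Lemma sum_fsetU (f : site -> R) A B : [disjoint A & B] ->
  \sum_(u <- A `|` B) f u = \sum_(u <- A) f u + \sum_(u <- B) f u.
Proof.
move=> dAB; rewrite -big_cat; apply: perm_big; apply: uniq_perm.
- exact: fset_uniq.
- rewrite cat_uniq !fset_uniq /= andbT; apply/hasPn => x xB; apply/negP => xA.
  by move/fdisjointP: dAB => /(_ _ xA); rewrite xB.
- by move=> x; rewrite mem_cat in_fsetU.
Qed.

Lemma sum_fset_le (f g : site -> R) A :
  (forall u, u \in A -> f u <= g u) -> \sum_(u <- A) f u <= \sum_(u <- A) g u.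
Proof.
move=> fg; rewrite big_seq_cond [leRHS]big_seq_cond; apply: ler_sum => u.
by rewrite andbT; exact: fg.
Qed.

Lemma sum_fset_eq (f g : site -> R) A :
  (forall u, u \in A -> f u = g u) -> \sum_(u <- A) f u = \sum_(u <- A) g u.
Proof.
by move=> fg; rewrite big_seq_cond [RHS]big_seq_cond; apply: eq_bigr => u /andP[/fg->].
Qed.

Lemma sum_fset_const (c : R) A : \sum_(u <- A) c = c * (#|` A|)%:R.
Proof. by rewrite big_const_seq count_predT iter_addr_0 mulr_natr. Qed.

Lemma sum_in_fset A (z : site) : \sum_(v <- A) (v == z)%:R = (z \in A)%:R :> R.
Proof.
have [zA|zA] := boolP (z \in A).
  rewrite (big_fsetD1 z) //= eqxx big_seq_cond big1 ?addr0 // => v.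
  by rewrite andbT in_fsetD1 => /andP[/negbTE->].
rewrite big_seq_cond big1 // => v; rewrite andbT => vA.
by case: eqP zA => // <-; rewrite vA.
Qed.

Definition edges (A B : {fset site}) : R :=
  \sum_(u <- A) \sum_(v <- nbrs u) (v \in B)%:R.

Lemma edgesE A B : edges A B = \sum_(u <- A) \sum_(z <- B) (nb u z)%:R.
Proof.
apply: eq_bigr => u _.
transitivity (\sum_(v <- nbrs u) \sum_(z <- B) (z == v)%:R : R).
  by apply: eq_bigr => v _; rewrite sum_in_fset.
rewrite exchange_big /=; apply: eq_bigr => z _; rewrite /nb.
have := nbrs_uniq u; elim: (nbrs u) => [|w s IH] /=; first by rewrite big_nil.
move=> /andP[ws us]; rewrite big_cons IH // inE.
case: eqP => [->|_] /=; last by rewrite add0r.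
by rewrite (negbTE ws) addr0.
Qed.

Lemma edgesC A B : edges A B = edges B A.
Proof.
rewrite !edgesE exchange_big; apply: eq_bigr => u _; apply: eq_bigr => v _.
by rewrite nb_sym.
Qed.

Lemma edges_ge0 A B : 0 <= edges A B.
Proof. by rewrite /edges; apply: sumr_ge0 => u _; apply: sumr_ge0. Qed.

Lemma edgesUl A B D : [disjoint A & B] -> edges (A `|` B) D = edges A D + edges B D.
Proof. exact: sum_fsetU. Qed.

Lemma edgesUr A B D : [disjoint A & B] -> edges D (A `|` B) = edges D A + edges D B.
Proof. by move=> d; rewrite edgesC edgesUl // ![edges _ D]edgesC. Qed.

Definition per A : R := \sum_(u <- A) \sum_(v <- nbrs u) (v \notin A)%:R.

Lemma perE A : per A = 4 * (#|` A|)%:R - edges A A.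
Proof.
rewrite -sum_fset_const /edges /per -sumrB; apply: eq_bigr => u _.
rewrite /= !big_cons !big_nil.
have e (b : bool) : (~~ b)%:R = 1 - b%:R :> R by case: b => /=; ring.
by rewrite !e; ring.
Qed.

Lemma perU A B : [disjoint A & B] -> per (A `|` B) = per A + per B - 2 * edges A B.
Proof.
move=> d; rewrite !perE edgesUl // !edgesUr // (edgesC B A).
have -> : (#|` A `|` B|)%:R = (#|` A|)%:R + (#|` B|)%:R :> R.
  by have := sum_fsetU (fun=> 1) d; rewrite !sum_fset_const !mul1r.
by ring.
Qed.

Lemma edges_le_per A B : [disjoint A & B] -> edges A B <= per A.
Proof.
move=> /fdisjointP d; apply: ler_sum => u _; apply: ler_sum => v _.
rewrite ler_nat; case vB: (v \in B) => //.
by case vA: (v \in A) => //; move: (d _ vA); rewrite vB.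
Qed.

Definition energy eta A : R := per A + \sum_(u <- A) eta u.

Lemma split3 A B : let X := A `\` B in let Y := A `&` B in let Z := B `\` A in
  [/\ A = X `|` Y, B = Z `|` Y & A `|` B = X `|` (Y `|` Z)] /\
  [/\ [disjoint X & Y], [disjoint Z & Y], [disjoint X & Z] & [disjoint X & Y `|` Z]].
Proof.
move=> X Y Z; split; split; try (by apply/fsetP => x; rewrite !inE; case: (x \in A); case: (x \in B)).
all: by apply/fdisjointP => x; rewrite !inE; case: (x \in A); case: (x \in B).
Qed.

(** The slack is twice the number of edges between the two differences; the fields balance
    exactly. *)
Lemma energy_submod eta A B :
  energy eta (A `&` B) + energy eta (A `|` B) <= energy eta A + energy eta B.
Proof.
have [[eA eB eU] [dXY dZY dXZ dXYZ]] := split3 A B.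
have dYZ : [disjoint A `&` B & B `\` A] by rewrite fdisjoint_sym.
have : energy eta A = energy eta ((A `\` B) `|` (A `&` B)) by rewrite -eA.
have : energy eta B = energy eta ((B `\` A) `|` (A `&` B)) by rewrite -eB.
rewrite eU => -> ->; rewrite /energy !sum_fsetU // !perU // edgesUr //.
rewrite [edges (A `&` B) (B `\` A)]edgesC.
by have := edges_ge0 (A `\` B) (B `\` A); lra.
Qed.

(** With opposite fields the contributions of the intersection cancel. The perimeters lose twice the
    excess of [per (A]&[B)] over its edges to the two differences. *)
Lemma energy_posimod eta A B :
  energy eta (A `\` B) + energy (fun v => - eta v) (B `\` A) <=
  energy eta A + energy (fun v => - eta v) B.
Proof.
have [[eA eB eU] [dXY dZY dXZ dXYZ]] := split3 A B.
have : energy eta A = energy eta ((A `\` B) `|` (A `&` B)) by rewrite -eA.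
have : energy (fun v => - eta v) B = energy (fun v => - eta v) ((B `\` A) `|` (A `&` B)).
  by rewrite -eB.
move=> -> ->; rewrite /energy !sum_fsetU // !perU // !sumrN.
have h1 : edges (A `&` B) ((A `\` B) `|` (B `\` A)) <= per (A `&` B).
  by apply: edges_le_per; apply/fdisjointP => x; rewrite !inE; case: (x \in A); case: (x \in B).
move: h1; rewrite edgesUr // ![edges (A `&` B) _]edgesC; lra.
Qed.

(** Every competitor of no larger energy must contain [A], so [A] is the least of the minimizers, a
    canonical choice. *)
Definition min_ground D eta A :=
  A `<=` D /\ forall B, B `<=` D ->
    energy eta A <= energy eta B /\ (energy eta B <= energy eta A -> A `<=` B).

Lemma min_ground_uniq D eta A B : min_ground D eta A -> min_ground D eta B -> A = B.
Proof.
move=> [AD hA] [BD hB]; apply/eqP; rewrite eqEfsubset.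
by rewrite (hA _ BD).2 ?(hB _ AD).2 // ?(hA _ BD).1 ?(hB _ AD).1.
Qed.

Lemma seq_argmin (T : eqType) (s : seq T) (f : T -> R) x : x \in s ->
  exists2 y, y \in s & forall z, z \in s -> f y <= f z.
Proof.
elim: s x => // a s IH x _; case: s IH => [_|b s IH].
  by exists a; rewrite ?inE // => z; rewrite inE => /eqP->.
have [y ys hy] := IH b (mem_head _ _).
have [ay|ya] := leP (f a) (f y).
  exists a; rewrite ?mem_head // => z; rewrite inE => /orP[/eqP->//|/hy].
  exact: le_trans.
exists y; first by rewrite inE ys orbT.
by move=> z; rewrite inE => /orP[/eqP->|/hy//]; exact: ltW.
Qed.

(** A minimizer of smallest cardinality lies in every other one, since by submodularity their
    intersection is again a minimizer. *)
Lemma min_ground_ex D eta : exists A, min_ground D eta A.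
Proof.
have in_pow B : B `<=` D -> B \in fpowerset D by rewrite fpowersetE.
have [A0 A0D hA0] := seq_argmin (energy eta) (in_pow _ (fsub0set D)).
pose s := [seq A <- fpowerset D | energy eta A <= energy eta A0].
have A0s : A0 \in s by rewrite mem_filter lexx.
have [A As hA] := seq_argmin (fun A => (#|` A|)%:R : R) A0s.
move: As; rewrite mem_filter => /andP[eA AD]; exists A; split; first by rewrite -fpowersetE.
move=> B BD; have le0 : energy eta A <= energy eta B by apply: le_trans eA (hA0 _ _); rewrite fpowersetE.
split => // BA.
have ABs : A `&` B \in s.
  rewrite mem_filter fpowersetE (fsubset_trans (fsubsetIr _ _) BD) andbT.
  have := energy_submod eta A B.
  have : energy eta A0 <= energy eta (A `|` B).
    by apply: hA0; rewrite fpowersetE fsubUset BD -fpowersetE AD.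
  by move: BA eA; lra.
have := hA _ ABs; rewrite ler_nat => leAB; apply/fsetIidPl/eqP.
by rewrite eqEfcard fsubsetIl.
Qed.

(* [ground D eta] is the set of minus spins of the largest ground state on [D] with + boundary
   condition and field [eta]; by spin flip, [ground D (- eta)] is the set of plus spins of the
   smallest ground state with - boundary condition. *)
Definition ground D eta : {fset site} := xget fset0 [set A | min_ground D eta A].

Lemma groundP D eta : min_ground D eta (ground D eta).
Proof. by apply: (@xgetPex _ fset0); exact: min_ground_ex. Qed.

Lemma groundE D eta A : min_ground D eta A -> ground D eta = A.
Proof. exact: min_ground_uniq (groundP _ _). Qed.

Lemma ground_sub D eta : ground D eta `<=` D.
Proof. by have [] := groundP D eta. Qed.

Lemma ground_min D eta B : B `<=` D -> energy eta (ground D eta) <= energy eta B.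
Proof. by have [_ h] := groundP D eta => /h[]. Qed.

Lemma ground_least D eta B : B `<=` D -> energy eta B <= energy eta (ground D eta) ->
  ground D eta `<=` B.
Proof. by have [_ h] := groundP D eta => /h[]. Qed.

Lemma energy_eq eta eta' A : (forall v, v \in A -> eta v = eta' v) ->
  energy eta A = energy eta' A.
Proof. by move=> h; rewrite /energy; congr (_ + _); apply: sum_fset_eq. Qed.

Lemma ground_local D eta eta' : (forall v, v \in D -> eta v = eta' v) ->
  ground D eta = ground D eta'.
Proof.
move=> h; apply: groundE; have [AD hA] := groundP D eta'; split => // B BD.
rewrite !(@energy_eq eta eta') => [||v vB]; first exact: hA.
  by move=> v vB; apply: h; exact: (fsubsetP BD).
by apply: h; exact: (fsubsetP AD).
Qed.

(** The union with [A'] is admissible in [D'] and cannot beat [A'], so by submodularity the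
    intersection is as good as [A]. Applied to both boundary conditions, this makes disagreement
    decrease with the domain. *)
Lemma ground_mono D D' eta : D `<=` D' -> ground D eta `<=` ground D' eta.
Proof.
move=> DD'; set A := ground D eta; set A' := ground D' eta.
have AD : A `<=` D := ground_sub _ _.
have h1 : energy eta A' <= energy eta (A `|` A').
  by apply: ground_min; rewrite fsubUset ground_sub andbT (fsubset_trans AD).
have : A `<=` A `&` A'.
  apply: ground_least; first exact: fsubset_trans (fsubsetIl _ _) AD.
  by have := energy_submod eta A A'; move: h1; rewrite -/A; lra.
by move/fsubset_trans; apply; exact: fsubsetIr.
Qed.

Lemma ground_anti D eta eta' : (forall v, v \in D -> eta v <= eta' v) ->
  ground D eta' `<=` ground D eta.
Proof.
move=> h; set A := ground D eta; set A' := ground D eta'.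
have A'D : A' `<=` D := ground_sub _ _; have AD : A `<=` D := ground_sub _ _.
have h1 : energy eta A <= energy eta (A' `|` A).
  by apply: ground_min; rewrite fsubUset A'D.
have : A' `<=` A' `&` A.
  apply: ground_least; first exact: fsubset_trans (fsubsetIl _ _) A'D.
  have h2 := energy_submod eta A' A.
  have e0 B : energy eta' B - energy eta B = \sum_(u <- B) (eta' u - eta u).
    by rewrite sumrB /energy; ring.
  have := e0 A'; have := e0 (A' `&` A).
  have [[e1 _ _] [d _ _ _]] := split3 A' A.
  have := sum_fsetU (fun u => eta' u - eta u) d; rewrite -e1.
  have : 0 <= \sum_(u <- A' `\` A) (eta' u - eta u).
    rewrite big_seq_cond; apply: sumr_ge0 => u; rewrite andbT inE => /andP[_ uA'].
    by rewrite subr_ge0; apply: h; exact: (fsubsetP A'D).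
  by move: h1 h2; rewrite -/A'; lra.
by move/fsubset_trans; apply; exact: fsubsetIr.
Qed.

(** Posimodularity lets one remove the common part of two minimizers without loss. It is stated for
    arbitrary minimizers because the event of the theorem ranges over arbitrary ground states. *)
Lemma ground_disj_min D eta A B : A `<=` D -> B `<=` D ->
  energy eta A <= energy eta (ground D eta) ->
  energy (fun v => - eta v) B <= energy (fun v => - eta v) (ground D (fun v => - eta v)) ->
  ground D eta `<=` A `\` B /\ ground D (fun v => - eta v) `<=` B `\` A.
Proof.
move=> AD BD hA hB; have := energy_posimod eta A B.
have sA : A `\` B `<=` D by apply: fsubset_trans AD; exact: fsubsetDl.
have sB : B `\` A `<=` D by apply: fsubset_trans BD; exact: fsubsetDl.
have := ground_min eta sA; have := ground_min (fun v => - eta v) sB.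
by split; apply: ground_least => //; lra.
Qed.

Lemma ground_disj D eta : [disjoint ground D eta & ground D (fun v => - eta v)].
Proof.
have [h _] := ground_disj_min (ground_sub D eta) (ground_sub D (fun v => - eta v)) (lexx _) (lexx _).
by apply/fdisjointP => x /(fsubsetP h); rewrite inE => /andP[].
Qed.

(* The set of sites where the extremal ground states on [D] for the fields [eta] (+ boundary)
   and [eta'] (- boundary) are + and - respectively, extended by the complement of [D]. *)
Definition diff D eta eta' (v : site) : bool :=
  (v \notin ground D eta) && (v \notin ground D (fun v => - eta' v)).

Lemma diff_mono D D' eta eta' v : D `<=` D' -> diff D' eta eta' v -> diff D eta eta' v.
Proof.
move=> DD' /andP[h1 h2]; apply/andP; split.
  by apply: contra h1; exact/fsubsetP/ground_mono.
by apply: contra h2; exact/fsubsetP/ground_mono.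
Qed.

Lemma diff_anti D eta eta' phi phi' v :
  (forall u, u \in D -> eta u <= phi u) -> (forall u, u \in D -> phi' u <= eta' u) ->
  diff D eta eta' v -> diff D phi phi' v.
Proof.
move=> h1 h2 /andP[g1 g2]; apply/andP; split.
  by apply: contra g1; exact/fsubsetP/ground_anti.
by apply: contra g2; apply/fsubsetP/ground_anti => u /h2; rewrite lerN2.
Qed.

Lemma diff_local D eta eta' phi phi' v :
  (forall u, u \in D -> eta u = phi u) -> (forall u, u \in D -> eta' u = phi' u) ->
  diff D eta eta' v = diff D phi phi' v.
Proof.
move=> h1 h2; rewrite /diff (@ground_local _ eta phi) //.
by rewrite (@ground_local _ (fun v => - eta' v) (fun v => - phi' v)) // => u /h2->.
Qed.

(* A set [I] shielded by plus spins is decoupled from the rest of the domain. *)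
Lemma ground_enclosed D D' I (G : pred site) eta :
  (forall u v, u \in I -> nb u v -> (v \in I) || G v) ->
  (forall v, G v -> v \notin ground D' eta) -> I `<=` D -> I `<=` D' ->
  forall v, v \in I -> v \in ground D' eta -> v \in ground D eta.
Proof.
move=> hI hG ID ID' v vI vM; set M := ground D' eta in hG vM.
pose X := M `&` I; pose Y := M `\` I.
have eM : M = X `|` Y by apply/fsetP => x; rewrite !inE; case: (x \in M); case: (x \in I).
have dI B : B `<=` I -> [disjoint B & Y].
  by move=> BI; apply/fdisjointP => x /(fsubsetP BI); rewrite !inE => ->.
have XI : X `<=` I := fsubsetIr _ _.
have eXY : edges X Y = 0.
  rewrite edgesE big_seq_cond big1 // => u; rewrite andbT inE => /andP[uM uI].
  rewrite big_seq_cond big1 // => z; rewrite andbT inE => /andP[zI zM].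
  case uz: (nb u z) => //; move: (hI _ _ uI uz); rewrite (negbTE zI) => /hG.
  by rewrite zM.
have EM : energy eta M = energy eta X + energy eta Y.
  by rewrite {1}eM /energy sum_fsetU ?dI // perU ?dI // eXY; ring.
have EB B : B `<=` I -> energy eta (B `|` Y) <= energy eta B + energy eta Y.
  move=> BI; rewrite /energy sum_fsetU ?dI // perU ?dI //.
  by have := edges_ge0 B Y; lra.
have BYD B : B `<=` I -> B `|` Y `<=` D'.
  move=> BI; rewrite fsubUset (fsubset_trans BI) //=.
  by apply: fsubset_trans (fsubsetDl _ _) (ground_sub _ _).
have XG : min_ground I eta X.
  split=> // B BI; have := ground_min eta (BYD _ BI); rewrite -/M EM => h.
  have := EB _ BI; split; first by lra.
  move=> hBX; have : M `<=` B `|` Y.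
    by apply: ground_least; [exact: BYD | rewrite -/M EM; lra].
  move/fsubsetP => s; apply/fsubsetP => x; rewrite inE => /andP[xM xI].
  by move: (s _ xM); rewrite !inE xI /= orbF.
apply: (fsubsetP (ground_mono eta ID)); rewrite (groundE XG).
by rewrite inE vM.
Qed.

(* Adding [A] to the minus spins of the + ground state for [eta], and to the plus spins of the
   - ground state for [eta'], cannot lower either energy; the fields cancel up to [eta' - eta]. *)
Lemma diff_isoperimetry D eta eta' A : A `<=` D ->
  (forall v, v \in A -> diff D eta eta' v) ->
  \sum_(u <- A) (eta' u - eta u) <=
  2 * \sum_(u <- A) \sum_(v <- nbrs u) ((v \notin A) && diff D eta eta' v)%:R.
Proof.
move=> AD hA; set M := ground D eta; set M' := ground D (fun v => - eta' v).
have d1 : [disjoint A & M].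
  by apply/fdisjointP => x /hA /andP[].
have d2 : [disjoint A & M'].
  by apply/fdisjointP => x /hA /andP[].
have h1 : energy eta M <= energy eta (A `|` M).
  by apply: ground_min; rewrite fsubUset AD ground_sub.
have h2 : energy (fun v => - eta' v) M' <= energy (fun v => - eta' v) (A `|` M').
  by apply: ground_min; rewrite fsubUset AD ground_sub.
have : per A - edges A M - edges A M' <=
    \sum_(u <- A) \sum_(v <- nbrs u) ((v \notin A) && diff D eta eta' v)%:R.
  rewrite /per /edges -!sumrB; apply: ler_sum => u _; rewrite -!sumrB.
  apply: ler_sum => v _; rewrite /diff -/M -/M'.
  move/fdisjointP: d1 => /(_ v); move/fdisjointP: d2 => /(_ v).
  case: (v \in A); case: (v \in M); case: (v \in M') => p q /=;
    first [by move: (p isT) | by move: (q isT) | lra].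
move: h1 h2; rewrite /energy !sum_fsetU // !perU // !sumrB !sumrN; lra.
Qed.

End GroundStates.

Local Close Scope fset_scope.

(** * The law of the field on events *)

Section Interface.
Variables (R : realType) (eps : R).
Local Notation field S := (g_sigma_algebraType (cyl S : set (set (fld R)))).

Definition gauss_law (p : set (fld R) -> R) := exists L : {measure set (field setT) -> \bar R},
  gaussian_rect eps L /\ p = pr L.

Hypothesis eps_gt0 : 0 < eps.
Variable p : set (fld R) -> R.
Hypothesis lawp : gauss_law p.
Implicit Types F G : set (fld R).

Lemma law_ge0 F : 0 <= p F.
Proof. by have [L [_ ->]] := lawp; exact: fine_ge0. Qed.

Lemma law_mono F G : ms setT F -> ms setT G -> F `<=` G -> p F <= p G.
Proof.
move=> mF mG FG; have [L [hL ->]] := lawp.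
by rewrite -lee_fin -!(prE hL) //; apply: le_measure; rewrite ?inE.
Qed.

Lemma lawT : p setT = 1.
Proof. by have [L [hL ->]] := lawp; rewrite /pr (LT hL). Qed.

Lemma law0 : p set0 = 0.
Proof. by have [L [hL ->]] := lawp; rewrite /pr measure0. Qed.

Lemma law_le1 F : ms setT F -> p F <= 1.
Proof. by move=> mF; rewrite -lawT; apply: law_mono => //; exact: msT. Qed.

Lemma lawU F G : ms setT F -> ms setT G -> F `&` G = set0 -> p (F `|` G) = p F + p G.
Proof.
move=> mF mG FG; have [L [hL ->]] := lawp; apply/EFin_inj.
by rewrite EFinD -!(prE hL) // ?measureU //; exact: msU.
Qed.

Lemma lawC F : ms setT F -> p (~` F) = 1 - p F.
Proof.
move=> mF; have := lawU mF (msC mF) (setICr F); rewrite setUv lawT; lra.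
Qed.

Lemma law_leU F G : ms setT F -> ms setT G -> p (F `|` G) <= p F + p G.
Proof.
move=> mF mG; have mGF : ms setT (G `\` F) by exact: msD.
have -> : F `|` G = F `|` (G `\` F).
  apply/seteqP; split=> x [Fx|]; [by left| |by left|by case; right].
  by have [Fx|nFx] := pselect (F x); [left|right; split].
rewrite lawU //; last by apply/seteqP; split=> x // [Fx []].
by rewrite lerD2l; apply: law_mono => // x [].
Qed.

Lemma law_exists (T : eqType) (s : seq T) (F : T -> set (fld R)) :
  (forall x, x \in s -> ms setT (F x)) ->
  p [set eta | exists2 x, x \in s & F x eta] <= \sum_(x <- s) p (F x).
Proof.
elim: s => [|a s IH] h.
  rewrite big_nil (_ : [set _ | _] = set0) ?law0 //.
  by apply/seteqP; split=> eta // [].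
have h' x : x \in s -> ms setT (F x) by move=> xs; apply: h; rewrite inE xs orbT.
rewrite big_cons (_ : [set _ | _] = F a `|` [set eta | exists2 x, x \in s & F x eta]).
  apply: le_trans (law_leU _ _) _; first by apply: h; rewrite mem_head.
    exact: ms_exists.
  by rewrite lerD2l; exact: IH.
apply/seteqP; split=> [eta [x]|eta [Fa|[x xs Fx]]].
- by rewrite inE => /orP[/eqP->|xs Fx]; [left|right; exists x].
- by exists a; rewrite ?mem_head.
- by exists x; rewrite ?inE ?xs ?orbT.
Qed.

Lemma law_union_le (T : eqType) (s : seq T) (F : T -> set (fld R)) (q : R) G :
  ms setT G -> (forall x, x \in s -> ms setT (F x)) -> (forall x, x \in s -> p (F x) <= q) ->
  (forall eta, G eta -> exists2 x, x \in s & F x eta) -> p G <= q * (size s)%:R.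
Proof.
move=> mG mF Fq GF; apply: le_trans (law_mono mG (ms_exists mF) GF) _.
apply: le_trans (law_exists mF) _.
apply: (@le_trans _ _ (\sum_(x <- s) q)); last first.
  by rewrite big_const_seq count_predT iter_addr_0 mulr_natr.
rewrite big_seq_cond [leRHS]big_seq_cond; apply: ler_sum => x /andP[xs _].
exact: Fq.
Qed.

Lemma law_indep S S' F G : S `&` S' = set0 -> ms S F -> ms S' G -> p (F `&` G) = p F * p G.
Proof.
move=> SS' mF mG; have [L [hL ->]] := lawp; apply/EFin_inj.
have mF' := msT_sub mF; have mG' := msT_sub mG.
by rewrite EFinM -!(prE hL) // ?(L_indep hL SS') //; exact: msI.
Qed.

Lemma law_indep_all (T : eqType) (s : seq T) (S : T -> set site) (F : T -> set (fld R)) (q : R) :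
  uniq s -> (forall x, x \in s -> ms (S x) (F x)) ->
  (forall x y, x \in s -> y \in s -> x != y -> S x `&` S y = set0) ->
  (forall x, x \in s -> p (F x) <= q) ->
  p [set eta | forall x, x \in s -> F x eta] <= q ^+ size s.
Proof.
elim: s => [|a s IH] us mF dis Fq.
  by apply: law_le1; rewrite (_ : [set _ | _] = setT); [exact: msT|apply/seteqP; split].
case/andP: us => as_ us.
have sub x : x \in s -> x \in a :: s by move=> xs; rewrite inE xs orbT.
rewrite (_ : [set _ | _] = F a `&` [set eta | forall x, x \in s -> F x eta]); last first.
  apply/seteqP; split=> [eta H|eta [Ha H] x].
    by split=> [|x xs]; apply: H; rewrite inE ?eqxx // xs orbT.
  by rewrite inE => /orP[/eqP->|/H].
rewrite (@law_indep (S a) (\bigcup_(x in [set x | x \in s]) S x)).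
- rewrite /= exprS; apply: ler_pM; try exact: law_ge0; first by apply: Fq; rewrite mem_head.
  by apply: IH => // [x /sub/mF|x y /sub xs /sub ys|x /sub/Fq] //; exact: dis.
- apply/seteqP; split=> // v [Sa [x /= xs Sx]].
  have ax : a != x by apply: contraNneq as_ => ->.
  have : (S a `&` S x) v by split.
  by rewrite (dis a x (mem_head _ _) (sub _ xs) ax).
- by apply: mF; rewrite mem_head.
- by apply: ms_forall => x xs; apply: ms_sub (mF x (sub _ xs)) => v Sv; exists x.
Qed.

Lemma law_perm (pi pi' : site -> site) : cancel pi pi' -> cancel pi' pi ->
  forall F, ms setT F -> p [set eta : fld R | F (eta \o pi)] = p F.
Proof.
by move=> pK p'K F mF; have [L [hL ->]] := lawp; rewrite /pr (L_perm hL pK p'K).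
Qed.

Lemma ms_perm (pi : site -> site) F : ms setT F -> ms setT [set eta : fld R | F (eta \o pi)].
Proof.
move=> mF; have mX : measurable_fun setT
    ((fun eta : fld R => eta \o pi) : field setT -> field setT).
  by apply: measurable_to_field => v _; exact: measurable_coord.
by have := mX measurableT _ mF; rewrite setTI.
Qed.

Lemma ms_shift c s F : ms setT F -> ms setT [set eta : fld R | F (shift c s eta)].
Proof. by move=> mF; have := measurable_shift c s measurableT mF; rewrite setTI. Qed.

Lemma law_shift1 c s t F : uniq s -> ms setT F -> 0 < t ->
  p [set eta | F (shift c s eta)] <=
  expR (c ^+ 2 / eps ^+ 2 * (size s)%:R) / (2 * t) + t / 2 * p F.
Proof. by have [L [hL ->]] := lawp; exact: pr_shift1. Qed.

Lemma law_shift2 c s t F G : uniq s -> ms setT F -> ms setT G -> 0 < t ->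
  (forall c' eta, G (shift c' s eta) <-> G eta) ->
  p [set eta | G eta /\ F (shift c s eta)] - p (G `&` F) <=
  p G * ((expR (c ^+ 2 / eps ^+ 2 * (size s)%:R) - 1) / (2 * t) + t / 2).
Proof.
move=> us mF mG t0 invG; have [L [hL ->]] := lawp; apply: pr_shift2 => // c'.
by apply/seteqP; split=> eta /= H; have [h1 h2] := invG c' eta; [exact: h1|exact: h2].
Qed.

(** The ground set equals [A] when finitely many inequalities between energies hold, and each energy
    is a finite sum of field values. *)
Lemma mdisc_ground (S : set site) (D : {fset site}) (f : fld R -> fld R) :
  (forall v, v \in D -> measurable_fun [set: field S] (fun eta : fld R => f eta v)) ->
  mdisc S (fun eta => ground D (f eta)).
Proof.
move=> mf A.
have mE (B : {fset site}) : (B `<=` D)%fset ->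
    measurable_fun [set: field S] (fun eta : fld R => energy (f eta) B).
  move=> BD; rewrite /energy; apply: measurable_funD; first exact: measurable_cst.
  have : {subset enum_fset B <= D} by exact/fsubsetP.
  elim: (enum_fset B) => [|v s IH] sD.
    by under eq_fun do rewrite big_nil; exact: measurable_cst.
  under eq_fun do rewrite big_cons; apply: measurable_funD.
    by apply: mf; apply: sD; rewrite mem_head.
  by apply: IH => u us; apply: sD; rewrite inE us orbT.
have [AD|AD] := boolP (A `<=` D)%fset; last first.
  rewrite (_ : [set _ | _] = set0); first exact: ms0.
  by apply/seteqP; split=> eta //= E; move: AD; rewrite -E ground_sub.
have mle B C : (B `<=` D)%fset -> (C `<=` D)%fset ->
   ms S [set eta : fld R | energy (f eta) B <= energy (f eta) C].
  move=> /mE mB /mE mC; have mt : measurable [set true] by [].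
  by have := measurable_fun_ler mB mC measurableT mt; rewrite setTI.
rewrite (_ : [set _ | _] = [set eta : fld R | forall B, B \in fpowerset D ->
    ([set eta : fld R | energy (f eta) A <= energy (f eta) B] `&`
     (if A `<=` B then setT else ~` [set eta : fld R | energy (f eta) B <= energy (f eta) A])%fset) eta]).
  apply: ms_forall => B; rewrite fpowersetE => BD; apply: msI; first exact: mle.
  by case: ifP => _; [exact: msT|apply: msC; exact: mle].
apply/seteqP; split=> eta /=.
  move=> <- B; rewrite fpowersetE => BD; split; first exact: ground_min.
  by case: ifP => // /negP AB /(ground_least BD).
move=> H; apply: groundE; split=> // B BD.
have BP : B \in fpowerset D by rewrite fpowersetE.
have [h1 h2] := H B BP; split=> // BA.
by move: h2; case: ifP => // _ /(_ BA).
Qed.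

End Interface.

Local Open Scope fset_scope.
Local Open Scope ring_scope.

(** * Planar crossings *)

Ltac nblia := rewrite ?nbE /=; lia.

(* Parity of the number of horizontal edges of a path crossing the upward vertical ray that
   starts from [z] shifted by [1/2] to the right. *)
Definition hedge (z u v : site) : bool :=
  [&& u.2 == v.2, z.2 < u.2 & ((u.1 == z.1) && (v.1 == z.1 + 1)) ||
                              ((u.1 == z.1 + 1) && (v.1 == z.1))].

Fixpoint ray_parity (z x : site) (p : seq site) : bool :=
  if p is y :: p' then hedge z x y (+) ray_parity z y p' else false.

(** An edge counted from [z] but not from the site above it has that site as an endpoint, and the
    path avoids it. *)
Lemma ray_parity_up (z x : site) p : (z.1, z.2 + 1) \notin x :: p ->
  ray_parity z x p = ray_parity (z.1, z.2 + 1) x p.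
Proof.
elim: p x => //= y p IH x; rewrite inE negb_or => /andP[xz zp]; rewrite IH //; congr (_ (+) _).
move: zp; rewrite inE negb_or => /andP[yz _].
move: x y z xz yz {IH} => [x1 x2] [y1 y2] [z1 z2]; rewrite /hedge !xpair_eqE /=; lia.
Qed.

(** The two rays bound the half-column above [(z.1 + 1, z.2)]. A path avoiding its base enters and
    leaves it only through the rays, so the parities differ according to which ends of the path lie
    inside. *)
Lemma ray_parity_right (z x : site) p : path nb x p -> (z.1 + 1, z.2) \notin x :: p ->
  ray_parity z x p (+) ray_parity (z.1 + 1, z.2) x p =
  ((x.1 == z.1 + 1) && (z.2 < x.2)) (+) (((last x p).1 == z.1 + 1) && (z.2 < (last x p).2)).
Proof.
elim: p x => [|y p IH] x /=; first by rewrite addbb.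
move=> /andP[xy yp]; rewrite inE negb_or => /andP[xz zp].
have := IH y yp zp.
have : hedge z x y (+) hedge (z.1 + 1, z.2) x y =
   ((x.1 == z.1 + 1) && (z.2 < x.2)) (+) ((y.1 == z.1 + 1) && (z.2 < y.2)).
  move: zp; rewrite inE negb_or => /andP[yz _].
  move: x y z xz yz xy {IH yp} => [x1 x2] [y1 y2] [z1 z2]; rewrite nbE /hedge !xpair_eqE /=.
  by move=> h1 h2 /or4P[] /andP[/eqP e1 /eqP e2]; move: h1 h2; rewrite e1 e2 {e1 e2}; lia.
by move=> h1 h2; rewrite addbACA h1 h2 -addbA addKb.
Qed.

Lemma ray_parity_below (z x : site) p : path nb x p ->
  (forall u, u \in x :: p -> z.2 < u.2) ->
  ray_parity z x p = (x.1 <= z.1) (+) ((last x p).1 <= z.1).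
Proof.
elim: p x => [|y p IH] x /=; first by rewrite addbb.
move=> /andP[xy yp] H; rewrite IH // => [|u up]; last by apply: H; rewrite inE up orbT.
have hx := H x (mem_head _ _); have hy : z.2 < y.2 by apply: H; rewrite !inE eqxx orbT.
have -> : hedge z x y = (x.1 <= z.1) (+) (y.1 <= z.1).
  move: xy; rewrite nbE /hedge; lia.
by rewrite -addbA addKb.
Qed.

Lemma ray_parity_above (z x : site) p : (forall u, u \in x :: p -> u.2 <= z.2) ->
  ray_parity z x p = false.
Proof.
elim: p x => [|y p IH] x //= H; rewrite IH // => [|u up]; last by apply: H; rewrite inE up orbT.
have hx := H x (mem_head _ _); rewrite /hedge; lia.
Qed.

(** A discrete Jordan argument. If the paths were disjoint, the parity would be constant along [q];
    but it is odd at the start of [q], which is below [p] and between its ends, and even at the end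
    of [q], which is above [p]. *)
Lemma cross_axis (x y : site) p q : path nb x p -> path nb y q ->
  (forall z, z \in y :: q -> x.1 < z.1 < (last x p).1) ->
  (forall z, z \in x :: p -> y.2 < z.2 < (last y q).2) ->
  exists2 z, z \in x :: p & z \in y :: q.
Proof.
move=> xp yq hq hp.
have [/hasP[z zp zq]|/hasPn H] := boolP (has (mem (y :: q)) (x :: p)); first by exists z.
exfalso.
have step u v : nb u v -> u \in y :: q -> v \in y :: q -> ray_parity u x p = ray_parity v x p.
  move=> uv uq vq.
  have up : u \notin x :: p by apply/negP => /H /negP; apply.
  have vp : v \notin x :: p by apply/negP => /H /negP; apply.
  have hu := hq _ uq; have hv := hq _ vq.
  move: uv; rewrite nbE => /or4P[] /andP[/eqP e1 /eqP e2].
  - have ev : v = (u.1 + 1, u.2) by rewrite -e1 -e2; case: (v).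
    have := ray_parity_right (z := u) xp; rewrite -ev => /(_ vp).
    have [h1 h2] := andP hv; rewrite -e1 (lt_eqF h1) (gt_eqF h2) /=.
    by case: (ray_parity u x p); case: (ray_parity v x p).
  - have ev : u = (v.1 + 1, v.2) by rewrite e1 e2 subrK; case: (u).
    have := ray_parity_right (z := v) xp; rewrite -ev => /(_ up).
    have -> : v.1 + 1 = u.1 by rewrite e1 subrK.
    have [h1 h2] := andP hu; rewrite (lt_eqF h1) (gt_eqF h2) /=.
    by case: (ray_parity u x p); case: (ray_parity v x p).
  - have ev : v = (u.1, u.2 + 1) by rewrite -e1 -e2; case: (v).
    by rewrite ev; apply: ray_parity_up; rewrite -ev.
  - have ev : u = (v.1, v.2 + 1) by rewrite e1 e2 subrK; case: (u).
    by rewrite ev; apply/esym/ray_parity_up; rewrite -ev.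
have const s u : path nb u s -> {subset u :: s <= y :: q} ->
    ray_parity u x p = ray_parity (last u s) x p.
  elim: s u => //= v s IH u /andP[uv vs] sub.
  rewrite (step u v uv); last 2 first.
  - by apply: sub; rewrite mem_head.
  - by apply: sub; rewrite !inE eqxx orbT.
  by apply: IH => // w ws; apply: sub; rewrite inE ws orbT.
have := const q y yq (fun=> id).
rewrite (ray_parity_below xp) => [|u /hp/andP[]//].
rewrite ray_parity_above => [|u /hp/andP[_ /ltW]//].
have /andP[h1 h2] := hq y (mem_head _ _).
by rewrite (ltW h1) leNgt h2.
Qed.

(** Reading sites as Gaussian integers, [uu a z] and [ww a z] are the real and imaginary parts of
    the conjugate of [a] times [z]. *)
Definition uu (a z : site) : int := a.1 * z.1 + a.2 * z.2.
Definition ww (a z : site) : int := a.1 * z.2 - a.2 * z.1.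

Lemma path_ext_front (d : site) (n : nat) (x : site) p :
  (forall u : site, nb (u.1 + d.1, u.2 + d.2) u) -> path nb x p ->
  exists2 p', path nb (x.1 + n%:Z * d.1, x.2 + n%:Z * d.2) p' /\
    last (x.1 + n%:Z * d.1, x.2 + n%:Z * d.2) p' = last x p &
    forall z, z \in (x.1 + n%:Z * d.1, x.2 + n%:Z * d.2) :: p' ->
      z \in x :: p \/ exists2 i : nat, (0 < i <= n)%N & z = (x.1 + i%:Z * d.1, x.2 + i%:Z * d.2).
Proof.
move=> hd xp; elim: n => [|n [p' [pp' lp'] hp']].
  exists p; first by rewrite !mul0r !addr0; case: (x) xp.
  by move=> z; rewrite !mul0r !addr0; case: (x) => ? ? ?; left.
exists ((x.1 + n%:Z * d.1, x.2 + n%:Z * d.2) :: p') => /=.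
  rewrite pp' andbT; split=> //.
  have := hd (x.1 + n%:Z * d.1, x.2 + n%:Z * d.2); rewrite /=.
  by congr (nb (_, _) _); rewrite intS; ring.
move=> z; rewrite inE => /orP[/eqP->|/hp' [|[i /andP[i0 ilt] ->]]]; [right|by left|right].
  by exists n.+1; rewrite ?ltnSn.
by exists i; rewrite // i0 leqW.
Qed.

Lemma path_ext_back (d : site) (n : nat) (x : site) p :
  (forall u : site, nb u (u.1 + d.1, u.2 + d.2)) -> path nb x p ->
  exists2 p', path nb x p' /\ last x p' = ((last x p).1 + n%:Z * d.1, (last x p).2 + n%:Z * d.2) &
    forall z, z \in x :: p' -> z \in x :: p \/
      exists2 i : nat, (0 < i <= n)%N & z = ((last x p).1 + i%:Z * d.1, (last x p).2 + i%:Z * d.2).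
Proof.
move=> hd xp; elim: n => [|n [p' [pp' lp'] hp']].
  exists p; last by left.
  by rewrite !mul0r !addr0; case: (last x p).
set l := last x p in lp' hp' *.
exists (rcons p' (l.1 + n.+1%:Z * d.1, l.2 + n.+1%:Z * d.2)).
  rewrite rcons_path last_rcons pp' lp'; split=> //=.
  have := hd (l.1 + n%:Z * d.1, l.2 + n%:Z * d.2); rewrite /=.
  by congr (nb _ (_, _)); rewrite intS; ring.
move=> z; rewrite inE mem_rcons in_cons orbCA -in_cons => /orP[/eqP->|].
  by right; exists n.+1; rewrite ?ltnSn.
move=> /hp' [|[i /andP[i0 ilt] ->]]; [by left|right].
by exists i; rewrite // i0 leqW.
Qed.

(** The first inequality forces [0 < a2], the second [a2 < 0]: this is why a horizontal and a
    vertical prolongation cannot meet. *)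
Lemma ray_key (a1 a2 i j : int) : 0 < a1 -> 0 < i -> 0 < j ->
  a1 * i <= a2 * j -> a1 * j <= - (a2 * i) -> False.
Proof.
move=> a0 i0 j0 h1 h2.
have a2j : 0 < a2 * j by apply: lt_le_trans h1; exact: mulr_gt0.
have a20 : 0 < a2 by rewrite -(pmulr_lgt0 _ j0).
have := mulr_gt0 a0 j0; have := mulr_gt0 a20 i0; lia.
Qed.

Lemma rays_disjoint (a X Y : site) (i j s t : int) : 0 < a.1 -> 0 < i -> 0 < j ->
  s * s = 1 -> t * t = 1 -> Y = (X.1 + s * i, X.2 - t * j) ->
  s * (uu a Y - uu a X) <= 0 -> 0 <= t * (ww a Y - ww a X) -> False.
Proof.
move=> a0 i0 j0 ss tt ->; rewrite /uu /ww /= => h1 h2.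
apply: (@ray_key a.1 (s * t * a.2) i j a0 i0 j0).
  rewrite -subr_le0; apply: le_trans h1; rewrite le_eqVlt; apply/orP; left; apply/eqP.
  transitivity (s * s * a.1 * i - s * t * a.2 * j); last by ring.
  by rewrite ss mul1r.
rewrite -subr_ge0; apply: le_trans h2 _; rewrite le_eqVlt; apply/orP; left; apply/eqP.
transitivity (- (t * t * a.1 * j) - s * t * a.2 * i); first by ring.
by rewrite tt mul1r; ring.
Qed.

Lemma ww_vert (a y : site) (j : int) : ww a (y.1, y.2 + j) = ww a y + a.1 * j.
Proof. by rewrite /ww /=; ring. Qed.

Lemma uu_hor (a y : site) (j : int) : uu a (y.1 + j, y.2) = uu a y + a.1 * j.
Proof. by rewrite /uu /=; ring. Qed.

Lemma nb_front (d u : site) : d \in [:: (-1, 0); (0, -1); (1, 0); (0, 1)] ->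
  nb (u.1 + d.1, u.2 + d.2) u.
Proof. by rewrite !inE => /or4P[] /eqP->; nblia. Qed.

Lemma nb_back (d u : site) : d \in [:: (-1, 0); (0, -1); (1, 0); (0, 1)] ->
  nb u (u.1 + d.1, u.2 + d.2).
Proof. by move=> h; rewrite nb_sym nb_front. Qed.

Lemma pair_eq_l (z : site) (x1 x2 i : int) (j : int) (s t : int) :
  x1 + s * i = z.1 -> x2 = z.2 + t * j -> z = (x1 + s * i, x2 - t * j).
Proof. by case: z => z1 z2 /= <- ->; rewrite addrK. Qed.

Lemma ext_bound (bd : nat) (X X' L L' Z : int) : (`|X| + `|X'| <= bd)%N ->
  (`|L| + `|L'| <= bd)%N -> (`|Z| <= bd)%N ->
  X + (2 * bd).+1%:Z * -1 < Z < L + (2 * bd).+1%:Z * 1.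
Proof. lia. Qed.

(* The ends of [p] are prolonged horizontally and those of [q] vertically; the prolongations
   leave the strips containing the other path and do not meet each other. *)
Lemma cross_pos (a x y : site) p q (ulo uhi wlo whi : int) : 0 < a.1 ->
  path nb x p -> path nb y q ->
  (forall z, z \in x :: p -> wlo <= ww a z <= whi) -> uu a x <= ulo -> uhi <= uu a (last x p) ->
  (forall z, z \in y :: q -> ulo <= uu a z <= uhi) -> ww a y <= wlo -> whi <= ww a (last y q) ->
  exists2 z, z \in x :: p & z \in y :: q.
Proof.
move=> a0 xp yq hp ux ul hq wy wl.
have [bd bdE] : exists bd : nat, forall z, z \in x :: p \/ z \in y :: q -> (`|z.1| + `|z.2| <= bd)%N.
  exists (\sum_(z <- x :: p ++ y :: q) (`|z.1| + `|z.2|)%N)%N => z zz.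
  have : z \in x :: p ++ y :: q.
    by case: zz; rewrite -cat_cons mem_cat => ->; rewrite ?orbT.
  by move=> zin; rewrite (big_rem z) //=; exact: leq_addr.
(* Long enough for each prolonged end to leave the box of radius [bd] around the origin, which
   contains both paths. *)
pose n := (2 * bd).+1.
have [p1 [pp1 lp1] hp1] := @path_ext_front (-1, 0) n x p (fun u => @nb_front (-1, 0) u isT) xp.
have [p2 [pp2 lp2] hp2] := @path_ext_back (1, 0) n _ p1 (fun u => @nb_back (1, 0) u isT) pp1.
have [q1 [qq1 lq1] hq1] := @path_ext_front (0, -1) n y q (fun u => @nb_front (0, -1) u isT) yq.
have [q2 [qq2 lq2] hq2] := @path_ext_back (0, 1) n _ q1 (fun u => @nb_back (0, 1) u isT) qq1.
rewrite /= ?mulr0 ?addr0 in lp1 lp2 hp1 hp2 lq1 lq2 hq1 hq2 pp1 pp2 qq1 qq2.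
set lP := last x p in ul lp1 lp2 hp2; set lQ := last y q in wl lq1 lq2 hq2.
rewrite lp1 in lp2 hp2; rewrite lq1 in lq2 hq2.
have lPin : lP \in x :: p by exact: mem_last.
have lQin : lQ \in y :: q by exact: mem_last.
have memP z : z \in (x.1 + n%:Z * -1, x.2) :: p2 -> z \in x :: p \/
    exists2 i : nat, (0 < i <= n)%N & z = (x.1 - i%:Z, x.2) \/ z = (lP.1 + i%:Z, lP.2).
  move=> /hp2 [/hp1 [|[i hi ->]]|[i hi ->]]; [by left|right|right]; exists i => //.
    by left; congr (_, _); rewrite /= ?mulr0 ?addr0 ?mulrN1.
  by right; congr (_, _); rewrite /= ?mulr0 ?addr0 ?mulr1.
have memQ z : z \in (y.1, y.2 + n%:Z * -1) :: q2 -> z \in y :: q \/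
    exists2 i : nat, (0 < i <= n)%N & z = (y.1, y.2 - i%:Z) \/ z = (lQ.1, lQ.2 + i%:Z).
  move=> /hq2 [/hq1 [|[i hi ->]]|[i hi ->]]; [by left|right|right]; exists i => //.
    by left; congr (_, _); rewrite /= ?mulr0 ?addr0 ?mulrN1.
  by right; congr (_, _); rewrite /= ?mulr0 ?addr0 ?mulr1.
have bx := bdE _ (or_introl (mem_head x p)); have by_ := bdE _ (or_intror (mem_head y q)).
have blP := bdE _ (or_introl lPin); have blQ := bdE _ (or_intror lQin).
have [||z zP zQ] := cross_axis pp2 qq2.
- move=> z /memQ Hz; rewrite lp2 /=.
  have : (`|z.1| <= bd)%N.
    case: Hz => [zq|[i _ [->|->]]] /=; apply: leq_trans (leq_addr _ _) _; [|exact: by_|exact: blQ].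
    exact: bdE (or_intror zq).
  exact: ext_bound bx blP.
- move=> z /memP Hz; rewrite lq2 /=.
  have : (`|z.2| <= bd)%N.
    case: Hz => [zq|[i _ [->|->]]] /=; apply: leq_trans (leq_addl _ _) _; [|exact: bx|exact: blP].
    exact: bdE (or_introl zq).
  by apply: (@ext_bound bd _ y.1 _ lQ.1); rewrite addnC.
have hx := hp _ (mem_head _ _); have hlP := hp _ lPin.
have hy := hq _ (mem_head _ _); have hlQ := hq _ lQin.
move: (memP _ zP) (memQ _ zQ) => [zp|[i /andP[i0 _] ei]] [zq|[j /andP[j0 _] ej]].
- by exists z.
- exfalso; have /andP[hz1 hz2] := hp _ zp; have aj := mulr_gt0 a0 (j0 : (0 < j%:Z)).
  move: ej hz1 hz2 => [->|->]; rewrite ww_vert; last by clear -wl aj; lia.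
  by clear -wy aj; lia.
- exfalso; have /andP[hz1 hz2] := hq _ zq; have ai := mulr_gt0 a0 (i0 : (0 < i%:Z)).
  move: ei hz1 hz2 => [->|->]; rewrite uu_hor; last by clear -ul ai; lia.
  by clear -ux ai; lia.
exfalso; have i0' : 0 < i%:Z by []. have j0' : 0 < j%:Z by [].
have K := rays_disjoint a0 i0' j0'.
move: ei ej => [->|->] [|] [e1 e2].
- apply: (K x y (-1) (-1)) => //; first by (apply: pair_eq_l; rewrite ?mulN1r ?mul1r).
    by clear -ux hy; lia.
  by clear -wy hx; lia.
- apply: (K x lQ (-1) 1) => //; first by (apply: pair_eq_l; rewrite ?mulN1r ?mul1r).
    by clear -ux hlQ; lia.
  by clear -wl hx; lia.
- apply: (K lP y 1 (-1)) => //; first by (apply: pair_eq_l; rewrite ?mulN1r ?mul1r).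
    by clear -ul hy; lia.
  by clear -wy hlP; lia.
- apply: (K lP lQ 1 1) => //; first by (apply: pair_eq_l; rewrite ?mulN1r ?mul1r).
    by clear -ul hlQ; lia.
  by clear -wl hlP; lia.
Qed.

Definition rot (z : site) : site := (- z.2, z.1).

Lemma nb_rot u v : nb (rot u) (rot v) = nb u v.
Proof. by rewrite !nbE /rot /=; lia. Qed.

Lemma uu_rot a z : uu (rot a) (rot z) = uu a z.
Proof. by rewrite /uu /rot /=; ring. Qed.

Lemma ww_rot a z : ww (rot a) (rot z) = ww a z.
Proof. by rewrite /ww /rot /=; ring. Qed.

Lemma rot_inj : injective rot.
Proof. by move=> [a b] [c d] [/oppr_inj-> ->]. Qed.

Lemma cross_tilted (a x y : site) p q (ulo uhi wlo whi : int) : a != (0, 0) ->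
  path nb x p -> path nb y q ->
  (forall z, z \in x :: p -> wlo <= ww a z <= whi) -> uu a x <= ulo -> uhi <= uu a (last x p) ->
  (forall z, z \in y :: q -> ulo <= uu a z <= uhi) -> ww a y <= wlo -> whi <= ww a (last y q) ->
  exists2 z, z \in x :: p & z \in y :: q.
Proof.
pose claim b := forall x y p q,
  path nb x p -> path nb y q ->
  (forall z, z \in x :: p -> wlo <= ww b z <= whi) -> uu b x <= ulo -> uhi <= uu b (last x p) ->
  (forall z, z \in y :: q -> ulo <= uu b z <= uhi) -> ww b y <= wlo -> whi <= ww b (last y q) ->
  exists2 z, z \in x :: p & z \in y :: q.
(* A quarter turn of direction and paths together changes neither coordinate, so the case [0 < a.1]
   gives all directions. *)
have step b : claim (rot b) -> claim b.
  move=> H x' y' p' q' xp yq hp ux ul hq wy wl.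
  have mp (t : seq site) u : path nb u t -> path nb (rot u) (map rot t).
    by move=> ut; rewrite path_map; apply: sub_path ut => v v'; rewrite /= nb_rot.
  have h1 z : z \in rot x' :: map rot p' -> wlo <= ww (rot b) z <= whi.
    by rewrite -map_cons => /mapP[z' z'p ->]; rewrite ww_rot; exact: hp.
  have h2 z : z \in rot y' :: map rot q' -> ulo <= uu (rot b) z <= uhi.
    by rewrite -map_cons => /mapP[z' z'p ->]; rewrite uu_rot; exact: hq.
  have := H _ _ _ _ (mp _ _ xp) (mp _ _ yq) h1.
  rewrite !last_map !uu_rot !ww_rot => /(_ ux ul h2 wy wl) [z].
  rewrite -!map_cons => /mapP[z' z'p ->]; rewrite (mem_map rot_inj) => z'q.
  by exists z'.
have pos b : 0 < b.1 -> claim b.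
  by move=> b0 x' y' p' q' *; exact: (@cross_pos b x' y' p' q' ulo uhi wlo whi).
have neg b : b.1 < 0 -> claim b.
  by move=> b0; apply: (step _); apply: (step _); apply: pos; rewrite /= oppr_gt0.
move=> a0; suff : claim a by exact.
case: (ltgtP a.1 0) => [/neg//|/pos//|a10].
case: (ltgtP a.2 0) => [a2|a2|a20].
- by apply: step; apply: pos; rewrite /= oppr_gt0.
- by apply: step; apply: neg; rewrite /= oppr_lt0.
- by move: a0 a10 a20; case: (a) => ? ? /= /[swap] -> /[swap] ->; rewrite eqxx.
Qed.

(** * Tilted squares and crossings *)

Section Equivariance.
Variable R : realType.
Implicit Types (A B D : {fset site}) (eta : site -> R).

Definition fimg (f : site -> site) A : {fset site} := [fset f x | x in A].

Lemma mem_fimg f A x : injective f -> (f x \in fimg f A) = (x \in A).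
Proof.
move=> fi; apply/imfsetP/idP => [[y /= yA /fi ->]//|xA]; by exists x.
Qed.

Lemma sum_fimg f A (F : site -> R) : injective f ->
  \sum_(u <- fimg f A) F u = \sum_(u <- A) F (f u).
Proof.
move=> fi; rewrite -(big_map f xpredT F); apply: perm_big; apply: uniq_perm.
- exact: fset_uniq.
- by rewrite map_inj_uniq // fset_uniq.
- move=> x; apply/imfsetP/mapP => -[y yA ->]; by exists y.
Qed.

Lemma energy_fimg f A eta : injective f -> (forall u v, nb (f u) (f v) = nb u v) ->
  energy eta (fimg f A) = energy (eta \o f) A.
Proof.
move=> fi fnb; rewrite /energy sum_fimg //; congr (_ + _).
have cE B : (#|` B|)%:R = \sum_(u <- B) 1 :> R by rewrite sum_fset_const mul1r.
rewrite !perE !edgesE !cE !sum_fimg //; congr (_ - _); apply: eq_bigr => u _.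
by rewrite sum_fimg //; apply: eq_bigr => v _; rewrite fnb.
Qed.

Lemma ground_fimg f f' D eta : cancel f f' -> cancel f' f ->
  (forall u v, nb (f u) (f v) = nb u v) ->
  ground (fimg f D) eta = fimg f (ground D (eta \o f)).
Proof.
move=> fK f'K fnb; have fi := can_inj fK; apply: groundE.
have sub A B : A `<=` B -> fimg f A `<=` fimg f B.
  move=> /fsubsetP AB; apply/fsubsetP => _ /imfsetP[x /= xA ->].
  by rewrite mem_fimg //; exact: AB.
have bk B : B = fimg f (fimg f' B).
  apply/fsetP => x; rewrite -{1}[x]f'K -[in RHS](f'K x) mem_fimg // f'K.
  by rewrite mem_fimg //; exact: can_inj f'K.
split; first exact/sub/ground_sub.
move=> B; have [B' ->] : exists B', B = fimg f B' by exists (fimg f' B).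
move=> BD; rewrite !energy_fimg //.
have BD' : B' `<=` D.
  apply/fsubsetP => x xB; rewrite -(mem_fimg D x fi); apply: (fsubsetP BD).
  by rewrite mem_fimg.
by split; [exact: ground_min|move=> h; apply: sub; exact: ground_least].
Qed.

Lemma diff_fimg f f' D eta eta' v : cancel f f' -> cancel f' f ->
  (forall x y, nb (f x) (f y) = nb x y) ->
  diff (fimg f D) eta eta' (f v) = diff D (eta \o f) (eta' \o f) v.
Proof.
move=> fK f'K fnb; have fi := can_inj fK.
by rewrite /diff !(ground_fimg _ _ fK f'K fnb) !mem_fimg.
Qed.

End Equivariance.

Definition trn (t z : site) : site := (z.1 + t.1, z.2 + t.2).
Definition opps (t : site) : site := (- t.1, - t.2).

Lemma trnK t : cancel (trn t) (trn (opps t)).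
Proof. by case=> a b; rewrite /trn /= !addrK. Qed.

Lemma trnVK t : cancel (trn (opps t)) (trn t).
Proof. by case=> a b; rewrite /trn /= !subrK. Qed.

Lemma nb_trn t u v : nb (trn t u) (trn t v) = nb u v.
Proof. by rewrite !nbE /trn /=; lia. Qed.

Definition rotV (z : site) : site := (z.2, - z.1).
Lemma rotK : cancel rot rotV. Proof. by case=> a b; rewrite /rot /rotV /= opprK. Qed.
Lemma rotVK : cancel rotV rot. Proof. by case=> a b; rewrite /rot /rotV /= opprK. Qed.

Definition nrm2 (a : site) : int := a.1 * a.1 + a.2 * a.2.
Definition nrm1 (a : site) : int := `|a.1| + `|a.2|.

(* Coordinates of [z] relative to [x], along [a] and along [rot a], in units of [1 / |a|]. *)
Definition ru (a x z : site) : int := uu a z - uu a x.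
Definition rw (a x z : site) : int := ww a z - ww a x.

Lemma nrm2_rot a : nrm2 (rot a) = nrm2 a.
Proof. by rewrite /nrm2 /rot /=; ring. Qed.
Lemma nrm1_rot a : nrm1 (rot a) = nrm1 a.
Proof. by rewrite /nrm1 /rot /= normrN addrC. Qed.
Lemma ru_rot a x z : ru (rot a) x z = rw a x z.
Proof. by rewrite /ru /rw /uu /ww /rot /=; ring. Qed.
Lemma rw_rot a x z : rw (rot a) x z = - ru a x z.
Proof. by rewrite /ru /rw /uu /ww /rot /=; ring. Qed.
Lemma ru_trn a t x z : ru a (trn t x) (trn t z) = ru a x z.
Proof. by rewrite /ru /uu /trn /=; ring. Qed.
Lemma rw_trn a t x z : rw a (trn t x) (trn t z) = rw a x z.
Proof. by rewrite /rw /ww /trn /=; ring. Qed.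
Lemma ru_rot2 a x z : ru (rot a) (rot x) (rot z) = ru a x z.
Proof. by rewrite /ru /uu /rot /=; ring. Qed.
Lemma rw_rot2 a x z : rw (rot a) (rot x) (rot z) = rw a x z.
Proof. by rewrite /rw /ww /rot /=; ring. Qed.

Lemma ru_step a x u v : nb u v -> `|ru a x v - ru a x u| <= nrm1 a.
Proof.
rewrite nbE /ru /uu /nrm1 => /or4P[] /andP[/eqP-> /eqP->].
all: by case: a => a1 a2; rewrite /= !mulrDr ?mulrN ?mulr1; lia.
Qed.

Lemma rw_step a x u v : nb u v -> `|rw a x v - rw a x u| <= nrm1 a.
Proof. by move=> h; rewrite -!ru_rot -nrm1_rot; exact: ru_step. Qed.

Definition insq (a x : site) (r : int) (z : site) : bool :=
  (`|ru a x z| <= r * nrm2 a) && (`|rw a x z| <= r * nrm2 a).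

Definition boxf (c : site) (n : nat) : {fset site} :=
  [fset trn c z | z in box n].

Lemma mem_box n (z : site) : (z \in box n) = (`|z.1| <= n%:Z) && (`|z.2| <= n%:Z).
Proof.
apply/allpairsP/andP => [[[i j] [hi hj ->]]|[h1 h2]].
  by move: hi hj; rewrite !mem_iota !add0n -muln2 /=; lia.
exists (absz (z.1 + n%:Z), absz (z.2 + n%:Z)); rewrite !mem_iota !add0n -muln2 /=.
split; [lia|lia|].
by case: z h1 h2 => a b /= h1 h2; congr (_, _); lia.
Qed.

Lemma mem_boxf c n (z : site) : (z \in boxf c n) = (`|z.1 - c.1| <= n%:Z) && (`|z.2 - c.2| <= n%:Z).
Proof.
apply/imfsetP/idP => [[y /=]|].
  by rewrite mem_box => h ->; rewrite /trn /= !addrK.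
move=> h; exists (z.1 - c.1, z.2 - c.2); first by rewrite /= mem_box.
by rewrite /trn /= !subrK; case: z {h}.
Qed.

Lemma card_boxf (x : site) n : (#|` boxf x n| <= (n.*2.+1) ^ 2)%N.
Proof.
apply: leq_trans (leq_imfset_card _ _ _) _.
by apply: leq_trans (size_undup (box n)) _; rewrite size_allpairs size_iota mulnn.
Qed.

Lemma nrm2_gt0 (a : site) : a != (0, 0) -> 0 < nrm2 a.
Proof.
case: a => a b; rewrite xpair_eqE negb_and /nrm2 /= => /orP[] h.
  by have := sqr_ge0 b; have : 0 < a ^+ 2; rewrite ?expr2; [rewrite -expr2 exprn_even_gt0|lia].
by have := sqr_ge0 a; have : 0 < b ^+ 2; rewrite ?expr2; [rewrite -expr2 exprn_even_gt0|lia].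
Qed.

Lemma insq_bound (a x : site) r (z : site) : a != (0, 0) -> insq a x r z ->
  (`|z.1 - x.1| <= r * nrm1 a) && (`|z.2 - x.2| <= r * nrm1 a).
Proof.
move=> /nrm2_gt0 W0 /andP[hu hw].
have r0 : 0 <= r.
  by rewrite leNgt; apply/negP => r0; have := mulr_gt0 W0 (_ : 0 < - r); rewrite oppr_gt0 => /(_ r0);
    clear -hu; lia.
have aux (b1 b2 s : int) : `|s * nrm2 a| <= `|b1| * (r * nrm2 a) + `|b2| * (r * nrm2 a) ->
    `|s| <= r * (`|b1| + `|b2|).
  rewrite normrM (gtr0_norm W0) -mulrDl mulrA ler_pM2r // => h.
  by rewrite mulrC.
apply/andP; split.
- apply: aux.
  have -> : (z.1 - x.1) * nrm2 a = a.1 * ru a x z - a.2 * rw a x z.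
    by rewrite /ru /rw /uu /ww /nrm2; ring.
  apply: le_trans (ler_normB _ _) _; rewrite !normrM.
  by apply: lerD; apply: ler_wpM2l.
- rewrite /nrm1 (addrC (`|a.1|)); apply: aux.
  have -> : (z.2 - x.2) * nrm2 a = a.2 * ru a x z + a.1 * rw a x z.
    by rewrite /ru /rw /uu /ww /nrm2; ring.
  apply: le_trans (ler_normD _ _) _; rewrite !normrM.
  by apply: lerD; apply: ler_wpM2l.
Qed.

Definition sq (a x : site) (r : int) : {fset site} :=
  [fset z in boxf x (absz (r * nrm1 a)) | insq a x r z].

Lemma mem_sq (a x : site) r (z : site) : a != (0, 0) -> (z \in sq a x r) = insq a x r z.
Proof.
move=> a0; rewrite !inE /= andbC; case H: (insq a x r z) => //=.
by rewrite mem_boxf; have := insq_bound a0 H; lia.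
Qed.

Lemma rot_neq0 (a : site) : a != (0, 0) -> rot a != (0, 0).
Proof. by case: a => a b; rewrite /rot !xpair_eqE /= oppr_eq0 andbC. Qed.

Lemma sq_trn (a x : site) r t : a != (0, 0) -> fimg (trn t) (sq a x r) = sq a (trn t x) r.
Proof.
move=> a0; apply/fsetP => z; rewrite -(trnVK t z) mem_fimg ?mem_sq //; last exact: can_inj (trnK t).
by rewrite /insq ru_trn rw_trn.
Qed.

Lemma sq_rot (a : site) r : a != (0, 0) -> fimg rot (sq a (0, 0) r) = sq a (0, 0) r.
Proof.
move=> a0; apply/fsetP => z; rewrite -(rotVK z) mem_fimg ?mem_sq //; last exact: rot_inj.
rewrite /insq -(ru_rot2 a) -(rw_rot2 a) ru_rot rw_rot normrN andbC.
by congr (_ && _); congr (`| _ | <= _); rewrite /ru /rw /uu /ww /rot /=; ring.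
Qed.

Opaque sq.

Section Crossing.
Variable R : realType.
Implicit Types (D : {fset site}) (eta : site -> R).

(* A crossing in the direction [a] of a rectangle with sides [8 |a|] and [2 |a|]. *)
Definition hard_cross (a x : site) D eta := exists (y : site) (p : seq site),
  [/\ path nb y p,
      forall z, z \in y :: p -> [/\ diff D eta eta z, nrm2 a <= rw a x z <= 3 * nrm2 a &
                                   `|ru a x z| <= 5 * nrm2 a],
      ru a x y <= - (4 * nrm2 a) & 4 * nrm2 a <= ru a x (last y p)].

Lemma hard_cross_map f f' a b x D eta : cancel f f' -> cancel f' f ->
  (forall u v, nb (f u) (f v) = nb u v) ->
  nrm2 b = nrm2 a -> (forall z, ru b (f x) (f z) = ru a x z) ->
  (forall z, rw b (f x) (f z) = rw a x z) ->
  hard_cross a x D (eta \o f) -> hard_cross b (f x) (fimg f D) eta.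
Proof.
move=> fK f'K fnb hn hu hw [y [p [yp hp h1 h2]]]; exists (f y), (map f p).
rewrite last_map hn !hu; split=> //.
  by rewrite path_map; apply: sub_path yp => u v; rewrite /= fnb.
move=> z; rewrite -map_cons => /mapP[z' /hp[d1 d2 d3] ->].
by rewrite hu hw (diff_fimg _ _ _ _ fK f'K fnb).
Qed.

Lemma hard_cross_trn a x D eta t : hard_cross a x D (eta \o trn t) ->
  hard_cross a (trn t x) (fimg (trn t) D) eta.
Proof.
apply: (hard_cross_map (trnK t) (trnVK t) (nb_trn t)) => // z; first exact: ru_trn.
exact: rw_trn.
Qed.

Lemma hard_cross_rot a D eta : hard_cross a (0, 0) D (eta \o rot) ->
  hard_cross (rot a) (0, 0) (fimg rot D) eta.
Proof.
have {2}-> : (0, 0) = rot (0, 0) by rewrite /rot /= oppr0.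
apply: (hard_cross_map rotK rotVK nb_rot); first exact: nrm2_rot.
  by move=> z; exact: ru_rot2.
by move=> z; exact: rw_rot2.
Qed.

(** Thus a bound on crossings in a small square around the rectangle, which is an event of the field
    in that square, serves for every larger domain. *)
Lemma hard_cross_mono a x D D' eta : D `<=` D' -> hard_cross a x D' eta -> hard_cross a x D eta.
Proof.
move=> DD' [y [p [yp hp h1 h2]]]; exists y, p; split=> // z /hp[d1 d2 d3]; split=> //.
exact: diff_mono d1.
Qed.

Lemma hard_cross_local a x D eta eta' : (forall v, v \in D -> eta v = eta' v) ->
  hard_cross a x D eta -> hard_cross a x D eta'.
Proof.
move=> h [y [p [yp hp h1 h2]]]; exists y, p; split=> // z /hp[d1 d2 d3]; split=> //.
by rewrite -(diff_local z h h).
Qed.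

Definition ring_cross a x D eta :=
  [/\ hard_cross a x D eta, hard_cross (rot a) x D eta,
      hard_cross (rot (rot a)) x D eta & hard_cross (rot (rot (rot a))) x D eta].

Lemma norm_step (A B W n : int) : `|B - A| <= n -> n <= W -> `|A| < 3 * W -> `|B| <= 4 * W.
Proof. lia. Qed.

Lemma lt3_le4 (A W : int) : 0 < W -> `|A| < 3 * W -> `|A| <= 4 * W.
Proof. lia. Qed.

Lemma hard_cross_blocks (b x : site) D eta (v : site) q : b != (0, 0) -> hard_cross b x D eta ->
  path nb v q -> (forall z, z \in v :: q -> ~~ diff D eta eta z) ->
  (forall z, z \in v :: q -> `|ru b x z| <= 4 * nrm2 b) ->
  rw b x v <= nrm2 b -> 3 * nrm2 b <= rw b x (last v q) -> False.
Proof.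
move=> b0 [y [p [yp hp h1 h2]]] vq hG hu hv hl.
have [z||||||z zp zq] := @cross_tilted b y v p q (uu b x - 4 * nrm2 b) (uu b x + 4 * nrm2 b)
  (ww b x + nrm2 b) (ww b x + 3 * nrm2 b) b0 yp vq.
- by move=> /hp[_ + _]; rewrite /rw; clear; lia.
- by move: h1; rewrite /ru; clear; lia.
- by move: h2; rewrite /ru; clear; lia.
- by move=> z /hu; rewrite /ru; clear; lia.
- by move: hv; rewrite /rw; clear; lia.
- by move: hl; rewrite /rw; clear; lia.
- by have [d _ _] := hp z zp; move: (hG z zq); rewrite d.
Qed.

(** At its first exit from the square of radius 3 the path is still within radius 4, since one step
    is at most [nrm1 a <= nrm2 a]. There one of the four crossings is long enough to be met. *)
Lemma ring_blocks (a x : site) D eta (v : site) q : a != (0, 0) -> nrm1 a <= nrm2 a ->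
  ring_cross a x D eta -> path nb v q -> (forall z, z \in v :: q -> ~~ diff D eta eta z) ->
  `|ru a x v| < nrm2 a -> `|rw a x v| < nrm2 a ->
  forall z, z \in v :: q -> (`|ru a x z| < 3 * nrm2 a) && (`|rw a x z| < 3 * nrm2 a).
Proof.
move=> a0 aW [r0 r1 r2 r3] + + uv wv.
have W0 := nrm2_gt0 a0.
elim/last_ind: q => [_ _ z|q z IH].
  by rewrite inE => /eqP->; apply/andP; split; [clear -uv W0|clear -wv W0]; lia.
rewrite rcons_path => /andP[vq qz] hG.
have sub u : u \in v :: q -> u \in v :: rcons q z.
  by rewrite !inE mem_rcons inE => /orP[->//|->]; rewrite !orbT.
have {}IH := IH vq (fun u h => hG u (sub u h)).
suff hz : (`|ru a x z| < 3 * nrm2 a) && (`|rw a x z| < 3 * nrm2 a).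
  move=> u; rewrite inE mem_rcons inE orbCA => /orP[/eqP->//|h]; apply: IH; by rewrite inE.
have vqz : path nb v (rcons q z) by rewrite rcons_path vq.
have /andP[lu lw] := IH _ (mem_last v q).
have su := ru_step a x qz; have sw := rw_step a x qz.
have bu u : u \in v :: rcons q z -> (`|ru a x u| <= 4 * nrm2 a) /\ (`|rw a x u| <= 4 * nrm2 a).
  rewrite inE mem_rcons inE orbCA => /orP[/eqP->|h].
    by split; [exact: norm_step su aW lu|exact: norm_step sw aW lw].
  have /IH/andP[] : u \in v :: q by rewrite inE.
  by clear -W0; lia.
have K b : b != (0, 0) -> hard_cross b x D eta -> nrm2 b = nrm2 a ->
    (forall u, u \in v :: rcons q z -> `|ru b x u| <= 4 * nrm2 a) -> rw b x v <= nrm2 a ->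
    rw b x z < 3 * nrm2 a.
  move=> b0 hb nb hu hv; rewrite ltNge; apply/negP => hl.
  by apply: (hard_cross_blocks b0 hb vqz hG); rewrite ?last_rcons ?nb.
have k0 : rw a x z < 3 * nrm2 a.
  by apply: K => // [u /bu[]//|]; clear -wv; lia.
have k1 : rw (rot a) x z < 3 * nrm2 a.
  apply: K => //; first exact: rot_neq0.
  - exact: nrm2_rot.
  - by move=> u /bu[_]; rewrite ru_rot.
  - by rewrite rw_rot; clear -uv; lia.
have k2 : rw (rot (rot a)) x z < 3 * nrm2 a.
  apply: K => //; first by do 2 apply: rot_neq0.
  - by rewrite !nrm2_rot.
  - by move=> u /bu[+ _]; rewrite ru_rot rw_rot normrN.
  - by rewrite rw_rot ru_rot; clear -wv; lia.
have k3 : rw (rot (rot (rot a))) x z < 3 * nrm2 a.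
  apply: K => //; first by do 3 apply: rot_neq0.
  - by rewrite !nrm2_rot.
  - by move=> u /bu[_]; rewrite ru_rot rw_rot ru_rot normrN.
  - by rewrite rw_rot ru_rot rw_rot; clear -uv; lia.
by move: k0 k1 k2 k3; rewrite !(rw_rot, ru_rot); clear; lia.
Qed.

(** The sites reached from [v] off the disagreement set are bounded by sites without spins of
    [ground D zeta], hence decoupled from the rest of [D]. Together with [ground_mono] this makes
    the state at [v] a function of the field in [sq a x 4]. *)
Lemma ring_encloses (a x : site) D (eta zeta : site -> R) (v : site) : a != (0, 0) -> nrm1 a <= nrm2 a ->
  (forall z, diff D eta eta z -> z \notin ground D zeta) ->
  ring_cross a x D eta -> sq a x 4 `<=` D ->
  `|ru a x v| < nrm2 a -> `|rw a x v| < nrm2 a ->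
  v \in ground D zeta -> v \in ground (sq a x 4) zeta.
Proof.
move=> a0 aW hz hr sD uv wv vM; have W0 := nrm2_gt0 a0.
pose reach z := exists2 q, path nb v q /\ last v q = z &
  forall u, u \in v :: q -> ~~ diff D eta eta u.
pose I := [fset z in sq a x 4 | `[< reach z >]].
have IE z : (z \in I) = (z \in sq a x 4) && `[< reach z >] by rewrite inE.
have reachP z : reach z -> z \in I.
  move=> rz; rewrite IE; apply/andP; split; last exact/asboolP.
  have [q [vq <-] hq] := rz; rewrite mem_sq //; have := ring_blocks a0 aW hr vq hq uv wv (mem_last v q).
  by move=> /andP[h1 h2]; apply/andP; split; exact: lt3_le4 W0 _.
apply: (@ground_enclosed _ (sq a x 4) D I (fun z => diff D eta eta z)) => //.
- move=> u z; rewrite IE => /andP[_ /asboolP[q [vq <-] hq]] uz.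
  have [//|nd] := boolP (diff D eta eta z); rewrite ?orbT // orbF; apply: reachP.
  exists (rcons q z); first by rewrite rcons_path vq last_rcons.
  move=> w; rewrite inE mem_rcons inE orbCA => /orP[/eqP->//|h]; apply: hq; by rewrite inE.
- by apply/fsubsetP => z; rewrite IE => /andP[].
- by apply: fsubset_trans sD; apply/fsubsetP => z; rewrite IE => /andP[].
- apply: reachP; exists [::] => // u; rewrite inE => /eqP->.
  by apply/negP => /hz; rewrite vM.
Qed.

End Crossing.

(** * Disagreement inside and outside a ring *)

(** The product of [c] and [a] as Gaussian integers, that is, a point of the lattice spanned by [a]
    and [rot a]. *)
Definition ctr (a c : site) : site := (c.1 * a.1 - c.2 * a.2, c.1 * a.2 + c.2 * a.1).

Lemma ru_ctr a c z : ru a (ctr a c) z = ru a (0, 0) z - c.1 * nrm2 a.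
Proof. by rewrite /ru /uu /ctr /nrm2 /=; ring. Qed.

Lemma rw_ctr a c z : rw a (ctr a c) z = rw a (0, 0) z - c.2 * nrm2 a.
Proof. by rewrite /rw /ww /ctr /nrm2 /=; ring. Qed.

Definition insqo (a x z : site) := (`|ru a x z| < nrm2 a) && (`|rw a x z| < nrm2 a).

Definition iotaZ (n : nat) : seq int := [seq i%:Z - n%:Z | i <- iota 0 n.*2.+1].

Lemma mem_iotaZ n (i : int) : (i \in iotaZ n) = (`|i| <= n%:Z).
Proof.
apply/mapP/idP => [[k]|h]; first by rewrite mem_iota add0n -muln2 => hk ->; lia.
exists (absz (i + n%:Z)); first by rewrite mem_iota add0n -muln2; lia.
lia.
Qed.

Lemma size_iotaZ n : size (iotaZ n) = n.*2.+1.
Proof. by rewrite size_map size_iota. Qed.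

(** Two layers are listed because a cell is named by its lower corner: points just outside radius
    [r] have index [r], [r + 1] or [- r - 1]. *)
Definition shell (r : nat) : seq site :=
  [seq (s, j) | s <- [:: r%:Z; r%:Z + 1; - r%:Z; - r%:Z - 1], j <- iotaZ r.+1] ++
  [seq (j, s) | s <- [:: r%:Z; r%:Z + 1; - r%:Z; - r%:Z - 1], j <- iotaZ r.+1].

Lemma size_shell r : size (shell r) = (16 * r + 24)%N.
Proof. by rewrite size_cat !size_allpairs size_iotaZ -muln2 /=; lia. Qed.

Lemma mem_shell r (i j : int) : (i, j) \in shell r ->
  [/\ `|i| <= r.+1%:Z, `|j| <= r.+1%:Z & (r%:Z <= `|i|) || (r%:Z <= `|j|)].
Proof.
rewrite mem_cat => /orP[] /allpairsP[[s k] /= [hs hk [-> ->]]].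
  by move: hs hk; rewrite mem_iotaZ !inE => /or4P[] /eqP-> hk; split; lia.
by move: hs hk; rewrite mem_iotaZ !inE => /or4P[] /eqP-> hk; split; lia.
Qed.

Lemma in_shell r (i j : int) : `|i| <= r.+1%:Z -> `|j| <= r.+1%:Z ->
  (r%:Z <= `|i|) || (r%:Z <= `|j|) -> (i, j) \in shell r.
Proof.
move=> hi hj h; rewrite mem_cat; apply/orP; case/orP: h => h; [left|right].
  by apply/allpairsP; exists (i, j); split; [rewrite !inE /=; clear -hi h; lia|rewrite mem_iotaZ|].
by apply/allpairsP; exists (j, i); split; [rewrite !inE /=; clear -hj h; lia|rewrite mem_iotaZ|].
Qed.

(** Spacing 9 keeps the squares of radius 4 around the centres disjoint, and disjoint from those of
    [shell (9 * q)]. *)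
Definition inner (q : nat) : seq site := [seq (9 * z.1, 9 * z.2) | z <- box q.-1].

Lemma floor_cell (W u : int) : 0 < W -> exists2 i : int, i * W <= u & u < (i + 1) * W.
Proof.
move=> W0; exists (u %/ W)%Z; first exact: lez_floor (lt0r_neq0 W0).
by rewrite {1}(divz_eq u W) mulrDl mul1r ltrD2l; exact: ltz_pmod.
Qed.

Section Core.
Variable R : realType.
Implicit Types (A B D : {fset site}) (eta : site -> R).

Definition plus (c : R) eta : site -> R := fun v => eta v + c.

(** The 8 is the 2 of the isoperimetric inequality times the at most four edges that a new site
    receives from [A]. *)
Lemma growth_step D (c : R) eta A A' : A `<=` D -> A `<=` A' -> (forall v, v \in A -> diff D eta (plus c eta) v) ->
  (forall u v, u \in A -> v \in nbrs u -> diff D eta (plus c eta) v -> v \in A') ->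
  c * (#|` A|)%:R <= 8 * ((#|` A'|)%:R - (#|` A|)%:R).
Proof.
move=> AD sub AC step.
have := @diff_isoperimetry R D eta (plus c eta) A AD AC.
have -> : \sum_(u <- A) (plus c eta u - eta u) = c * (#|` A|)%:R.
  by rewrite -sum_fset_const; apply: eq_bigr => u _; rewrite /plus addrC addKr.
move=> /le_trans; apply.
have -> : (8 : R) = 2 * 4 by ring.
rewrite -mulrA ler_pM2l //.
apply: (@le_trans _ _ (edges R A (A' `\` A))).
  apply: sum_fset_le => u ul; rewrite big_seq [leRHS]big_seq; apply: ler_sum => v uv.
  by rewrite ler_nat; case: andP => // -[vl vC]; rewrite inE vl (step u).
rewrite edgesC.
have -> : (#|` A'|)%:R - (#|` A|)%:R = (#|` A' `\` A|)%:R :> R.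
  by rewrite cardfsDS // natrB // fsubset_leq_card.
rewrite -sum_fset_const; apply: sum_fset_le => u _.
rewrite /= !big_cons big_nil.
by do 4! case: (_ \in _) => /=; lra.
Qed.

(** Disagreement is computed in [sq a x 4] rather than in the ambient domain, so that the
    cardinality depends on the field in that square only and can be exchanged with that of a
    disjoint square. *)
Definition Yset a (c : R) eta x : {fset site} :=
  [fset v in sq a x 4 | insqo a x v && diff (sq a x 4) eta (plus c eta) v].

Lemma mem_Yset a c eta x v : a != (0, 0) ->
  (v \in Yset a c eta x) = insqo a x v && diff (sq a x 4) eta (plus c eta) v.
Proof.
move=> a0; rewrite inE; apply: andb_idl => /andP[h _].
by rewrite mem_sq //; have := nrm2_gt0 a0; move: h; rewrite /insqo /insq; clear; lia.
Qed.

Lemma card_cover (T : eqType) (s : seq T) (F : T -> {fset site}) A :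
  (forall v, v \in A -> exists2 x, x \in s & v \in F x) ->
  (#|` A| <= \sum_(x <- s) #|` F x|)%N.
Proof.
elim: s A => [|y s IH] A h.
  rewrite big_nil leqn0 cardfs_eq0; apply/eqP/fsetP => v; rewrite inE.
  by apply/negP => /h[].
rewrite big_cons -(cardfsID (F y) A); apply: leq_add.
  by apply: fsubset_leq_card; exact: fsubsetIr.
apply: IH => v; rewrite inE => /andP[vy /h[x]].
by rewrite inE => /orP[/eqP->|xs vx]; [rewrite (negbTE vy)|exists x].
Qed.

Lemma grow_bound (l : nat) (n A X : int) : 0 <= n -> `|A| <= X + l%:Z * n -> `|A| <= X + l.+1%:Z * n.
Proof. by move=> n0 h; apply: le_trans h _; rewrite lerD2l; apply: ler_wpM2r => //; lia. Qed.

Lemma step_bound (l : nat) (n A B X : int) : `|B - A| <= n -> `|A| <= X + l%:Z * n ->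
  `|B| <= X + l.+1%:Z * n.
Proof.
move=> h1 h2; have -> : X + l.+1%:Z * n = (X + l%:Z * n) + n by rewrite intS mulrDl mul1r addrA addrAC.
have -> : B = A + (B - A) by rewrite addrC subrK.
by apply: le_trans (ler_normD _ _) _; apply: lerD.
Qed.

Lemma cell_bound (r : nat) (W S k t : int) : 0 < W -> S <= W ->
  `|t| <= r%:Z * W + S -> k * W <= t -> t < (k + 1) * W ->
  `|k| <= r.+1%:Z /\ (r%:Z * W < `|t| -> r%:Z <= `|k|).
Proof.
move=> W0 hS ht k1 k2.
have e1 : (r.+1%:Z) * W = r%:Z * W + W by rewrite intS mulrDl mul1r addrC.
have e2 : (- r.+1%:Z) * W = - (r%:Z * W + W) by rewrite mulNr e1.
have t1 : t <= r%:Z * W + W by move: ht hS; clear; lia.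
have t2 : - (r%:Z * W + W) <= t by move: ht hS; clear; lia.
have b1 : k * W <= r.+1%:Z * W by rewrite e1; exact: le_trans t1.
have b2 : - r.+1%:Z * W < (k + 1) * W by rewrite e2; exact: le_lt_trans k2.
rewrite ler_pM2r // in b1; rewrite ltr_pM2r // in b2.
split; first by move: b1 b2; clear; lia.
rewrite -[X in _ < `|X| -> _]/t; case: (leP 0 t) => t0 h.
  have : r%:Z * W < (k + 1) * W by move: h k2; rewrite ger0_norm //; exact: lt_trans.
  by rewrite ltr_pM2r //; clear; lia.
have : k * W < - r%:Z * W by rewrite mulNr; move: h k1; rewrite ltr0_norm // ltrNr => /[swap]; exact: le_lt_trans.
by rewrite ltr_pM2r //; clear; lia.
Qed.

Lemma insqo_cell (i W u : int) : 0 < W -> i * W <= u -> u < (i + 1) * W -> `|u - i * W| < W.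
Proof. rewrite mulrDl mul1r; lia. Qed.

Lemma sq_cell (i s W u : int) : 0 < W -> `|i| <= s -> `|u - i * W| <= 4 * W -> `|u| <= (s + 4) * W.
Proof.
move=> W0 hi hu; have : `|i * W| <= s * W by rewrite normrM (gtr0_norm W0) ler_pM2r.
by move: hu; rewrite mulrDl; clear; lia.
Qed.

Section Growth.
Variables (a : site) (r : nat) (c : R) (eta : site -> R).
Hypotheses (a0 : a != (0, 0)) (aW : nrm1 a <= nrm2 a) (c0 : 0 <= c).
Local Notation W := (nrm2 a).
Local Notation DD := (sq a (0, 0) (r%:Z + 6)).
Local Notation C := (diff DD eta (plus c eta)).

(** The radius grows by [nrm1 a], the largest change of a coordinate along one edge, so all
    disagreeing neighbours of one layer lie in the next. *)
Definition layer (l : nat) : {fset site} := [fset z in DD |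
  [&& C z, `|ru a (0, 0) z| <= r%:Z * W + l%:Z * nrm1 a &
           `|rw a (0, 0) z| <= r%:Z * W + l%:Z * nrm1 a]].

Lemma mem_layer l z : l%:Z * nrm1 a <= 2 * W -> (z \in layer l) =
  [&& C z, `|ru a (0, 0) z| <= r%:Z * W + l%:Z * nrm1 a &
           `|rw a (0, 0) z| <= r%:Z * W + l%:Z * nrm1 a].
Proof.
move=> hl; rewrite inE; apply: andb_idl => /and3P[_ h1 h2].
have W0 := nrm2_gt0 a0; rewrite mem_sq // /insq mulrDl.
by move: h1 h2 hl W0; clear; lia.
Qed.

Lemma layer_step l : l.+1%:Z * nrm1 a <= 2 * W ->
  c * (#|` layer l|)%:R <= 8 * ((#|` layer l.+1|)%:R - (#|` layer l|)%:R).
Proof.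
move=> hl; have n0 : 0 <= nrm1 a by rewrite /nrm1; clear; lia.
have hl' : l%:Z * nrm1 a <= 2 * W.
  apply: le_trans hl; apply: ler_wpM2r => //; lia.
have sub : layer l `<=` layer l.+1.
  apply/fsubsetP => z; rewrite !mem_layer // => /and3P[-> h1 h2] /=.
  by rewrite !grow_bound.
have lD : layer l `<=` DD by apply/fsubsetP => z; rewrite inE => /andP[].
apply: (@growth_step DD c eta) => //.
  by move=> v; rewrite mem_layer // => /and3P[].
move=> u v ul uv vC; rewrite mem_layer // vC /=.
move: ul; rewrite mem_layer // => /and3P[_ h1 h2].
by rewrite (step_bound (ru_step a (0, 0) uv)) // (step_bound (rw_step a (0, 0) uv)).
Qed.

(** Each of the [L] enlargements adds at least [c / 8] times the size of the current layer, which
    contains [layer 0]. *)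
Lemma layer_growth (L : nat) : L%:Z * nrm1 a <= W ->
  c * L%:R * (#|` layer 0|)%:R <= 8 * ((#|` layer L|)%:R - (#|` layer 0|)%:R).
Proof.
move=> hL; have n0 : 0 <= nrm1 a by rewrite /nrm1; clear; lia.
have W0 := nrm2_gt0 a0.
have hl l : (l <= L)%N -> l%:Z * nrm1 a <= 2 * W.
  move=> lL; apply: (@le_trans _ _ (L%:Z * nrm1 a)); first by apply: ler_wpM2r.
  by move: hL W0; clear; lia.
suff H l : (l <= L)%N -> layer 0 `<=` layer l /\
    c * l%:R * (#|` layer 0|)%:R <= 8 * ((#|` layer l|)%:R - (#|` layer 0|)%:R).
  by have [_] := H L (leqnn L).
elim: l => [_|l IH lL]; first by rewrite mulr0 mul0r subrr mulr0; split.
have [s h] := IH (ltnW lL); have := layer_step (hl _ lL).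
have sub : layer l `<=` layer l.+1.
  apply/fsubsetP => z; rewrite !mem_layer ?hl // 1?ltnW // => /and3P[-> h1 h2] /=.
  by rewrite !grow_bound.
split; first exact: fsubset_trans sub.
have : c * (#|` layer 0|)%:R <= c * (#|` layer l|)%:R.
  by apply: ler_wpM2l => //; rewrite ler_nat fsubset_leq_card.
by rewrite -natr1; move: h => /=; lra.
Qed.

Lemma shell_cover L v : L%:Z * nrm1 a <= W -> v \in layer L `\` layer 0 ->
  exists2 z, z \in shell r & v \in Yset a c eta (ctr a z).
Proof.
move=> hL; have W0 := nrm2_gt0 a0.
have hL2 : L%:Z * nrm1 a <= 2 * W by apply: le_trans hL _; rewrite ler_peMl // ltW.
have h02 : 0%:Z * nrm1 a <= 2 * W by rewrite mul0r mulr_ge0 // ltW.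
rewrite inE !mem_layer // mul0r addr0 => /andP[out /and3P[vC h1 h2]].
have [i i1 i2] := floor_cell (ru a (0, 0) v) W0.
have [j j1 j2] := floor_cell (rw a (0, 0) v) W0.
have [bi ri] := cell_bound W0 hL h1 i1 i2; have [bj rj] := cell_bound W0 hL h2 j1 j2.
exists (i, j).
  apply: in_shell => //; move: out; rewrite vC /= negb_and -!ltNge.
  by case/orP => [/ri ->//|/rj ->]; rewrite orbT.
rewrite mem_Yset //; apply/andP; split.
  by rewrite /insqo ru_ctr rw_ctr /= !insqo_cell.
apply: diff_mono vC; apply/fsubsetP => z; rewrite !mem_sq // /insq ru_ctr rw_ctr /=.
(* The index of a shell cell is at most [r + 1] and its square has radius 4, so radius [r + 6] for
   the ambient domain leaves one unit to spare. *)
have -> : r%:Z + 6 = r.+1%:Z + 4 + 1 by rewrite intS; ring.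
move=> /andP[z1 z2].
have ex s : s * W <= (s + 1) * W by rewrite mulrDl mul1r ler_wpDr // ltW.
by rewrite (le_trans (sq_cell W0 bi z1)) // (le_trans (sq_cell W0 bj z2)).
Qed.

End Growth.

Lemma ctr0 a : ctr a (0, 0) = (0, 0).
Proof. by rewrite /ctr /=; congr (_, _); ring. Qed.

Lemma inner_bound q x : x \in inner q -> (0 < q)%N ->
  (`|x.1| + 9 <= 9 * q%:Z) /\ (`|x.2| + 9 <= 9 * q%:Z).
Proof.
by move=> /mapP[[i j]]; rewrite mem_box /= => /andP[h1 h2] -> q0 /=; split; [clear h2|clear h1]; lia.
Qed.

Lemma cell_in (i r W u : int) : 0 < W -> `|i| + 9 <= r -> `|u - i * W| < W -> `|u| <= r * W.
Proof.
move=> W0 hi hu; have : (`|i| + 9) * W <= r * W by rewrite ler_pM2r.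
have : `|i * W| = `|i| * W by rewrite normrM (gtr0_norm W0).
by rewrite mulrDl; move: hu W0; clear; lia.
Qed.

Lemma in_cross_a (A W : int) : W <= A <= 3 * W -> `|A| <= 3 * W.
Proof. lia. Qed.

Lemma in_cross_b (A W : int) : W <= - A <= 3 * W -> `|A| <= 3 * W.
Proof. lia. Qed.

(* The inner squares see only sites of [layer 0], which is nonempty since a crossing avoiding the
   minus set meets a transversal crossing avoiding the plus set, while the layers grow too fast
   for all the shell squares to be as poor as [layer 0]. *)
Lemma shell_wins (a : site) q (c : R) eta (L : nat) : a != (0, 0) -> nrm1 a <= nrm2 a -> 0 <= c ->
  (0 < q)%N -> L%:Z * nrm1 a <= nrm2 a -> 8 * (size (shell (9 * q)))%:R < c * L%:R ->
  (forall x, x \in inner q ->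
     ring_cross a (ctr a x) (sq a (0, 0) ((9 * q)%N%:Z + 6)) eta /\
     ring_cross a (ctr a x) (sq a (0, 0) ((9 * q)%N%:Z + 6)) (plus c eta)) ->
  exists2 z, z \in shell (9 * q) & forall x, x \in inner q ->
    (#|` Yset a c eta (ctr a x)| < #|` Yset a c eta (ctr a z)|)%N.
Proof.
move=> a0 aW c0 q0 hL hc hR; set DD := sq _ _ _ in hR; have W0 := nrm2_gt0 a0.
set l0 := layer a (9 * q) c eta 0; set m := size _ in hc.
have h02 : 0%:Z * nrm1 a <= 2 * nrm2 a by rewrite mul0r mulr_ge0 // ltW.
have e9 : (9 * q)%N%:Z = 9 * q%:Z by rewrite PoszM.
have Yl x : x \in inner q -> Yset a c eta (ctr a x) `<=` l0.
  move=> xq; have [x1 x2] := inner_bound xq q0; have [r1 r2] := hR x xq.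
  have sD : sq a (ctr a x) 4 `<=` DD.
    apply/fsubsetP => z; rewrite !mem_sq // /insq ru_ctr rw_ctr => /andP[z1 z2].
    have ex (s : int) : s + 9 <= 9 * q%:Z -> (s + 4) * nrm2 a <= ((9 * q)%N%:Z + 6) * nrm2 a.
      by move=> h; rewrite ler_pM2r // e9; clear -h; lia.
    rewrite (le_trans (sq_cell W0 (lexx _) z1)) ?(le_trans (sq_cell W0 (lexx _) z2)) //.
      exact: ex.
    exact: ex.
  apply/fsubsetP => v; rewrite mem_Yset // /insqo => /andP[/andP[v1 v2] /andP[d1 d2]].
  rewrite mem_layer // mul0r addr0; apply/and3P; split.
  - apply/andP; split.
      by apply: contra d1; apply: (ring_encloses a0 aW _ r1 sD v1 v2) => z /andP[].
    by apply: contra d2; apply: (ring_encloses a0 aW _ r2 sD v1 v2) => z /andP[].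
  - by move: v1; rewrite ru_ctr; apply: cell_in => //; rewrite e9.
  - by move: v2; rewrite rw_ctr; apply: cell_in => //; rewrite e9.
have l0_gt0 : (0 < #|` l0|)%N.
  have /hR : (0, 0) \in inner q.
    by apply/mapP; exists (0, 0); rewrite ?mem_box //= mulr0.
  rewrite ctr0 => -[[[y [p [yp hp p1 p2]]] _ _ _] [_ [z [t [zt ht t1 t2]]] _ _]].
  have r00 : ru a (0, 0) (0, 0) = 0 by rewrite /ru subrr.
  have ruE v : uu a v = ru a (0, 0) v by rewrite /ru /uu /=; ring.
  have rwE v : ww a v = rw a (0, 0) v by rewrite /rw /ww /=; ring.
  have [v|||v|||v vp vt] := @cross_tilted a y z p t (- (3 * nrm2 a)) (- nrm2 a) (nrm2 a)
    (3 * nrm2 a) a0 yp zt.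
  - by move=> /hp[_ + _]; rewrite rwE.
  - by rewrite ruE; apply: le_trans p1 _; move: W0; clear; lia.
  - by rewrite ruE; apply: le_trans p2; move: W0; clear; lia.
  - by move=> /ht[_ + _]; rewrite ruE rw_rot nrm2_rot; clear; lia.
  - by move: t1; rewrite rwE ru_rot nrm2_rot; move: W0; clear; lia.
  - by move: t2; rewrite rwE ru_rot nrm2_rot; move: W0; clear; lia.
  have [/andP[d1 _] d2 _] := hp v vp; have [/andP[_ d3] + _] := ht v vt.
  rewrite rw_rot nrm2_rot => d4; rewrite cardfs_gt0; apply/fset0Pn; exists v.
  have k : 3 * nrm2 a <= (9 * q)%N%:Z * nrm2 a by rewrite ler_pM2r // e9; move: q0; clear; lia.
  rewrite mem_layer // mul0r addr0 /diff d1 d3 /= (le_trans (in_cross_b d4)) //.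
  exact: le_trans (in_cross_a d2) k.
have [/hasP[z zs hz]|/hasPn none] :=
    boolP (has (fun z => #|` l0| < #|` Yset a c eta (ctr a z)|)%N (shell (9 * q))).
  by exists z => // x /Yl/fsubset_leq_card xl; exact: leq_ltn_trans xl hz.
exfalso; have sub : l0 `<=` layer a (9 * q) c eta L.
  apply/fsubsetP => v; rewrite !mem_layer //; last first.
    by apply: le_trans hL _; rewrite ler_peMl // ltW.
  rewrite mul0r addr0 => /and3P[-> h1 h2] /=.
  have n0 : 0 <= L%:Z * nrm1 a by rewrite mulr_ge0 // /nrm1 addr_ge0.
  by rewrite !ler_wpDr.
have := layer_growth (9 * q) eta a0 aW c0 hL; rewrite -/l0 -natrB ?fsubset_leq_card // -cardfsDS //.
apply/negP; rewrite -ltNge.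
have : (#|` layer a (9 * q) c eta L `\` l0| <= m * #|` l0|)%N.
  apply: leq_trans (card_cover (F := fun z => Yset a c eta (ctr a z)) _) _; first by move=> v; apply: shell_cover.
  rewrite /m -sum1_size big_distrl /= big_seq [leqRHS]big_seq; apply: leq_sum => z /none.
  by rewrite -leqNgt mul1n.
rewrite -(ler_nat R) natrM => h; apply: le_lt_trans (_ : 8 * (m%:R * (#|` l0|)%:R) < _).
  by rewrite ler_pM2l.
by rewrite mulrA ltr_pM2r // ltr0n.
Qed.

End Core.

(** * Exchangeability of disjoint squares *)

Section Meas.
Variable R : realType.
Local Notation field S := (g_sigma_algebraType (cyl S : set (set (fld R)))).

Definition mfield (S : set site) (D : {fset site}) (f : fld R -> fld R) :=
  forall v, v \in D -> measurable_fun [set: field S] (fun eta : fld R => f eta v).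

(** The two ground sets take values in a countable type, so any property of the disagreement set is
    an event, including the existence of a path in it. *)
Lemma ms_diff S D f f' (Phi : (site -> bool) -> Prop) : mfield S D f -> mfield S D f' ->
  ms S [set eta : fld R | Phi (diff D (f eta) (f' eta))].
Proof.
move=> mf mf'.
have m2 : mfield S D (fun eta v => - f' eta v).
  by move=> v vD; apply: measurable_funN; exact: mf'.
exact: (@mdisc_pred _ S _ (fun eta => (ground D (f eta), ground D (fun v => - f' eta v)))
  (fun K => Phi (fun v => (v \notin K.1) && (v \notin K.2)))
  (mdisc_pair (mdisc_ground mf) (mdisc_ground m2))).
Qed.

Lemma mfield_id (S : set site) D : (forall v, v \in D -> S v) -> mfield S D id.
Proof. by move=> DS v /DS; exact: measurable_coord. Qed.

Lemma mfield_plus (S : set site) D c : (forall v, v \in D -> S v) -> mfield S D (plus c).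
Proof. by move=> DS v /DS Sv; apply: measurable_funD; [exact: measurable_coord|exact: measurable_cst]. Qed.

Lemma mfield_shift (S : set site) D c s : (forall v, v \in D -> S v) -> mfield S D (shift c s).
Proof. by move=> DS v /DS Sv; apply: measurable_funD; [exact: measurable_coord|exact: measurable_cst]. Qed.

Lemma ms_hard_cross (S : set site) a x D : (forall v, v \in D -> S v) ->
  ms S [set eta : fld R | hard_cross a x D eta].
Proof.
move=> DS; have m := mfield_id DS.
exact: (@ms_diff S D id id (fun d => exists (y : site) (p : seq site),
  [/\ path nb y p,
      forall z, z \in y :: p -> [/\ d z, nrm2 a <= rw a x z <= 3 * nrm2 a &
                                   `|ru a x z| <= 5 * nrm2 a],
      ru a x y <= - (4 * nrm2 a) & 4 * nrm2 a <= ru a x (last y p)]) m m).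
Qed.

Lemma mdisc_card_Yset a c x : mdisc setT (fun eta : fld R => #|` Yset a c eta x|).
Proof.
move=> k; apply: (@ms_diff setT (sq a x 4) id (plus c)
  (fun d => #|` [fset v in sq a x 4 | insqo a x v && d v]| = k)).
  exact: mfield_id.
exact: mfield_plus.
Qed.

End Meas.

Section Exchange.
Variables (R : realType) (eps : R) (p : set (fld R) -> R).
Hypothesis lawp : gauss_law eps p.
Variables (T : eqType) (Y : T -> fld R -> nat).
Hypothesis mY : forall x, mdisc setT (Y x).

(** The inequality is strict so that these events are disjoint for distinct [x] in [s]. *)
Definition wins (s : seq T) x := [set eta : fld R | forall y, y \in s -> y != x -> (Y y eta < Y x eta)%N].

Lemma ms_wins s x : ms setT (wins s x).
Proof.
rewrite /wins (_ : [set _ | _] =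
    [set eta : fld R | forall y, y \in [seq y <- s | y != x] -> [set eta | Y y eta < Y x eta]%N eta]).
  apply: ms_forall => y _.
  exact: (mdisc_pred (fun k : nat * nat => (k.1 < k.2)%N) (mdisc_pair (mY y) (mY x))).
apply/seteqP; split=> eta H y; first by rewrite mem_filter => /andP[h ys]; exact: H.
by move=> ys yx; apply: H; rewrite mem_filter yx.
Qed.

Lemma wins_le1 s s' : uniq s' -> {subset s' <= s} ->
  p [set eta | exists2 x, x \in s' & wins s x eta] = \sum_(x <- s') p (wins s x).
Proof.
elim: s' => [|x s' IH] us sub.
  rewrite big_nil (_ : [set _ | _] = set0) ?(law0 lawp) //.
  by apply/seteqP; split=> eta // [].
case/andP: us => xs' us.
rewrite big_cons -IH //; last by move=> y ys; apply: sub; rewrite inE ys orbT.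
rewrite -(lawU lawp); first last.
- apply/seteqP; split=> eta // -[h [y ys' h']].
  have xy : x != y by apply: contraNneq xs' => ->.
  have xs : x \in s by apply: sub; rewrite mem_head.
  have ys : y \in s by apply: sub; rewrite inE ys' orbT.
  have yx : y != x by rewrite eq_sym.
  by have := ltn_trans (h y ys yx) (h' x xs xy); rewrite ltnn.
- by apply: ms_exists => y _; exact: ms_wins.
- exact: ms_wins.
congr (p _); apply/seteqP; split=> [eta [y]|eta [h|[y ys h]]].
- by rewrite inE => /orP[/eqP->|ys h]; [left|right; exists y].
- by exists x; rewrite ?mem_head.
- by exists y; rewrite ?inE ?ys ?orbT.
Qed.

(** Exchanging [x] with [z] preserves the law, so all members of [s] win with the same probability,
    and at most one of them wins. *)
Lemma wins_exchange s z : uniq s -> z \in s ->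
  (forall x, x \in s -> x != z -> exists pi pi' : site -> site, [/\ cancel pi pi', cancel pi' pi &
    forall eta, [/\ Y x (eta \o pi) = Y z eta, Y z (eta \o pi) = Y x eta &
      forall y, y \in s -> y != x -> y != z -> Y y (eta \o pi) = Y y eta]]) ->
  p (wins s z) * (size s)%:R <= 1.
Proof.
move=> us zs H.
have E x : x \in s -> p (wins s x) = p (wins s z).
  move=> xs; have [->//|xz] := eqVneq x z; have [pi [pi' [pK p'K h]]] := H x xs xz.
  rewrite -(law_perm lawp pK p'K (ms_wins s x)); congr (p _); apply/seteqP; split=> eta /= W y ys.
  - move=> yz; have [e1 e2 e3] := h eta; have [->|yx] := eqVneq y x.
      by have := W z zs; rewrite eq_sym xz e1 e2; exact.
    by have := W y ys yx; rewrite e1 e3.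
  - move=> yx; have [e1 e2 e3] := h eta; have [->|yz] := eqVneq y z.
      by rewrite e1 e2; exact: W.
    by rewrite e1 e3 //; exact: W.
have := law_le1 lawp (ms_exists (fun x (_ : x \in s) => ms_wins s x)).
rewrite wins_le1 // big_seq (eq_bigr (fun=> p (wins s z))) => [|x /E//].
by rewrite -big_seq big_const_seq count_predT iter_addr_0 mulr_natr.
Qed.

End Exchange.

Section Swap.
Variable R : realType.
Implicit Types (D : {fset site}) (eta : fld R).

Definition swap (D D' : {fset site}) (t v : site) : site :=
  if v \in D then trn t v else if v \in D' then trn (opps t) v else v.

Lemma swapK D t : [disjoint D & fimg (trn t) D] -> cancel (swap D (fimg (trn t) D) t) (swap D (fimg (trn t) D) t).
Proof.
move=> /fdisjointP dis v; rewrite {2}/swap.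
have mt u : (trn t u \in fimg (trn t) D) = (u \in D) by apply: mem_fimg; exact: can_inj (trnK t).
have [vD|vD] := boolP (v \in D).
  rewrite /swap; have h : trn t v \in fimg (trn t) D by rewrite mt.
  case: ifP => [h'|_]; first by move: (dis _ h'); rewrite h.
  by rewrite h trnK.
have [|vD'] := boolP (v \in fimg (trn t) D).
  rewrite -{1}(trnVK t v) mt => h; by rewrite /swap h trnVK.
by rewrite /swap (negbTE vD) (negbTE vD').
Qed.

Lemma Yset_local a c eta eta' x : (forall v, v \in sq a x 4 -> eta v = eta' v) ->
  Yset a c eta x = Yset a c eta' x.
Proof.
move=> h; apply/fsetP => v; rewrite !inE; congr (_ && (_ && _)).
by apply: diff_local => u uD; rewrite /plus h.
Qed.

Lemma card_Yset_trn (a : site) c eta x t : a != (0, 0) ->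
  #|` Yset a c (eta \o trn t) x| = #|` Yset a c eta (trn t x)|.
Proof.
move=> a0; have ti := can_inj (trnK t).
have -> : Yset a c eta (trn t x) = fimg (trn t) (Yset a c (eta \o trn t) x).
  apply/fsetP => v; rewrite -(trnVK t v); move: (trn (opps t) v) => {}v.
  rewrite (mem_fimg _ _ ti) (mem_Yset c _ _ _ a0) (mem_Yset c _ x v a0) /insqo ru_trn rw_trn.
  congr (_ && _); rewrite -(sq_trn x 4 t a0).
  exact: (diff_fimg _ _ _ _ (trnK t) (trnVK t) (nb_trn t)).
by move: (Yset _ _ _ x) => A; rewrite /fimg card_imfset.
Qed.

Lemma card_Yset_trn_to (a : site) c eta x z t : a != (0, 0) -> trn t x = z ->
  #|` Yset a c (eta \o trn t) x| = #|` Yset a c eta z|.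
Proof. by move=> a0 <-; exact: card_Yset_trn. Qed.

Opaque Yset.

Lemma swap_Yset (s : seq site) (a : site) c x z : a != (0, 0) -> x \in s -> z \in s -> x != z ->
  (forall y y', y \in s -> y' \in s -> y != y' -> [disjoint sq a y 4 & sq a y' 4]) ->
  exists pi pi' : site -> site, [/\ cancel pi pi', cancel pi' pi &
    forall eta, [/\ #|` Yset a c (eta \o pi) x| = #|` Yset a c eta z|,
      #|` Yset a c (eta \o pi) z| = #|` Yset a c eta x| &
      forall y, y \in s -> y != x -> y != z ->
        #|` Yset a c (eta \o pi) y| = #|` Yset a c eta y|]].
Proof.
move=> a0 xs zs xz dis.
have [t tx] : exists t, trn t x = z.
  by exists (z.1 - x.1, z.2 - x.2); rewrite /trn /=; case: (z) (x) => z1 z2 [x1 x2] /=; congr (_, _); ring.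
have tz : trn (opps t) z = x by rewrite -tx trnK.
have Dz : fimg (trn t) (sq a x 4) = sq a z 4 by rewrite sq_trn // tx.
pose pi := swap (sq a x 4) (fimg (trn t) (sq a x 4)) t.
have piK : cancel pi pi by apply: swapK; rewrite Dz; exact: dis.
exists pi, pi; split; [exact: piK|exact: piK|move=> eta; split].
- apply: etrans (card_Yset_trn_to c eta a0 tx).
  congr (size (enum_fset _)); apply: Yset_local => v vx.
  by rewrite /= /pi /swap vx.
- apply: etrans (card_Yset_trn_to c eta a0 tz).
  congr (size (enum_fset _)); apply: Yset_local => v vz.
  rewrite /= /pi /swap Dz vz; case: ifP => // vx.
  by have /fdisjointP/(_ _ vx) := dis _ _ xs zs xz; rewrite vz.
- move=> y ys yx yz; congr (size (enum_fset _)); apply: Yset_local => v vy; rewrite /= /pi /swap Dz.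
  have /fdisjointP/(_ _ vy)/negbTE -> := dis _ _ ys xs yx.
  by have /fdisjointP/(_ _ vy)/negbTE -> := dis _ _ ys zs yz.
Qed.

End Swap.

Lemma sq_far (a x y : site) : a != (0, 0) -> (9 <= `|x.1 - y.1|) || (9 <= `|x.2 - y.2|) ->
  [disjoint sq a (ctr a x) 4 & sq a (ctr a y) 4].
Proof.
move=> a0 h; have W0 := nrm2_gt0 a0; apply/fdisjointP => v; rewrite !mem_sq // /insq !ru_ctr !rw_ctr.
move=> /andP[x1 x2]; apply/negP => /andP[y1 y2].
have far (i j u : int) : 9 <= `|i - j| -> `|u - i * nrm2 a| <= 4 * nrm2 a ->
    `|u - j * nrm2 a| <= 4 * nrm2 a -> False.
  move=> ij h1 h2; have : `|i - j| * nrm2 a <= 8 * nrm2 a.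
    rewrite -{1}(gtr0_norm W0) -normrM mulrBl; move: h1 h2; clear; lia.
  by rewrite ler_pM2r //; move: ij; clear; lia.
by case/orP: h => h; [exact: far h x1 y1|exact: far h x2 y2].
Qed.

Lemma inner_far q x y : x \in inner q -> y \in inner q -> x != y ->
  (9 <= `|x.1 - y.1|) || (9 <= `|x.2 - y.2|).
Proof.
move=> /mapP[[i j] _ ->] /mapP[[k l] _ ->]; rewrite xpair_eqE /= negb_and.
by clear; lia.
Qed.

Lemma shell_far q x z : (0 < q)%N -> x \in inner q -> z \in shell (9 * q) ->
  (9 <= `|z.1 - x.1|) || (9 <= `|z.2 - x.2|).
Proof.
move=> q0 /inner_bound/(_ q0)[x1 x2]; case: z => i j /mem_shell[_ _]; rewrite PoszM /=.
by move: x1 x2; case: x => x1 x2 /=; clear; lia.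
Qed.

Lemma uniq_inner q : uniq (inner q).
Proof.
rewrite map_inj_uniq => [|[i j] [k l] /= [h1 h2]]; last by congr (_, _); lia.
by apply: allpairs_uniq; rewrite ?iota_uniq // => -[i j] [k l] _ _ /= [h1 h2]; congr (_, _); lia.
Qed.

Lemma size_inner q : size (inner q) = ((q.-1.*2.+1) ^ 2)%N.
Proof. by rewrite size_map size_allpairs size_iota mulnn. Qed.

(** * A scale-invariant bound on crossing probabilities *)

Section RingProb.
Variables (R : realType) (eps : R) (p : set (fld R) -> R).
Hypothesis lawp : gauss_law eps p.

Lemma ms_hc a x D : ms setT [set eta : fld R | hard_cross a x D eta].
Proof. exact: ms_hard_cross. Qed.

Lemma hc_trn_le (a b x : site) s t : a != (0, 0) ->
  p [set eta | hard_cross b x (sq a x s) eta] <=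
  p [set eta | hard_cross b (trn t x) (sq a (trn t x) s) eta].
Proof.
move=> a0; rewrite -(law_perm lawp (trnK t) (trnVK t) (ms_hc b x (sq a x s))).
apply: (law_mono lawp); [exact: ms_perm (ms_hc _ _ _)|exact: ms_hc|move=> eta /=].
by rewrite -sq_trn //; exact: hard_cross_trn.
Qed.

Lemma hc_rot_le (a b : site) s : a != (0, 0) ->
  p [set eta | hard_cross b (0, 0) (sq a (0, 0) s) eta] <=
  p [set eta | hard_cross (rot b) (0, 0) (sq a (0, 0) s) eta].
Proof.
move=> a0; rewrite -(law_perm lawp rotK rotVK (ms_hc b (0, 0) (sq a (0, 0) s))).
apply: (law_mono lawp); [exact: ms_perm (ms_hc _ _ _)|exact: ms_hc|move=> eta /=].
by move=> /hard_cross_rot; rewrite sq_rot.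
Qed.

End RingProb.

Lemma trn0 (t : site) : trn t (0, 0) = t.
Proof. by rewrite /trn /= !add0r; case: t. Qed.

Lemma nrm_le (a : site) (L : int) : 2 <= nrm1 a -> 2 * L <= nrm1 a ->
  nrm1 a <= nrm2 a /\ L * nrm1 a <= nrm2 a.
Proof.
move=> h2 hL; have : nrm1 a * nrm1 a <= 2 * nrm2 a.
  rewrite /nrm1 /nrm2; have := sqr_ge0 (`|a.1| - `|a.2|).
  have e (i : int) : `|i| * `|i| = i * i by rewrite -expr2 real_normK ?num_real // expr2.
  rewrite -(e a.1) -(e a.2) expr2; set x := `|a.1|; set y := `|a.2|.
  have -> : (x - y) * (x - y) = 2 * (x * x + y * y) - (x + y) * (x + y) by ring.
  by rewrite subr_ge0.
move=> h; have h' : 2 * L * nrm1 a <= nrm1 a * nrm1 a by apply: ler_wpM2r => //; apply: le_trans h2.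
have h'' : 2 * nrm1 a <= nrm1 a * nrm1 a by apply: ler_wpM2r => //; apply: le_trans h2.
by split; move: h h' h''; rewrite -?mulrA; clear; lia.
Qed.

Lemma card_sq (a x : site) (r n : nat) : a != (0, 0) -> nrm1 a = n%:Z -> (0 < r * n)%N ->
  (#|` sq a x r%:Z| <= (3 * r * n) ^ 2)%N.
Proof.
move=> a0 hn rn; apply: (@leq_trans #|` boxf x (r * n)|).
  apply: fsubset_leq_card; apply/fsubsetP => z; rewrite mem_sq // => /(insq_bound a0).
  by rewrite mem_boxf hn PoszM.
apply: leq_trans (card_boxf _ _) _.
by rewrite -mulnA leq_exp2r // -muln2 ; move: rn; clear; lia.
Qed.

Lemma ring_contra (R : realFieldType) (x t u v w y : R) :
  1 <= x + u -> u <= v + w -> v <= 1 / 8 + t / 2 * x -> w <= y -> t * x <= 8^-1 -> 4 * x <= t * x ->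
  y <= 2^-1 -> False.
Proof.
move=> h1 h2 h3 h4 h5 h6 h7; have e : t / 2 * x = 2^-1 * (t * x) by rewrite mulrA (mulrC t).
by rewrite e in h3; lra.
Qed.

Section RingThm.
Variables (R : realType) (eps : R).
Hypothesis eps_gt0 : 0 < eps.
Variable q : nat.
Hypotheses (q_gt0 : (0 < q)%N) (hq : (2 * size (shell (9 * q)) <= size (inner q))%N).

Local Notation m := (size (shell (9 * q))).
Local Notation k := (size (inner q)).
Local Notation B := (9 * q + 6)%N.

(** Four times a bound on the second moment of the density for a shift [25 * m / n] on a square of
    radius [B], which has at most [(3 * B * n) ^ 2] sites; [n] cancels. *)
Definition ring_tau : R := 4 * expR ((25 * m%:R) ^+ 2 * (3 * B%:R) ^+ 2 / eps ^+ 2).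
(** Chosen so that [ring_tau * (4 * k * ring_delta)] is [1 / 8], where [4 * k] counts the rectangles
    of all the inner rings. *)
Definition ring_delta : R := (32 * k%:R * ring_tau)^-1.

Lemma k_gt0 : (0 < k)%N. Proof. by rewrite size_inner expn_gt0. Qed.
Lemma m_gt0 : (0 < m)%N. Proof. by rewrite size_shell; lia. Qed.

Lemma ring_tau_ge4 : 4 <= ring_tau.
Proof.
rewrite /ring_tau ler_peMr // -expR0 ler_expR; apply: divr_ge0; last exact: sqr_ge0.
by rewrite mulr_ge0 // sqr_ge0.
Qed.

Lemma ring_delta_gt0 : 0 < ring_delta.
Proof.
have t4 := ring_tau_ge4; rewrite invr_gt0; apply: mulr_gt0; last by apply: lt_le_trans t4.
by apply: mulr_gt0; rewrite // ltr0n k_gt0.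
Qed.

Lemma local_ring (a x : site) D eta eta' : (forall v, v \in D -> eta v = eta' v) ->
  ring_cross a x D eta -> @ring_cross R a x D eta'.
Proof. by move=> h [h1 h2 h3 h4]; split; exact: hard_cross_local h _. Qed.

(** The radius [2 * B] makes the square around any inner centre contain the common domain of radius
    [B]; by [hard_cross_mono] a crossing in the former is one in the latter. *)
Lemma hard_cross_prob (p : set (fld R) -> R) (a x : site) : gauss_law eps p -> 2 <= nrm1 a ->
  p [set eta | hard_cross a x (sq a x (2 * B%:Z)) eta] <= 1 - ring_delta.
Proof.
move=> lawp h2; have a0 : a != (0, 0) by apply: contraTneq h2 => ->.
apply: le_trans (hc_trn_le lawp a x _ (opps x) a0) _.
have -> : trn (opps x) x = (0, 0) by rewrite -{2}(trn0 x) trnK.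
rewrite leNgt; apply/negP => big.
have W0 := nrm2_gt0 a0; have [n hn] : exists n : nat, nrm1 a = n%:Z.
  by exists (absz (nrm1 a)); move: h2; clear; lia.
rewrite hn in h2; have n2 : (2 <= n)%N by move: h2; clear; lia.
(* From [nrm1 a ^+ 2 <= 2 * nrm2 a], half of [n] steps stay within one unit. With [n <= 3 * L], the
   shift [25 * m / n] gives [c * L >= 25 / 3 * m], just above the required [8 * m]. *)
pose L := (n %/ 2)%N; have L3 : (n <= 3 * L)%N by rewrite /L; move: n2; clear; lia.
have [aW hL] : nrm1 a <= nrm2 a /\ L%:Z * nrm1 a <= nrm2 a.
  by apply: nrm_le; rewrite hn // /L; clear; lia.
pose c : R := 25 * m%:R / n%:R.
have n0 : 0 < n%:R :> R by rewrite ltr0n; apply: ltn_trans n2.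
have m0 : 0 < m%:R :> R by rewrite ltr0n m_gt0.
have k0 : 0 < k%:R :> R by rewrite ltr0n k_gt0.
have c0 : 0 <= c by rewrite /c divr_ge0 ?mulr_ge0.
have cL : 8 * m%:R < c * L%:R.
  have : n%:R <= 3 * L%:R :> R by rewrite -natrM ler_nat.
  rewrite /c mulrAC ltr_pdivlMr // => h.
  have : m%:R * n%:R <= m%:R * (3 * L%:R) :> R by rewrite ler_pM2l.
  have : 0 < m%:R * L%:R :> R.
    by rewrite mulr_gt0 // ltr0n; move: L3 n2; clear; lia.
  by rewrite -!mulrA; lra.
pose D := sq a (0, 0) ((9 * q)%N%:Z + 6).
pose s := [seq (x, b) | x <- inner q, b <- [:: a; rot a; rot (rot a); rot (rot (rot a))]].
pose nhc (xb : site * site) := [set eta : fld R | ~ hard_cross xb.2 (ctr a xb.1) D eta].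
pose bad := [set eta : fld R | exists2 xb, xb \in s & nhc xb eta].
have mn xb : ms setT (nhc xb) by apply: msC; exact: ms_hc.
have mbad : ms setT bad by apply: ms_exists => xb _; exact: mn.
have d0 := ring_delta_gt0; have t4 := ring_tau_ge4.
have badP eta : ~ bad eta -> forall x, x \in inner q -> ring_cross a (ctr a x) D eta.
  move=> nb y yq; have h b : b \in [:: a; rot a; rot (rot a); rot (rot (rot a))] ->
      hard_cross b (ctr a y) D eta.
    move=> hb; apply: contrapT => nh; apply: nb; exists (y, b) => //.
    by apply/allpairsP; exists (y, b).
  by split; apply: h; rewrite !inE eqxx ?orbT.
have pbad : p bad <= ring_delta * (4 * k%:R).
  have -> : 4 * k%:R = (size s)%:R :> R by rewrite size_allpairs -natrM mulnC.
  apply: (law_union_le lawp (F := nhc)) => // -[y b] /allpairsP[[y' b'] /= [yq hb [-> ->]]].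
  rewrite (lawC lawp) ?(ms_hc) //; last exact: ms_hc.
  rewrite lerBlDr -lerBlDl; apply: le_trans (ltW big) _.
  apply: (@le_trans _ _ (p [set eta | hard_cross b' (0, 0) (sq a (0, 0) (2 * B%:Z)) eta])).
    have st b1 := @hc_rot_le R eps p lawp a b1 (2 * B%:Z) a0.
    move: hb; rewrite !inE => /or4P[] /eqP->.
    - exact: lexx.
    - exact: (st a).
    - exact: le_trans (st a) (st (rot a)).
    - exact: le_trans (st a) (le_trans (st (rot a)) (st (rot (rot a)))).
  apply: le_trans (hc_trn_le lawp _ _ _ (ctr a y') a0) _; rewrite trn0.
  apply: (law_mono lawp); [exact: ms_hc|exact: ms_hc|move=> eta /=].
  apply: hard_cross_mono; apply/fsubsetP => z.
  have [y1 y2] := inner_bound yq q_gt0.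
  rewrite !mem_sq // /insq ru_ctr rw_ctr => /andP[z1 z2].
  have sh (i u : int) : `|i| + 9 <= 9 * q%:Z -> `|u| <= ((9 * q)%N%:Z + 6) * nrm2 a ->
      `|u - i * nrm2 a| <= (2 * B%:Z) * nrm2 a.
    move=> hi hu; apply: (@le_trans _ _ ((`|i| + ((9 * q)%N%:Z + 6)) * nrm2 a)).
      have : `|i * nrm2 a| = `|i| * nrm2 a by rewrite normrM (gtr0_norm W0).
      by rewrite mulrDl; move: hu; clear; lia.
    by rewrite ler_pM2r //; move: hi; clear; lia.
  by rewrite !sh.
pose sD := enum_fset D; have usD : uniq sD := fset_uniq D.
(* With [t = ring_tau] the second moment divided by [2 * t] is at most [1 / 8]. *)
have pbad2 : p [set eta | bad (shift c sD eta)] <= 1 / 8 + ring_tau / 2 * p bad.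
  apply: le_trans (law_shift1 eps_gt0 lawp c usD mbad (_ : 0 < ring_tau)) _; first by lra.
  rewrite lerD2r ler_pdivrMr; last by lra.
  have -> : 1 / 8 * (2 * ring_tau) = expR ((25 * m%:R) ^+ 2 * (3 * B%:R) ^+ 2 / eps ^+ 2) :> R.
    by rewrite /ring_tau; lra.
  rewrite ler_expR mulrAC ler_pM2r; last by rewrite invr_gt0 exprn_gt0.
  rewrite /c expr_div_n -mulrA ler_pM2l ?exprn_gt0 ?mulr_gt0 //.
  rewrite mulrC ler_pdivrMr ?exprn_gt0 // -exprMn -!natrM -natrX ler_nat /sD /D.
  have -> : (9 * q)%N%:Z + 6 = B%:Z by rewrite PoszD.
  by apply: card_sq => //; move: n2; clear; lia.
pose Y x eta := #|` Yset a c eta (ctr a x)|.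
have mY y : mdisc setT (Y y) by exact: mdisc_card_Yset.
pose W := [set eta : fld R | exists2 z, z \in shell (9 * q) & wins Y (z :: inner q) z eta].
have mW : ms setT W by apply: ms_exists => z _; exact: ms_wins.
(* Each shell square competes separately against the [k] inner ones, so that its chance is at most
   [1 / (k + 1)]. *)
have pW : p W <= (k.+1%:R)^-1 * m%:R.
  apply: (law_union_le lawp (F := fun z => wins Y (z :: inner q) z)) => //.
    by move=> z _; exact: ms_wins.
  move=> z zs; rewrite -[leRHS]mul1r ler_pdivlMr ?ltr0n //.
  have zi : z \notin inner q.
    by apply/negP => zi; have := shell_far q_gt0 zi zs; rewrite !subrr.
  have unz : uniq (z :: inner q) by rewrite cons_uniq zi uniq_inner.
  apply: (@wins_exchange _ _ _ lawp _ Y mY (z :: inner q) z unz (mem_head _ _)).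
  move=> y ys yz.
  have zs' : ctr a z \in map (ctr a) (z :: inner q) by rewrite map_f ?mem_head.
  have far u v : u \in z :: inner q -> v \in z :: inner q -> u != v ->
      (9 <= `|u.1 - v.1|) || (9 <= `|u.2 - v.2|).
    rewrite !inE => /orP[/eqP->|uq] /orP[/eqP->|vq]; first by rewrite eqxx.
    - by move=> _; exact: shell_far q_gt0 vq zs.
    - by move=> _; rewrite (distrC u.1) (distrC u.2); exact: shell_far q_gt0 uq zs.
    - exact: inner_far uq vq.
  have ci u v : u \in z :: inner q -> v \in z :: inner q -> ctr a u != ctr a v -> u != v.
    by move=> _ _; apply: contraNneq => ->.
  have dis u v : u \in map (ctr a) (z :: inner q) -> v \in map (ctr a) (z :: inner q) ->
      u != v -> [disjoint sq a u 4 & sq a v 4].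
    by move=> /mapP[u' us ->] /mapP[v' vs ->] uv; apply: sq_far => //; apply: far => //; exact: ci.
  have cyz u v : u \in z :: inner q -> v \in z :: inner q -> u != v -> ctr a u != ctr a v.
    move=> us vs uv; apply/negP => /eqP e.
    have := sq_far a0 (far _ _ us vs uv); rewrite e => /fdisjointP/(_ (ctr a v)).
    by rewrite mem_sq // /insq /ru /rw !subrr normr0 mulr_ge0 ?ltW // => /(_ isT).
  have zz : z \in z :: inner q by rewrite mem_head.
  have [pi [pi' [pK p'K H]]] := @swap_Yset R _ a c (ctr a y) (ctr a z) a0
    (map_f (ctr a) ys) zs' (cyz _ _ ys zz yz) dis.
  exists pi, pi'; split; [exact: pK|exact: p'K|move=> eta; have [e1 e2 e3] := H eta].
  split; [exact: e1|exact: e2|move=> v vs vy vz; apply: e3].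
  - exact: map_f.
  - exact: cyz.
  - exact: cyz.
(* Some event always occurs, although the three probabilities are at most [1 / 32], [3 / 16] and
   [1 / 2]. *)
have cov : (setT `<=` bad `|` ([set eta | bad (shift c sD eta)] `|` W))%classic.
  move=> eta _; have [b1|b1] := pselect (bad eta); first by left.
  have [b2|b2] := pselect (bad (shift c sD eta)); first by right; left.
  right; right; have [|z zs hz] := @shell_wins R a q c eta L a0 aW c0 q_gt0 hL cL.
    move=> y yq; split; first exact: badP.
    apply: (@local_ring a (ctr a y) D (shift c sD eta)); last exact: badP.
    by move=> v vD; rewrite /shift /plus vD.
  by exists z => // y; rewrite inE => /orP[/eqP->|/hz//]; rewrite eqxx.
have mb2 : ms setT [set eta | bad (shift c sD eta)] by exact: ms_shift.
have := law_mono lawp (@msT R setT) (msU mbad (msU mb2 mW)) cov; rewrite (lawT lawp).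
move=> H; have {}H := le_trans H (law_leU lawp mbad (msU mb2 mW)).
have h := law_leU lawp mb2 mW.
have e1 : ring_tau * (ring_delta * (4 * k%:R)) = 8^-1.
  rewrite /ring_delta; field; rewrite (gt_eqF k0) /= gt_eqF //; lra.
have b1 : ring_tau * p bad <= 8^-1 by rewrite -e1 ler_pM2l //; lra.
have b2 : 4 * p bad <= ring_tau * p bad by apply: ler_wpM2r => //; exact: law_ge0 lawp _.
have b3 : (k.+1%:R)^-1 * m%:R <= 2^-1 :> R.
  rewrite mulrC ler_pdivrMr ?ltr0n // mulrC ler_pdivlMr // -natrM ler_nat.
  by move: hq; clear; lia.
by apply: (@ring_contra _ (p bad) ring_tau _ _ _ _ H h pbad2 pW b1 b2 b3).
Qed.

End RingThm.

(** * Greedy decomposition of paths *)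

Definition vadd (a b : site) : site := (a.1 + b.1, a.2 + b.2).
Definition vsub (a b : site) : site := (a.1 - b.1, a.2 - b.2).
Definition vmul (c : int) (a : site) : site := (c * a.1, c * a.2).
Definition dot (a b : site) : int := a.1 * b.1 + a.2 * b.2.

Lemma nrm2_ge0 a : 0 <= nrm2 a.
Proof. by rewrite /nrm2 -!expr2 addr_ge0 // sqr_ge0. Qed.

Lemma nrm2D a b : nrm2 (vadd a b) = nrm2 a + 2 * dot a b + nrm2 b.
Proof. by rewrite /nrm2 /dot /=; ring. Qed.

Lemma nrm2M c a : nrm2 (vmul c a) = c ^+ 2 * nrm2 a.
Proof. by rewrite /nrm2 /=; ring. Qed.

Lemma vsub_add a b c : vadd (vsub a b) (vsub b c) = vsub a c.
Proof. by rewrite /vadd /vsub /=; congr (_, _); ring. Qed.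

Lemma cauchy a b : dot a b ^+ 2 <= nrm2 a * nrm2 b.
Proof.
rewrite -subr_ge0; have -> : nrm2 a * nrm2 b - dot a b ^+ 2 = (a.1 * b.2 - a.2 * b.1) ^+ 2.
  by rewrite /nrm2 /dot; ring.
exact: sqr_ge0.
Qed.

Lemma norm_le_sqr (x y : int) : 0 <= y -> x ^+ 2 <= y ^+ 2 -> `|x| <= y.
Proof. by move=> y0; rewrite -(real_normK (num_real x)) ler_sqr ?nnegrE. Qed.

Lemma dot_le a b s r : 0 <= s -> 0 <= r -> nrm2 a <= s ^+ 2 -> nrm2 b <= r ^+ 2 ->
  `|dot a b| <= s * r.
Proof.
move=> s0 r0 ha hb; apply: norm_le_sqr; first exact: mulr_ge0.
by apply: le_trans (cauchy a b) _; rewrite exprMn; apply: ler_pM => //; exact: nrm2_ge0.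
Qed.

Lemma nrm2_tri a b s r : 0 <= s -> 0 <= r -> nrm2 a <= s ^+ 2 -> nrm2 b <= r ^+ 2 ->
  nrm2 (vadd a b) <= (s + r) ^+ 2.
Proof.
move=> s0 r0 ha hb; have := dot_le s0 r0 ha hb; have := ler_norm (dot a b).
rewrite nrm2D sqrrD -mulr_natl; lia.
Qed.

Lemma nrm2_tri_lt a b s r : 0 <= s -> 0 <= r -> nrm2 a < s ^+ 2 -> nrm2 b < r ^+ 2 ->
  nrm2 (vadd a b) < (s + r) ^+ 2.
Proof.
move=> s0 r0 ha hb; have := dot_le s0 r0 (ltW ha) (ltW hb); have := ler_norm (dot a b).
rewrite nrm2D sqrrD -mulr_natl; lia.
Qed.

Lemma coord_le a s : 0 <= s -> nrm2 a <= s ^+ 2 -> `|a.1| <= s /\ `|a.2| <= s.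
Proof.
move=> s0; rewrite /nrm2 => h; split; apply: norm_le_sqr => //; apply: le_trans h.
  by rewrite -expr2 lerDl -expr2 sqr_ge0.
by rewrite -!expr2 lerDr sqr_ge0.
Qed.

Lemma nrm2_coord a s : `|a.1| <= s -> `|a.2| <= s -> nrm2 a <= 2 * s ^+ 2.
Proof.
move=> h1 h2; rewrite /nrm2; have e (i : int) : `|i| <= s -> i * i <= s ^+ 2.
  by move=> h; rewrite -expr2 -(real_normK (num_real i)) ler_sqr ?nnegrE //; exact: le_trans h.
by rewrite mulr_natl mulr2n; apply: lerD; exact: e.
Qed.

Lemma le_of_eq (x y : int) : x = y -> x <= y.
Proof. by move->. Qed.

Section Marks.
Variable n : int.
Hypothesis n_gt0 : 0 < n.

Fixpoint marks (z : site) (p : seq site) : seq site :=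
  if p is v :: p' then if n ^+ 2 <= nrm2 (vsub v z) then v :: marks v p' else marks z p' else [::].

Definition jump (z v : site) := n ^+ 2 <= nrm2 (vsub v z) <= (n + 1) ^+ 2.

Lemma nrm2_nb u v z : nb u v -> nrm2 (vsub u z) < n ^+ 2 -> nrm2 (vsub v z) <= (n + 1) ^+ 2.
Proof.
move=> uv h; rewrite -(vsub_add v u z); have -> : vadd (vsub v u) (vsub u z) = vadd (vsub u z) (vsub v u).
  by rewrite /vadd /=; congr (_, _); rewrite addrC.
apply: nrm2_tri => //; rewrite ?(ltW n_gt0) ?(ltW h) // expr1n.
by move: uv; rewrite nbE /nrm2 /vsub /= => /or4P[] /andP[/eqP-> /eqP->];
  rewrite ?subrr ?(addrC _ 1) ?(addrC _ (-1)) ?addrK ?mulr0 ?mul0r ?mulrNN ?mulr1 ?addr0 ?add0r.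
Qed.

Lemma vsubxx z : nrm2 (vsub z z) = 0.
Proof. by rewrite /nrm2 /vsub /=; ring. Qed.

Lemma vsubxx_lt z : nrm2 (vsub z z) < n ^+ 2.
Proof. by rewrite vsubxx exprn_gt0. Qed.

Lemma marks_jump u z p : nrm2 (vsub u z) < n ^+ 2 -> path nb u p -> path jump z (marks z p).
Proof.
elim: p u z => [|v p IH] u z uz //= /andP[uv vp].
case: ifP => h /=; last by apply: IH vp; rewrite ltNge h.
by rewrite /jump h (nrm2_nb uv uz) /= (IH v) // vsubxx_lt.
Qed.

Lemma marks_sub z p : {subset marks z p <= p}.
Proof.
elim: p z => [|v p IH] z //= w; case: ifP => _; rewrite !inE.
  by case/orP => [->//|/IH->]; rewrite orbT.
by move=> /IH ->; rewrite orbT.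
Qed.

Lemma marks_near u z p w : nrm2 (vsub u z) < n ^+ 2 -> w \in u :: p ->
  exists2 x, x \in z :: marks z p & nrm2 (vsub w x) < n ^+ 2.
Proof.
elim: p u z => [|v p IH] u z uz.
  by rewrite inE => /eqP->; exists z; rewrite ?mem_head.
rewrite inE => /orP[/eqP->|wp]; first by exists z; rewrite ?mem_head.
rewrite /=; case: ifP => h.
  have [x xm hx] := IH v v (vsubxx_lt v) wp; exists x => //; by rewrite inE xm orbT.
by apply: IH wp; rewrite ltNge h.
Qed.

Lemma marks_last u z p : nrm2 (vsub u z) < n ^+ 2 ->
  nrm2 (vsub (last u p) (last z (marks z p))) < n ^+ 2.
Proof.
elim: p u z => [|v p IH] u z uz //=.
case: ifP => h /=; first exact/IH/vsubxx_lt.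
by apply: IH; rewrite ltNge h.
Qed.

(** Here [q] is the part of the current piece already read. If every piece has length at least
    [be / al], the lengths add up. The threshold is kept as a ratio of naturals because it will be a
    ratio of powers. *)
Lemma marks_piece (C : site -> bool) (al be : nat) z q p :
  path nb z (q ++ p) -> (forall w, w \in z :: q ++ p -> C w) ->
  (exists z' q', [/\ z' \in z :: marks z p, path nb z' q', forall w, w \in z' :: q' -> C w,
     n ^+ 2 <= nrm2 (vsub (last z' q') z') & (size q' * al < be)%N]) \/
  (be * size (marks z p) <= al * (size q + size p))%N.
Proof.
elim: p z q => [|v p IH] z q; first by rewrite muln0; right.
move=> hp hC /=; case: ifP => h.
  have hp' : path nb z ((rcons q v) ++ p) by rewrite cat_rcons.
  have [lt|ge] := ltnP (size (rcons q v) * al) be.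
    left; exists z, (rcons q v); split; rewrite ?mem_head ?last_rcons //.
      by move: hp'; rewrite cat_path => /andP[].
    move=> w; rewrite inE mem_rcons inE => hw; apply: hC; rewrite inE mem_cat inE.
    by case/or3P: hw => ->; rewrite ?orbT.
  have vp : path nb v ([::] ++ p) by move: hp'; rewrite cat_path last_rcons => /andP[].
  have [|[z' [q' [h1 h2 h3 h4 h5]]]|hle] := IH v [::] vp.
  - by move=> w /=; rewrite inE => hw; apply: hC; rewrite inE mem_cat inE; case/orP: hw => ->; rewrite ?orbT.
  - by left; exists z', q'; split=> //; rewrite inE h1 orbT.
  - right; rewrite mulnS; apply: leq_trans (leq_add ge hle) _.
    by rewrite size_rcons (mulnC _.+1) -mulnDr add0n addSnnS.
have hp' : path nb z ((rcons q v) ++ p) by rewrite cat_rcons.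
have [|l|hle] := IH z (rcons q v) hp'.
- by move=> w; rewrite cat_rcons; exact: hC.
- by left.
- by right; move: hle; rewrite size_rcons addSnnS.
Qed.

Lemma jump_dist z s : path jump z s ->
  nrm2 (vsub (last z s) z) <= ((size s)%:Z * (n + 1)) ^+ 2.
Proof.
elim: s z => [|v s IH] z /=; first by rewrite vsubxx mul0r.
move=> /andP[/andP[_ h] vs]; rewrite -(vsub_add _ v) intS mulrDl mul1r addrC.
by apply: nrm2_tri (IH _ vs) h; rewrite ?mulr_ge0 //; move: n_gt0; clear; lia.
Qed.

Section Quad.
Variables (M : int) (D : site).

(** For [M] steps with total displacement [D] this is [M ^ 2] times the sum of squared deviations of
    the steps from their mean [D / M], scaled to stay integral. *)
Fixpoint quad (z : site) (s : seq site) : int :=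
  if s is v :: s' then nrm2 (vsub (vmul M (vsub v z)) D) + quad v s' else 0.

Lemma quad_ge0 z s : 0 <= quad z s.
Proof. by elim: s z => //= v s IH z; rewrite addr_ge0 // nrm2_ge0. Qed.

Lemma quad_cat z s s' : quad z (s ++ s') = quad z s + quad (last z s) s'.
Proof. by elim: s z => [|v s IH] z /=; rewrite ?add0r // IH addrA. Qed.

Lemma quad_le z s : path jump z s ->
  quad z s <= M ^+ 2 * (n + 1) ^+ 2 * (size s)%:Z - 2 * M * dot D (vsub (last z s) z)
              + (size s)%:Z * nrm2 D.
Proof.
elim: s z => [|v s IH] z /=; first by rewrite (_ : dot _ _ = 0) ?mulr0 ?mul0r // /dot /=; ring.
move=> /andP[/andP[_ h] vs]; have ih := IH v vs.
have e1 : nrm2 (vsub (vmul M (vsub v z)) D) =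
    M ^+ 2 * nrm2 (vsub v z) - 2 * M * dot D (vsub v z) + nrm2 D.
  by rewrite /nrm2 /dot /=; ring.
have e2 : dot D (vsub (last v s) z) = dot D (vsub (last v s) v) + dot D (vsub v z).
  by rewrite /dot /=; ring.
have h' : M ^+ 2 * nrm2 (vsub v z) <= M ^+ 2 * (n + 1) ^+ 2 by apply: ler_wpM2l => //; exact: sqr_ge0.
rewrite e1 e2 intS -subr_ge0.
set A := M ^+ 2 * (n + 1) ^+ 2 in ih h' *; set S := (size s)%:Z in ih *.
rewrite -subr_ge0 in h'; rewrite -subr_ge0 in ih.
by apply: le_trans (addr_ge0 h' ih) _; apply: le_of_eq; ring.
Qed.

(** Cauchy-Schwarz for the partial sums of the deviations, proved one step at a time. *)
Lemma quad_dev z s : nrm2 (vsub (vmul M (vsub (last z s) z)) (vmul (size s)%:Z D)) <=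
  (size s)%:Z * quad z s.
Proof.
elim: s z => [|v s IH] z /=; first by rewrite mul0r (_ : nrm2 _ = 0) // /nrm2 /=; ring.
set x := vsub (vmul M (vsub v z)) D.
set y := vsub (vmul M (vsub (last v s) v)) (vmul (size s)%:Z D).
have -> : vsub (vmul M (vsub (last v s) z)) (vmul (size s).+1%:Z D) = vadd x y.
  by rewrite /x /y /vadd /vsub /vmul intS /=; congr (_, _); ring.
have := IH v; rewrite -/y; move: (quad v s) (quad_ge0 v s) => Q Q0 hy.
case: (size s) hy => [|m] hy.
  have y0 : nrm2 y = 0 by apply/eqP; rewrite eq_le nrm2_ge0 andbT; move: hy; rewrite mul0r.
  have d0 : `|dot x y| <= 0.
    by apply: norm_le_sqr => //; apply: le_trans (cauchy x y) _; rewrite y0 mulr0 expr0n.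
  by rewrite nrm2D y0 mul1r; move: d0 Q0; clear; lia.
have := nrm2_ge0 (vsub (vmul m.+1%:Z x) y).
have -> : nrm2 (vsub (vmul m.+1%:Z x) y) = m.+1%:Z * (m.+1%:Z * nrm2 x - 2 * dot x y) + nrm2 y.
  by rewrite /nrm2 /dot /=; ring.
rewrite nrm2D; set X := nrm2 x; set Y := nrm2 y in hy *; set d := dot x y => h.
have m0 : 0 < m.+1%:Z by [].
have : 0 <= m.+1%:Z * (m.+1%:Z * X - 2 * d + Q) by rewrite mulrDr; apply: le_trans h _; rewrite lerD2l.
rewrite pmulr_rge0 // => h'; rewrite -subr_ge0 in hy; rewrite -subr_ge0.
by apply: le_trans (addr_ge0 h' hy) _; apply: le_of_eq; rewrite [m.+2%:Z]intS; ring.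
Qed.

End Quad.

Lemma quad_total z s M D : path jump z s -> M = (size s)%:Z -> D = vsub (last z s) z ->
  quad M D z s <= M * (M ^+ 2 * (n + 1) ^+ 2 - nrm2 D).
Proof.
move=> hs eM eD; apply: le_trans (quad_le M D hs) _.
rewrite -eD -eM (_ : dot D D = nrm2 D) //.
by apply: le_of_eq; ring.
Qed.

Lemma quad_mark z s w M D : path jump z s -> w \in z :: s ->
  M = (size s)%:Z -> D = vsub (last z s) z ->
  exists2 m : nat, (m <= size s)%N & nrm2 (vsub (vmul M (vsub w z)) (vmul m%:Z D)) <=
  m%:Z * (M * (M ^+ 2 * (n + 1) ^+ 2 - nrm2 D)).
Proof.
move=> hs ws eM eD.
have [s1 [s2 [def_s hw]]] : exists s1 s2, s = s1 ++ s2 /\ last z s1 = w.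
  by case/splitPl: ws => s1 s2 h; exists s1, s2.
exists (size s1); first by rewrite def_s size_cat leq_addr.
rewrite -hw; apply: le_trans (quad_dev M D z s1) _; apply: ler_wpM2l => //.
apply: le_trans (quad_total hs eM eD); rewrite def_s quad_cat lerDl; exact: quad_ge0.
Qed.

End Marks.

Section Arith.
Variables (t n M : int).
Hypotheses (t8 : 8 <= t) (hn : 2 * t ^+ 2 <= n) (M1 : t ^+ 2 - 1 <= M) (M2 : M <= t ^+ 2 + 3).

Lemma t2_ge : 8 * t <= t ^+ 2.
Proof. by rewrite expr2 ler_pM2r //; clear -t8; lia. Qed.

Lemma unit_gt0 : 0 < n. Proof. by have := t2_ge; clear -t8 hn; lia. Qed.
Lemma M_gt0 : 0 < M. Proof. by have := t2_ge; clear -t8 M1; lia. Qed.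

(** The steps have total length at most [(t ^+ 2 + 4) * n], the chord at least [(t ^+ 2 - 1) * n],
    and the squares differ by only [(10 * t ^+ 2 + 15) * n ^+ 2]. So the marks stay within order
    [t * n] of a chord of length about [t ^+ 2 * n]; this is why the scale ratio is a square. *)
Lemma quad_arith (N m : int) : ((t ^+ 2 - 1) * n) ^+ 2 <= N -> 0 <= m -> m <= M ->
  m * (M * (M ^+ 2 * (n + 1) ^+ 2 - N)) <= (M * n) ^+ 2 * (11 * t ^+ 2).
Proof.
move=> hN m0 mM; have T := t2_ge; have M0 := M_gt0; have n0 := unit_gt0.
have h : M ^+ 2 * (n + 1) ^+ 2 - N <= n ^+ 2 * (11 * t ^+ 2).
  have h1 : M * (n + 1) <= (t ^+ 2 + 4) * n by rewrite mulrDr mulr1 mulrDl; nia.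
  have h2 : (M * (n + 1)) ^+ 2 <= ((t ^+ 2 + 4) * n) ^+ 2.
    rewrite ler_sqr ?nnegrE //; first by rewrite mulr_ge0 //; lia.
    by rewrite mulr_ge0 //; lia.
  rewrite -exprMn; apply: (@le_trans _ _ (((t ^+ 2 + 4) * n) ^+ 2 - ((t ^+ 2 - 1) * n) ^+ 2)).
    exact: lerB.
  have -> : ((t ^+ 2 + 4) * n) ^+ 2 - ((t ^+ 2 - 1) * n) ^+ 2 = n ^+ 2 * (10 * t ^+ 2 + 15) by ring.
  by apply: ler_wpM2l; [exact: sqr_ge0|lia].
have X0 : 0 <= n ^+ 2 * (11 * t ^+ 2) by apply: mulr_ge0; [exact: sqr_ge0|apply: mulr_ge0 => //; exact: sqr_ge0].
apply: (@le_trans _ _ (m * (M * (n ^+ 2 * (11 * t ^+ 2))))).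
  by apply: ler_wpM2l => //; apply: ler_wpM2l => //; exact: ltW.
have -> : (M * n) ^+ 2 * (11 * t ^+ 2) = M * (M * (n ^+ 2 * (11 * t ^+ 2))) by ring.
by apply: ler_wpM2r => //; apply: mulr_ge0 => //; exact: ltW.
Qed.

Lemma dev27 : (8 * t) ^+ 2 * ((M * n) ^+ 2 * (11 * t ^+ 2)) <= (27 * M * t ^+ 2 * n) ^+ 2.
Proof.
have -> : (8 * t) ^+ 2 * ((M * n) ^+ 2 * (11 * t ^+ 2)) = 704 * (M * t ^+ 2 * n) ^+ 2 by ring.
have -> : (27 * M * t ^+ 2 * n) ^+ 2 = 729 * (M * t ^+ 2 * n) ^+ 2 by ring.
by apply: ler_wpM2r => //; exact: sqr_ge0.
Qed.

Lemma dev2 (m : int) : 0 <= m -> m <= M -> m ^+ 2 * (2 * (M * n) ^+ 2) <= (2 * M * t ^+ 2 * n) ^+ 2.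
Proof.
move=> m0 mM; have T := t2_ge.
have -> : (2 * M * t ^+ 2 * n) ^+ 2 = (2 * (t ^+ 2) ^+ 2) * (2 * (M * n) ^+ 2) by ring.
apply: ler_wpM2r; first by rewrite mulr_ge0 // sqr_ge0.
have h : m <= t ^+ 2 + 3 by lia.
apply: (@le_trans _ _ ((t ^+ 2 + 3) ^+ 2)); first by rewrite ler_sqr ?nnegrE //; lia.
move: T t8; move: (t ^+ 2) => T' h1 h2; rewrite !expr2; nia.
Qed.

Lemma a_lower : (7 * t + 2) * M * n <= 8 * t * ((t ^+ 2 - 1) * n).
Proof.
have n0 := unit_gt0; rewrite [leRHS]mulrA ler_pM2r //.
apply: (@le_trans _ _ ((7 * t + 2) * (t ^+ 2 + 3))); first by apply: ler_wpM2l => //; lia.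
by have := t2_ge; rewrite expr2; nia.
Qed.

Lemma a_upper (i d f : int) : f = 8 * t * d - M * n * i -> `|f| <= M * n -> `|d| <= M * (n + 1) ->
  `|i| <= 9 * t.
Proof.
move=> hf f1 d1; have M0 := M_gt0; have n0 := unit_gt0.
have Mn : 0 < M * n by exact: mulr_gt0.
have h : `|M * n * i| <= 8 * t * (M * (n + 1)) + M * n.
  have -> : M * n * i = 8 * t * d - f by rewrite hf; ring.
  apply: le_trans (ler_normB _ _) _; apply: lerD => //; rewrite normrM (ger0_norm (_ : 0 <= 8 * t)); last lia.
  by apply: ler_wpM2l => //; lia.
rewrite normrM (gtr0_norm Mn) in h.
rewrite -(ler_pM2l Mn); apply: le_trans h _.
have -> : 8 * t * (M * (n + 1)) + M * n = M * (8 * t * (n + 1) + n) by ring.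
have -> : M * n * (9 * t) = M * (n * (9 * t)) by ring.
by rewrite ler_pM2l //; have := t2_ge; nia.
Qed.

(** Here 29 is 27 for the deviation of the marks plus 2 for rounding the direction, and
    [5 * 29 <= 24 * 7]. The ratio 3/5 leaves room for the vertices between marks. *)
Lemma rw_arith (W r : int) : (7 * t * n) ^+ 2 <= W -> (8 * t * r) ^+ 2 <= W * (29 * t ^+ 2 * n) ^+ 2 ->
  5 * `|r| <= 3 * W.
Proof.
move=> hW hr; have W0 : 0 <= W by apply: le_trans hW; exact: sqr_ge0.
suff : `|5 * r| <= 3 * W by rewrite normrM.
apply: norm_le_sqr; first exact: mulr_ge0.
have T0 : 0 < (8 * t) ^+ 2 by rewrite exprn_gt0 //; clear -t8; lia.
rewrite -(ler_pM2l T0) -exprMn.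
rewrite [leLHS](_ : _ = 5 ^+ 2 * (8 * t * r) ^+ 2); last by ring.
apply: (@le_trans _ _ (5 ^+ 2 * (W * (29 * t ^+ 2 * n) ^+ 2))); first by apply: ler_wpM2l.
rewrite [leLHS](_ : _ = W * t ^+ 2 * (5 * 29 * (t * n)) ^+ 2); last by ring.
rewrite [leRHS](_ : _ = W * t ^+ 2 * (24 ^+ 2 * W)); last by ring.
apply: ler_wpM2l; first by rewrite mulr_ge0 // sqr_ge0.
apply: (@le_trans _ _ (24 ^+ 2 * (7 * t * n) ^+ 2)); last by apply: ler_wpM2l.
have tn : 0 <= t * n by rewrite mulr_ge0 ?(ltW unit_gt0) //; clear -t8; lia.
rewrite -exprMn (_ : 24 * (7 * t * n) = 24 * 7 * (t * n)); last by ring.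
have c0 (k : nat) : k%:R * (t * n) \is Num.nneg by rewrite nnegrE mulr_ge0.
by rewrite -!natrM ler_sqr ?c0 //; apply: ler_wpM2r; rewrite ?ler_nat.
Qed.

Lemma ru_arith (W r d tau : int) : t = 8 * tau -> (7 * t * n) ^+ 2 <= W ->
  8 * t * r = M * W + d -> d ^+ 2 <= W * (2 * (M * n) ^+ 2) -> (tau - 1) * W <= r.
Proof.
move=> ht hW hr hd; have M0 := M_gt0; have W0 : 0 <= W by apply: le_trans hW; exact: sqr_ge0.
have h : `|4 * t * d| <= M * W.
  apply: norm_le_sqr; first by rewrite mulr_ge0 // ltW.
  have -> : (4 * t * d) ^+ 2 = (4 * t) ^+ 2 * d ^+ 2 by ring.
  apply: (@le_trans _ _ ((4 * t) ^+ 2 * (W * (2 * (M * n) ^+ 2)))).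
    by apply: ler_wpM2l => //; exact: sqr_ge0.
  have -> : (4 * t) ^+ 2 * (W * (2 * (M * n) ^+ 2)) = W * M ^+ 2 * (32 * (t * n) ^+ 2) by ring.
  have -> : (M * W) ^+ 2 = W * M ^+ 2 * W by ring.
  apply: ler_wpM2l; first by rewrite mulr_ge0 // sqr_ge0.
  apply: le_trans hW; have -> : (7 * t * n) ^+ 2 = 49 * (t * n) ^+ 2 by ring.
  by apply: ler_wpM2r => //; exact: sqr_ge0.
have T0 : 0 < 32 * t ^+ 2 by have := t2_ge; clear -t8; lia.
rewrite -(ler_pM2l T0).
have -> : 32 * t ^+ 2 * r = 4 * t * M * W + 4 * t * d.
  have -> : 4 * t * M * W + 4 * t * d = 4 * t * (M * W + d) by ring.
  by rewrite -hr; ring.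
apply: (@le_trans _ _ ((4 * t - 1) * (M * W))); last first.
  have -> : (4 * t - 1) * (M * W) = 4 * t * M * W - M * W by ring.
  by rewrite lerD2l; move: h; clear; lia.
apply: (@le_trans _ _ ((4 * t - 1) * ((t ^+ 2 - 1) * W))); last first.
  by apply: ler_wpM2l; [clear -t8; lia|apply: ler_wpM2r].
rewrite [leLHS]mulrA [leRHS]mulrA; apply: ler_wpM2r => //.
have -> : 32 * t ^+ 2 * (tau - 1) = 4 * t ^+ 3 - 32 * t ^+ 2.
  by rewrite ht; ring.
have -> : (4 * t - 1) * (t ^+ 2 - 1) = 4 * t ^+ 3 - t ^+ 2 - 4 * t + 1 by ring.
by have := t2_ge; clear -t8; lia.
Qed.

End Arith.

Lemma path_upto (f : site -> int) (s hi : int) u p :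
  (forall x y, nb x y -> `|f y - f x| <= s) -> path nb u p -> f u <= hi + s -> hi <= f (last u p) ->
  exists q, [/\ path nb u q, {subset q <= p}, hi <= f (last u q) &
    forall w, w \in u :: q -> f w <= hi + s].
Proof.
move=> hs; elim: p u => [|v p IH] u /=.
  by move=> _ fu hl; exists [::]; split=> // w; rewrite inE => /eqP->.
move=> /andP[uv vp] fu hl; have [h|h] := leP hi (f u).
  by exists [::]; split=> // w; rewrite inE => /eqP->.
have fv : f v <= hi + s by have := hs _ _ uv; move: h; clear; lia.
have [q [vq sub hq bq]] := IH v vp fv hl; exists (v :: q); split=> //=.
- by rewrite uv.
- by move=> w; rewrite !inE => /orP[->//|/sub->]; rewrite orbT.
- by move=> w; rewrite inE => /orP[/eqP->|/bq].
Qed.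

Lemma path_from (f : site -> int) (lo : int) u p : path nb u p ->
  (forall w, w \in u :: p -> lo < f w) \/
  exists y q, [/\ path nb y q, {subset y :: q <= u :: p}, last y q = last u p, f y <= lo &
    forall w, w \in q -> lo < f w].
Proof.
elim: p u => [|v p IH] u /=.
  move=> _; have [h|h] := leP (f u) lo; last by left=> w; rewrite inE => /eqP->.
  by right; exists u, [::]; split.
move=> /andP[uv vp]; have [h|[y [q [h1 h2 h3 h4 h5]]]] := IH v vp.
  have [fu|fu] := leP (f u) lo; first by right; exists u, (v :: p); split=> //=; rewrite uv.
  by left=> w; rewrite inE => /orP[/eqP->|/h].
by right; exists y, q; split=> // w /h2 hw; rewrite inE hw orbT.
Qed.

(** Stop at the first visit to [hi], then start at the last visit to [lo] before it. *)
Lemma path_window (f : site -> int) (s lo hi : int) u p : 0 <= s ->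
  (forall x y, nb x y -> `|f y - f x| <= s) -> path nb u p -> f u <= lo -> lo <= hi ->
  hi <= f (last u p) ->
  exists y q, [/\ path nb y q, {subset y :: q <= u :: p}, f y <= lo, hi <= f (last y q) &
    forall w, w \in y :: q -> lo - s <= f w <= hi + s].
Proof.
move=> s0 hs up fu lh hl.
have [|q [uq sub hq bq]] := path_upto hs up _ hl; first by move: fu lh s0; clear; lia.
have [h|[y [r [yr sub' hl' fy br]]]] := path_from f lo uq.
  by have := h u (mem_head _ _); move: fu; clear; lia.
exists y, r; split=> //; last 1 first.
- move=> w wr; rewrite bq ?sub' // andbT; move: wr; rewrite inE => /orP[/eqP->|/br]; last by move: s0; clear; lia.
  case: r {sub'} yr hl' br => [|x r] /=.
    by move=> _ e _; move: hq; rewrite -e; move: lh s0; clear; lia.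
  by move=> /andP[/hs + _] _ /(_ x (mem_head _ _)); clear; lia.
- by move=> w /sub'; rewrite !inE => /orP[->//|/sub->]; rewrite orbT.
- by rewrite hl'.
Qed.

(** * Straight paths cross rectangles *)

(** One piece may be lost against [t ^+ 2]: it accounts for the unfinished last piece and for the
    overshoot of the jumps, at most 1 each, which is small as [2 * t ^+ 2 <= n]. *)
Lemma size_marks_ge (t n : int) z s E : 8 <= t -> 2 * t ^+ 2 <= n -> path (jump n) z s ->
  nrm2 (vsub E (last z s)) < n ^+ 2 -> (t ^+ 2 * n) ^+ 2 <= nrm2 (vsub E z) ->
  t ^+ 2 - 1 <= (size s)%:Z.
Proof.
move=> t8 hn hs hE hz; rewrite leNgt; apply/negP => hM.
have T := t2_ge t8; have n0 : 0 < n by apply: lt_le_trans hn; clear -T t8; lia.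
have hD := jump_dist n0 hs; set M := (size s)%:Z in hM hD.
have M0 : 0 <= M by [].
have hD' : nrm2 (vsub (last z s) z) < (M * (n + 1) + 1) ^+ 2.
  apply: le_lt_trans hD _; rewrite ltr_pXn2r ?nnegrE //; first by clear; lia.
    by rewrite mulr_ge0 //; clear -n0; lia.
  by rewrite addr_ge0 // mulr_ge0 //; clear -n0; lia.
have := @nrm2_tri_lt _ _ n (M * (n + 1) + 1) (ltW n0) _ hE hD'; rewrite vsub_add.
have MM : 0 <= M * (n + 1) by rewrite mulr_ge0 //; clear -n0; lia.
have h1 : 0 <= M * (n + 1) + 1 by clear -MM; lia.
move=> /(_ h1) h; have := le_lt_trans hz h; rewrite ltr_pXn2r ?nnegrE //; first last.
- by clear -h1 n0; lia.
- by rewrite mulr_ge0 ?(ltW n0) //; clear -T t8; lia.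
rewrite mulrDr mulr1; have : M * n <= (t ^+ 2 - 2) * n.
  by rewrite ler_pM2r //; clear -hM; lia.
by rewrite mulrBl; clear -hM hn T t8; lia.
Qed.

Lemma vsub_dist_ge (s r : int) E w z : 0 <= s -> 0 <= r -> nrm2 (vsub E w) < r ^+ 2 ->
  (s + r) ^+ 2 <= nrm2 (vsub E z) -> s ^+ 2 <= nrm2 (vsub w z).
Proof.
move=> s0 r0 h1 h2; rewrite leNgt; apply/negP => h.
by have := nrm2_tri_lt r0 s0 h1 h; rewrite vsub_add addrC ltNge h2.
Qed.

Lemma ru_dot a x v : ru a x v = dot a (vsub v x).
Proof. by rewrite /ru /uu /dot /=; ring. Qed.
Lemma rw_dot a x v : rw a x v = dot (rot a) (vsub v x).
Proof. by rewrite /rw /ww /dot /=; ring. Qed.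

Lemma modz_coord (d m : int) : 0 < m -> exists2 i : int, True & 0 <= d - m * i < m.
Proof.
move=> m0; exists (d %/ m)%Z => //; have -> : d - m * (d %/ m)%Z = (d %% m)%Z.
  by rewrite {1}(divz_eq d m) mulrC addrC addKr.
by rewrite modz_ge0 ?lt0r_neq0 // ltz_pmod.
Qed.

Section Straight.
Variables (t n tau : int) (z : site) (s : seq site) (E : site).
Hypotheses (t8 : 8 <= t) (ht : t = 8 * tau) (hn : 2 * t ^+ 2 <= n) (hs : path (jump n) z s).
Hypotheses (hM : (size s)%:Z <= t ^+ 2 + 3) (hE : nrm2 (vsub E (last z s)) < n ^+ 2).
Hypothesis (hz : (t ^+ 2 * n) ^+ 2 <= nrm2 (vsub E z)).

(** The vector is [8 * t * D / M] rounded to multiples of [n]. Its length is about [8 * t * n], so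
    the chord measures about [tau = t / 8] of it, and rounding leaves finitely many directions for a
    union bound. *)
Lemma straight_dir : exists i j : int, [/\ `|i| <= 9 * t, `|j| <= 9 * t,
  (7 * t * n) ^+ 2 <= nrm2 (n * i, n * j),
  forall w, w \in z :: s -> 5 * `|rw (n * i, n * j) z w| <= 3 * nrm2 (n * i, n * j) &
  (tau - 1) * nrm2 (n * i, n * j) <= ru (n * i, n * j) z (last z s)].
Proof.
have T := t2_ge t8; have hM1 := size_marks_ge t8 hn hs hE hz.
have n0 := unit_gt0 t8 hn; have hM2 := hM; set M := (size s)%:Z in hM1 hM2 *.
have M0 : 0 < M := M_gt0 t8 hM1.
set D := vsub (last z s) z.
have hD : ((t ^+ 2 - 1) * n) ^+ 2 <= nrm2 D.
  apply: (@vsub_dist_ge _ n E) hE _ => //; [|exact: ltW|].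
    by rewrite mulr_ge0 ?(ltW n0) //; clear -T t8; lia.
  by rewrite -[X in (_ + X) ^+ 2]mul1r -mulrDl subrK.
have hD2 := jump_dist n0 hs; rewrite -/M -/D in hD2.
have Mn1 : 0 <= M * (n + 1) by rewrite mulr_ge0 ?(ltW M0) //; clear -n0; lia.
have [D1 D2] := coord_le Mn1 hD2.
have Mn : 0 < M * n by exact: mulr_gt0.
have [i _ hi] := modz_coord (8 * t * D.1) Mn; have [j _ hj] := modz_coord (8 * t * D.2) Mn.
exists i, j; set a : site := (n * i, n * j).
pose f : site := (8 * t * D.1 - M * n * i, 8 * t * D.2 - M * n * j).
have f1 : `|f.1| <= M * n by case/andP: hi => g1 g2; rewrite /f /= ger0_norm // ltW.
have f2 : `|f.2| <= M * n by case/andP: hj => g1 g2; rewrite /f /= ger0_norm // ltW.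
have hf : nrm2 f <= 2 * (M * n) ^+ 2 by exact: nrm2_coord.
have eD : vmul (8 * t) D = vadd (vmul M a) f by rewrite /vadd /vmul /f /=; congr (_, _); ring.
have ha : (7 * t * n) ^+ 2 <= nrm2 a.
  rewrite leNgt; apply/negP => h.
  have h1 : nrm2 (vmul M a) < (7 * t * n * M) ^+ 2.
    by rewrite nrm2M mulrC exprMn ltr_pM2r // exprn_gt0.
  have h2 : nrm2 f < (2 * M * n) ^+ 2.
    apply: le_lt_trans hf _; rewrite [ltRHS](_ : _ = 4 * (M * n) ^+ 2); last by ring.
    by rewrite ltr_pM2r // exprn_gt0.
  have g1 : 0 <= 7 * t * n * M.
    by rewrite !mulr_ge0 ?(ltW n0) ?(ltW M0) //; clear -t8; lia.
  have g2 : 0 <= 2 * M * n by rewrite !mulr_ge0 ?(ltW n0) ?(ltW M0).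
  have := nrm2_tri_lt g1 g2 h1 h2; rewrite -eD nrm2M.
  apply/negP; rewrite -leNgt.
  apply: (@le_trans _ _ ((8 * t) ^+ 2 * ((t ^+ 2 - 1) * n) ^+ 2)); last first.
    by apply: ler_wpM2l => //; exact: sqr_ge0.
  rewrite -exprMn (_ : 7 * t * n * M + 2 * M * n = (7 * t + 2) * M * n); last by ring.
  have al := a_lower t8 hn hM1 hM2; rewrite ler_pXn2r ?nnegrE //.
    by rewrite (_ : (7 * t + 2) * M * n = 7 * t * n * M + 2 * M * n) ?addr_ge0 //; ring.
  by rewrite !mulr_ge0 ?(ltW n0) //; clear -T t8; lia.
split=> //.
- by apply: (@a_upper t n M t8 hn hM1 hM2 i D.1 f.1).
- by apply: (@a_upper t n M t8 hn hM1 hM2 j D.2 f.2).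
- move=> w ws; apply: (@rw_arith t n t8 hn (nrm2 a) (rw a z w)) => //.
  have [m mM hm] := quad_mark hs ws (erefl M) (erefl D).
  have m0 : 0 <= m%:Z by [].
  have {}mM : m%:Z <= M by rewrite lez_nat.
  set e := vsub (vmul M (vsub w z)) (vmul m%:Z D) in hm.
  have he : nrm2 e <= (M * n) ^+ 2 * (11 * t ^+ 2).
    exact: le_trans hm (quad_arith t8 hn hM1 hM2 hD m0 mM).
  pose g := vsub (vmul (8 * t) (vsub w z)) (vmul m%:Z a).
  have eg : vmul M g = vadd (vmul (8 * t) e) (vmul m%:Z f).
    by rewrite /g /e /f /vadd /vsub /vmul /=; congr (_, _); ring.
  have x1 : nrm2 (vmul (8 * t) e) <= (27 * M * t ^+ 2 * n) ^+ 2.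
    rewrite nrm2M; apply: le_trans (dev27 t n M); apply: ler_wpM2l he; exact: sqr_ge0.
  have x2 : nrm2 (vmul m%:Z f) <= (2 * M * t ^+ 2 * n) ^+ 2.
    rewrite nrm2M; apply: le_trans (dev2 t8 hn hM1 hM2 m0 mM); apply: ler_wpM2l hf; exact: sqr_ge0.
  have y1 (k : nat) : 0 <= k%:R * M * t ^+ 2 * n :> int.
    apply: mulr_ge0 (ltW n0); apply: mulr_ge0 (sqr_ge0 _); apply: mulr_ge0 (ltW M0); exact: ler0n.
  have := nrm2_tri (y1 27) (y1 2) x1 x2; rewrite -eg nrm2M.
  rewrite (_ : _ + _ = M * (29 * t ^+ 2 * n)); last by ring.
  rewrite exprMn ler_pM2l ?exprn_gt0 // => hg.
  have -> : 8 * t * rw a z w = dot (rot a) g by rewrite rw_dot /dot /g /=; ring.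
  apply: le_trans (cauchy _ _) _; rewrite nrm2_rot; apply: ler_wpM2l => //; exact: nrm2_ge0.
- apply: (@ru_arith t n M t8 hM1 (nrm2 a) _ (dot a f)) => //.
    by rewrite ru_dot -/D /dot /nrm2 /f /=; ring.
  apply: le_trans (cauchy _ _) _; apply: ler_wpM2l hf; exact: nrm2_ge0.
Qed.

End Straight.

(* Seen from this centre, the tube of width [2 |a|] around the ray from [y] in the direction [a]
   is the strip crossed by [hard_cross]. *)
Definition rect_ctr (a y : site) (c : int) : site :=
  (y.1 + c * a.1 + 2 * a.2, y.2 + c * a.2 - 2 * a.1).

Lemma ru_rect a y c v : ru a (rect_ctr a y c) v = ru a y v - c * nrm2 a.
Proof. by rewrite /ru /uu /rect_ctr /nrm2 /=; ring. Qed.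
Lemma rw_rect a y c v : rw a (rect_ctr a y c) v = rw a y v + 2 * nrm2 a.
Proof. by rewrite /rw /ww /rect_ctr /nrm2 /=; ring. Qed.

Lemma dot_norm1 a v s : `|v.1| <= s -> `|v.2| <= s -> `|dot a v| <= nrm1 a * s.
Proof.
move=> h1 h2; rewrite /dot /nrm1 mulrDl; apply: le_trans (ler_normD _ _) _.
by rewrite !normrM; apply: lerD; apply: ler_wpM2l.
Qed.

Lemma small_slack (t n W N : int) : 8 <= t -> 0 < n -> (7 * t * n) ^+ 2 <= W ->
  N <= 18 * t * n -> 10 * (N * n) < W.
Proof.
move=> t8 n0 hW hN; apply: lt_le_trans hW.
apply: (@le_lt_trans _ _ (10 * (18 * t * n * n))); first by rewrite ler_pM2l // ler_pM2r.
have -> : 10 * (18 * t * n * n) = (180 * t) * (n * n) by ring.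
have -> : (7 * t * n) ^+ 2 = (49 * t * t) * (n * n) by ring.
by rewrite ltr_pM2r ?mulr_gt0 // ltr_pM2r; clear -t8; lia.
Qed.

Section StraightCross.
Variables (R : realType) (D : {fset site}) (eta : site -> R).
Variables (t n tau : int) (z : site) (p : seq site) (y : site) (B : int).
Hypotheses (t8 : 8 <= t) (ht : t = 8 * tau) (hn : 2 * t ^+ 2 <= n).
Hypotheses (zp : path nb z p) (hC : forall v, v \in z :: p -> diff D eta eta v).
Hypotheses (hM : (size (marks n z p))%:Z <= t ^+ 2 + 3).
Hypothesis (hz : (t ^+ 2 * n) ^+ 2 <= nrm2 (vsub (last z p) z)).
Hypotheses (y1 : `|z.1 - y.1| <= n) (y2 : `|z.2 - y.2| <= n).

(** In units of [|a|], the path strays from the ray by at most 3/5 at the marks, 1/10 between marks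
    and 1/10 from replacing [z] by the grid point [y], so it stays in a tube of half-width 1. The
    range of [c] keeps the rectangles away from both ends. *)
Lemma straight_cross : exists i j : int, [/\ `|i| <= 9 * t, `|j| <= 9 * t,
  (7 * t * n) ^+ 2 <= nrm2 (n * i, n * j) &
  forall c, 6 <= c -> c <= tau - 8 ->
    (sq (n * i, n * j) (rect_ctr (n * i, n * j) y c) B `<=` D)%fset ->
    hard_cross (n * i, n * j) (rect_ctr (n * i, n * j) y c)
      (sq (n * i, n * j) (rect_ctr (n * i, n * j) y c) B) eta].
Proof.
have n0 := unit_gt0 t8 hn; have zz := vsubxx_lt n0 z.
have hs := marks_jump n0 zz zp; have hl := marks_last n0 p zz.
have [i [j [hi hj ha hrw hru]]] := straight_dir t8 ht hn hs hM hl hz.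
exists i, j; split=> //; set a : site := (n * i, n * j) in ha hrw hru *; set W := nrm2 a in ha hrw hru *.
have N1 : nrm1 a <= 18 * t * n.
  rewrite /nrm1 /a /= !normrM (gtr0_norm n0) -mulrDr mulrC ler_pM2r //.
  by move: hi hj; clear; lia.
have hN := ltW (small_slack t8 n0 ha N1).
have W0 : 0 < W.
  by apply: lt_le_trans ha; rewrite exprn_gt0 // !mulr_gt0 //; clear -t8; lia.
have sW : nrm1 a <= W.
  have : nrm1 a * 1 <= nrm1 a * n by apply: ler_wpM2l; [rewrite /nrm1 addr_ge0|clear -n0; lia].
  by have : 0 <= nrm1 a; [rewrite /nrm1 addr_ge0|move: hN; clear; lia].
have bru v w : `|v.1 - w.1| <= n -> `|v.2 - w.2| <= n -> 10 * `|ru a w v| <= W.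
  by move=> h1 h2; rewrite ru_dot; apply: le_trans hN; rewrite ler_pM2l //; apply: dot_norm1.
have brw v w : `|v.1 - w.1| <= n -> `|v.2 - w.2| <= n -> 10 * `|rw a w v| <= W.
  move=> h1 h2; rewrite rw_dot; apply: le_trans hN; rewrite ler_pM2l // -nrm1_rot; exact: dot_norm1.
have ruD x v w : ru a x w = ru a x v + ru a v w by rewrite /ru; ring.
have rwD x v w : rw a x w = rw a x v + rw a v w by rewrite /rw; ring.
have tube v : v \in z :: p -> `|rw a y v| <= W.
  move=> /(marks_near n0 zz)[x xs hx]; have [c1 c2] := coord_le (ltW n0) (ltW hx).
  have := hrw x xs; have := brw _ _ c1 c2; have := brw _ _ y1 y2.
  by rewrite (rwD y z v) (rwD z x v); clear -W0; lia.
have rz : ru a y z <= W by have := bru _ _ y1 y2; clear -W0; lia.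
have rl : (tau - 2) * W <= ru a y (last z p).
  have [c1 c2] := coord_le (ltW n0) (ltW hl).
  have := bru _ _ c1 c2; have := bru _ _ y1 y2; move: hru.
  by rewrite (ruD y z (last z p)) (ruD z (last z (marks n z p)) (last z p)) !mulrBl; clear -W0; lia.
move=> c c6 ct sD; set x := rect_ctr a y c.
have s0 : 0 <= nrm1 a by rewrite /nrm1 addr_ge0.
have cW : 6 * W <= c * W by rewrite ler_pM2r.
have cW' : c * W <= (tau - 8) * W by rewrite ler_pM2r.
have [|||y' [q [yq sub h1 h2 h3]]] := path_window (f := ru a x) (lo := - (4 * W)) (hi := 4 * W) s0
  (fun u v => @ru_step a x u v) zp.
- by rewrite ru_rect -/W; move: rz cW; clear -W0; lia.
- by clear -W0; lia.
- by rewrite ru_rect -/W; move: rl cW'; rewrite !mulrBl; clear -W0; lia.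
exists y', q; split=> // v vq; split.
- by apply: diff_mono sD _; apply: hC; exact: sub.
- by rewrite rw_rect -/W; have := tube v (sub v vq); clear; lia.
- by have := h3 v vq; move: sW; rewrite -/W; clear; lia.
Qed.

End StraightCross.

Lemma path_exit (N : int) z u q : 0 < N -> path nb u q -> nrm2 (vsub u z) < N ^+ 2 ->
  N ^+ 2 <= nrm2 (vsub (last u q) z) ->
  exists q', [/\ path nb u q', (size q' <= size q)%N, {subset q' <= q},
    N ^+ 2 <= nrm2 (vsub (last u q') z) &
    forall w, w \in u :: q' -> nrm2 (vsub w z) <= (N + 1) ^+ 2].
Proof.
move=> N0; elim: q u => [|v q IH] u /=; first by move=> _ h; rewrite leNgt h.
move=> /andP[uv vq] hu hl; have hv := nrm2_nb N0 uv hu.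
have hu' : nrm2 (vsub u z) <= (N + 1) ^+ 2.
  by apply: le_trans (ltW hu) _; rewrite ler_sqr ?nnegrE; clear -N0; lia.
have [h|h] := leP (N ^+ 2) (nrm2 (vsub v z)).
  exists [:: v]; split=> //=; first by rewrite uv.
    by move=> w; rewrite !inE => ->.
  by move=> w; rewrite !inE => /orP[] /eqP->.
have [q' [h1 h2 h3 h4 h5]] := IH v vq h hl; exists (v :: q'); split=> //=.
- by rewrite uv.
- by move=> w; rewrite !inE => /orP[->//|/h3->]; rewrite orbT.
- by move=> w; rewrite inE => /orP[/eqP->|/h5].
Qed.

Definition cells (y : site) (n : int) (r : nat) : seq site :=
  [seq (y.1 + n * c.1, y.2 + n * c.2) | c <- box r].

Lemma size_cells y n r : size (cells y n r) = ((r.*2.+1) ^ 2)%N.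
Proof. by rewrite size_map size_allpairs size_iota mulnn. Qed.

Lemma cells_bound y n r x : 0 < n -> x \in cells y n r ->
  `|x.1 - y.1| <= r%:Z * n /\ `|x.2 - y.2| <= r%:Z * n.
Proof.
move=> n0 /mapP[[i j]]; rewrite mem_box /= => /andP[hi hj] -> /=.
by rewrite !(addrC y.1) !(addrC y.2) !addrK !normrM (gtr0_norm n0) !(mulrC n) !ler_pM2r.
Qed.

Lemma cell_coord (n d : int) (r : nat) : 0 < n -> `|d| <= r%:Z * n ->
  exists2 i : int, `|i| <= r%:Z & `|d - n * i| <= n.
Proof.
move=> n0 hd; have [i h1 h2] := floor_cell d n0.
exists i; last by move: h1 h2; rewrite mulrDl mul1r (mulrC n); clear; lia.
have a1 : i * n <= r%:Z * n by apply: le_trans h1 _; exact: le_trans (ler_norm _) hd.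
have a2 : - r%:Z * n < (i + 1) * n.
  by apply: le_lt_trans h2; rewrite mulNr lerNl; apply: le_trans hd; rewrite -normrN ler_norm.
rewrite ler_pM2r // in a1; rewrite ltr_pM2r // in a2.
by move: a1 a2; clear; lia.
Qed.

Lemma cells_cover y n r x : 0 < n -> `|x.1 - y.1| <= r%:Z * n -> `|x.2 - y.2| <= r%:Z * n ->
  exists2 y', y' \in cells y n r & (`|x.1 - y'.1| <= n) /\ (`|x.2 - y'.2| <= n).
Proof.
move=> n0 h1 h2; have [i i1 i2] := cell_coord n0 h1; have [j j1 j2] := cell_coord n0 h2.
exists (y.1 + n * i, y.2 + n * j).
  by apply/mapP; exists (i, j); rewrite ?mem_box ?i1 ?j1.
by rewrite /= !opprD !addrA.
Qed.

Lemma count_le1 (T : eqType) (P : pred T) (s : seq T) : uniq s ->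
  (forall x y, x \in s -> y \in s -> P x -> P y -> x = y) -> (count P s <= 1)%N.
Proof.
elim: s => //= x s IH /andP[xs us] h.
have [Px|Px] := boolP (P x); last first.
  by rewrite add0n; apply: IH => // y z ys zs; apply: h; rewrite inE ?ys ?zs orbT.
rewrite -[X in (X <= _)%N]addn0; suff -> : count P s = 0%N by [].
apply/eqP; rewrite -leqn0 leqNgt -has_count; apply/hasPn => y ys; apply/negP => Py.
have /(h x y (mem_head _ _)) : y \in x :: s by rewrite inE ys orbT.
by move=> /(_ Px Py) e; move: xs; rewrite e ys.
Qed.

Lemma nrm2_le_nrm1 (a : site) : nrm2 a <= nrm1 a ^+ 2.
Proof.
have e (i : int) : i * i = `|i| ^+ 2 by rewrite real_normK ?num_real // expr2.
by rewrite /nrm2 (e a.1) (e a.2) /nrm1 sqrrD -addrA lerD2l lerDr mulrn_wge0 // mulr_ge0.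
Qed.

(** * Short crossings are unlikely *)

Section Params.
Variables (B K : nat).
(** Room for [K] rectangles at spacing [4 * B + 1], from position 6 up to at most [par_tau - 8]. *)
Definition par_tau : nat := ((4 * B + 1) * K + 20)%N.
Definition par_t : nat := (8 * par_tau)%N.
Definition par_b : nat := (par_t ^ 2)%N.
(** The prefactor guarantees [2 * t ^ 2 <= n] at every scale, including the smallest. *)
Definition scale (j : nat) : nat := (2 * par_b * par_b ^ j)%N.

Lemma par_t_ge : (160 <= par_t)%N.
Proof. by rewrite /par_t /par_tau; lia. Qed.

Lemma par_b_ge : (160 * par_t <= par_b)%N.
Proof. by rewrite /par_b -mulnn leq_mul2r par_t_ge orbT. Qed.

Lemma par_bZ : par_b%:Z = par_t%:Z ^+ 2.
Proof. by rewrite /par_b -mulnn PoszM expr2. Qed.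

Lemma scaleS j : scale j.+1 = (par_b * scale j)%N.
Proof. by rewrite /scale expnS; nia. Qed.

Lemma scale_ge j : (2 * par_b <= scale j)%N.
Proof.
rewrite /scale leq_pmulr // expn_gt0; apply/orP; left.
by have := par_b_ge; have := par_t_ge; lia.
Qed.

Lemma scale_gt0 j : (0 < scale j)%N.
Proof. by apply: leq_trans (scale_ge j); have := par_b_ge; have := par_t_ge; lia. Qed.

End Params.

Section Short.
Variables (R : realType) (B K : nat).
Local Notation t := (par_t B K).
Local Notation b := (par_b B K).
Local Notation n_ := (scale B K).

(* A path of diameter [scale j] has at least [b - 1] pieces of diameter [scale j.-1], and at least
   [b + 4] unless it is straight; [k] is the number of scales at which straightness is allowed. *)
Definition short (y : site) (j k : nat) : set (fld R) := [set eta | exists z q,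
  [/\ path nb z q, forall v, v \in z :: q -> diff (boxf y (5 * n_ j)) eta eta v,
     `|z.1 - y.1| <= (n_ j)%:Z /\ `|z.2 - y.2| <= (n_ j)%:Z,
     (n_ j)%:Z ^+ 2 <= nrm2 (vsub (last z q) z) &
     (size q * (b + 4) ^ k < (b - 1) ^ k * (b + 4) ^ j)%N]].

Definition rpos (k : nat) : int := (6 + k * (4 * B + 1))%N%:Z.

Definition dirs (j : nat) : seq site :=
  [seq a <- [seq ((n_ j)%:Z * c.1, (n_ j)%:Z * c.2) | c <- box (9 * t)] |
    (7 * t%:Z * (n_ j)%:Z) ^+ 2 <= nrm2 a].

(** Discards the rectangles whose domain might meet the box of [short] around [y']; this makes
    [straight] independent of the shorter path inside that box. *)
Definition far_rects (y' : site) (j : nat) (a y0 : site) : seq nat :=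
  [seq k <- iota 0 K |
    (2 * B%:Z) * nrm2 a + 5 * (n_ j)%:Z * nrm1 a < `|ru a (rect_ctr a y0 (rpos k)) y'|].

Definition crossed (a y0 : site) (k : nat) : set (fld R) :=
  [set eta | hard_cross a (rect_ctr a y0 (rpos k)) (sq a (rect_ctr a y0 (rpos k)) (2 * B%:Z)) eta].

Definition straight (y y' : site) (j : nat) : set (fld R) :=
  [set eta | exists2 ya, ya \in [seq (y0, a) | y0 <- cells y (n_ j)%:Z (2 * b + 1), a <- dirs j] &
    [set eta | forall k, k \in far_rects y' j ya.2 ya.1 -> crossed ya.2 ya.1 k eta] eta].

Lemma dirsP j a : a \in dirs j -> exists i i' : int,
  [/\ a = ((n_ j)%:Z * i, (n_ j)%:Z * i'), `|i| <= 9 * t%:Z, `|i'| <= 9 * t%:Z &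
     (7 * t%:Z * (n_ j)%:Z) ^+ 2 <= nrm2 a].
Proof.
rewrite mem_filter => /andP[h /mapP[[i i']]]; rewrite mem_box PoszM /= => /andP[hi hi'] e.
by exists i, i'.
Qed.

Lemma nrm1_dirs j a : a \in dirs j -> nrm1 a <= 18 * t%:Z * (n_ j)%:Z.
Proof.
move=> /dirsP[i [i' [-> hi hi' _]]]; have n0 : 0 < (n_ j)%:Z by rewrite ltz_nat scale_gt0.
rewrite /nrm1 /= !normrM (gtr0_norm n0) -mulrDr mulrC ler_pM2r //.
by move: hi hi'; clear; lia.
Qed.

Lemma par_t8 : 8 <= t%:Z. Proof. by have := par_t_ge B K; lia. Qed.

Lemma nrm1_dirs_ge j a : a \in dirs j -> 2 <= nrm1 a.
Proof.
move=> /dirsP[i [i' [_ _ _ h]]]; rewrite leNgt; apply/negP => h1.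
have n1 : 0 <= nrm1 a by rewrite /nrm1 addr_ge0.
have : nrm1 a ^+ 2 <= 1 ^+ 2 by rewrite ler_sqr ?nnegrE //; move: h1; clear; lia.
have := nrm2_le_nrm1 a; have n0 : 1 <= (n_ j)%:Z by rewrite lez_nat scale_gt0.
have : 2 ^+ 2 <= (7 * t%:Z * (n_ j)%:Z) ^+ 2.
  have t8' := par_t8; have x : 56 * 1 <= 7 * t%:Z * (n_ j)%:Z.
    by apply: ler_pM => //; move: t8'; clear; lia.
  by rewrite ler_sqr ?nnegrE //; move: x; clear; lia.
by move: h; rewrite expr1n; clear; lia.
Qed.

Lemma dirs_slack j a : a \in dirs j -> 10 * (nrm1 a * (n_ j)%:Z) < nrm2 a.
Proof.
move=> ha; have [_ [_ [_ _ _ h]]] := dirsP ha; have n0 : 0 < (n_ j)%:Z by rewrite ltz_nat scale_gt0.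
exact: small_slack par_t8 n0 h (nrm1_dirs ha).
Qed.

Lemma dirs_neq0 j a : a \in dirs j -> a != (0, 0).
Proof. by move=> /nrm1_dirs_ge h; apply: contraTneq h => ->. Qed.

Lemma sq_ru_disj (a x x' y : site) (r s : int) : a != (0, 0) -> (r + s) * nrm2 a < `|ru a x x'| ->
  [disjoint sq a x r & sq a x' s].
Proof.
move=> a0 h; apply/fdisjointP => v; rewrite !mem_sq // => /andP[h1 _]; apply/negP => /andP[h2 _].
have e : ru a x x' = ru a x v - ru a x' v by rewrite /ru; ring.
by move: h h1 h2; rewrite e mulrDl; clear; lia.
Qed.

(** At most one rectangle is discarded: the spacing [(4 * B + 1) * nrm2 a] exceeds twice the
    exclusion radius, since [10 * (nrm1 a * n) < nrm2 a] by [dirs_slack]. *)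
Lemma size_far_rects y' j a y0 : a \in dirs j -> (K <= (size (far_rects y' j a y0)).+1)%N.
Proof.
move=> ha; rewrite size_filter; set P := (fun k => _).
rewrite -[X in (X <= _)%N](size_iota 0 K) -(count_predC P (iota 0 K)) -addn1 leq_add2l.
apply: count_le1; first exact: iota_uniq.
have W0 := nrm2_gt0 (dirs_neq0 ha); have hs := dirs_slack ha.
move=> k k' _ _; rewrite /= /P -!leNgt !ru_rect /rpos => h h'.
apply/eqP; apply: contraTT isT => kk.
have d : (4 * B%:Z + 1) <= `|(6 + k * (4 * B + 1))%N%:Z - (6 + k' * (4 * B + 1))%N%:Z|.
  rewrite !PoszD !PoszM; have -> : 6%:Z + k%:Z * (4%:Z * B%:Z + 1%:Z) - (6%:Z + k'%:Z * (4%:Z * B%:Z + 1%:Z)) =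
    (k%:Z - k'%:Z) * (4 * B%:Z + 1) by ring.
  have c0 : 0 <= 4 * B%:Z + 1 by rewrite addr_ge0 ?mulr_ge0.
  rewrite normrM (ger0_norm c0) ler_peMl //.
  by move: kk; clear; lia.
have : (4 * B%:Z + 1) * nrm2 a <= `|(6 + k * (4 * B + 1))%N%:Z * nrm2 a - (6 + k' * (4 * B + 1))%N%:Z * nrm2 a|.
  by rewrite -mulrBl normrM (gtr0_norm W0) ler_pM2r.
have e1 : (4 * B%:Z + 1) * nrm2 a = 2 * (2 * B%:Z * nrm2 a) + nrm2 a by ring.
have e2 : 5 * (n_ j)%:Z * nrm1 a = 5 * (nrm1 a * (n_ j)%:Z) by ring.
by rewrite e1; move: h h' hs; rewrite e2; clear; lia.
Qed.

Lemma crossed_disj y' j a y0 k : a \in dirs j -> k \in far_rects y' j a y0 ->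
  [disjoint sq a (rect_ctr a y0 (rpos k)) (2 * B%:Z) & boxf y' (5 * n_ j)].
Proof.
move=> ha; rewrite mem_filter => /andP[h _]; have a0 := dirs_neq0 ha.
apply/fdisjointP => v; rewrite mem_sq // => /andP[h1 _]; apply/negP; rewrite mem_boxf => /andP[v1 v2].
have : `|ru a y' v| <= nrm1 a * (5 * n_ j)%N%:Z by rewrite ru_dot; exact: dot_norm1.
have e : ru a (rect_ctr a y0 (rpos k)) y' = ru a (rect_ctr a y0 (rpos k)) v - ru a y' v by rewrite /ru; ring.
rewrite e in h; rewrite PoszM; have e2 : 5 * (n_ j)%:Z * nrm1 a = nrm1 a * (5%:Z * (n_ j)%:Z) by ring.
by rewrite e2 in h; move: h h1; clear; lia.
Qed.

Lemma ms_crossed y0 a k : ms [set v | v \in sq a (rect_ctr a y0 (rpos k)) (2 * B%:Z)] (crossed a y0 k).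
Proof. exact: ms_hard_cross. Qed.

Lemma ms_straight y y' j : ms [set v | v \notin boxf y' (5 * n_ j)] (straight y y' j).
Proof.
apply: ms_exists => -[y0 a] /allpairsP[[y1 a1] /= [_ ha [-> ->]]].
apply: ms_forall => k hk; apply: (ms_sub _ (@ms_crossed y1 a1 k)) => v /=.
by have /fdisjointP := crossed_disj ha hk; apply.
Qed.

Lemma ms_short y j k : ms [set v | v \in boxf y (5 * n_ j)] (short y j k).
Proof.
have m : mfield [set v | v \in boxf y (5 * n_ j)] (boxf y (5 * n_ j)) (id : fld R -> fld R) by exact: mfield_id.
exact: (@ms_diff R _ _ id id (fun d => exists z q,
  [/\ path nb z q, forall v, v \in z :: q -> d v,
     `|z.1 - y.1| <= (n_ j)%:Z /\ `|z.2 - y.2| <= (n_ j)%:Z,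
     (n_ j)%:Z ^+ 2 <= nrm2 (vsub (last z q) z) &
     (size q * (b + 4) ^ k < (b - 1) ^ k * (b + 4) ^ j)%N]) m m).
Qed.

Lemma short0 y k : short y 0 k = set0.
Proof.
apply/seteqP; split=> eta // -[z [q [_ _ _ h]]]; rewrite expn0 muln1.
case: q h => [|v q]; last first.
  by move=> _; apply/negP; rewrite -leqNgt; apply: leq_trans (leq_pmull _ _) => //; case: k => // k; rewrite leq_exp2r //; clear; lia.
rewrite /= vsubxx leNgt exprn_gt0 //; by rewrite ltz_nat scale_gt0.
Qed.

End Short.

Lemma boxf_sub (y y' : site) (r s : nat) : `|y'.1 - y.1| + r%:Z <= s%:Z ->
  `|y'.2 - y.2| + r%:Z <= s%:Z -> boxf y' r `<=` boxf y s.
Proof.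
move=> h1 h2; apply/fsubsetP => v; rewrite !mem_boxf => /andP[v1 v2].
have e (i i' k : int) : `|i' - i| + r%:Z <= s%:Z -> `|k - i'| <= r%:Z -> `|k - i| <= s%:Z.
  by clear; lia.
by rewrite (e _ _ _ h1 v1) (e _ _ _ h2 v2).
Qed.

Lemma box_arith (x w u X n : int) : 8 * `|x| <= 9 * X -> 8 * `|w| <= 9 * X -> `|u| <= 2 * X + n ->
  2 * n <= X -> `|x + w + u| <= 5 * X.
Proof. lia. Qed.

Lemma near_arith (i i' k X n : int) : 0 < n -> `|i - i'| <= X + 1 -> `|i' - k| <= X ->
  `|i - k| <= 2 * X + n.
Proof. lia. Qed.

Lemma sub_arith (d b n : int) : 160 <= b -> 0 < n -> d <= 2 * (b * n) + n -> d + 5 * n <= 5 * (b * n).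
Proof. by move=> hb n0 hd; have : 160 * n <= b * n; [rewrite ler_pM2r|lia]. Qed.

Section Step.
Variables (R : realType) (B K : nat).
Hypothesis (B0 : (0 < B)%N) (K0 : (0 < K)%N).
Local Notation t := (par_t B K).
Local Notation b := (par_b B K).
Local Notation n_ := (scale B K).

Lemma rect_in_box (y y0 : site) j a k : y0 \in cells y (n_ j)%:Z (2 * b + 1) -> a \in dirs B K j ->
  (k < K)%N -> sq a (rect_ctr a y0 (rpos B k)) (2 * B%:Z) `<=` boxf y (5 * n_ j.+1).
Proof.
move=> hy0 ha kK; have a0 := dirs_neq0 ha; have n0 : 0 < (n_ j)%:Z by rewrite ltz_nat scale_gt0.
have [c1 c2] := cells_bound n0 hy0.
have [i [i' [ea hi hi' _]]] := dirsP ha; have N1 := nrm1_dirs ha.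
have t8' : 0 < t%:Z by have := par_t8 B K; clear; lia.
have a1 : `|a.1| <= 9 * t%:Z * (n_ j)%:Z.
  by rewrite ea /= normrM (gtr0_norm n0) mulrC ler_pM2r.
have a2 : `|a.2| <= 9 * t%:Z * (n_ j)%:Z.
  by rewrite ea /= normrM (gtr0_norm n0) mulrC ler_pM2r.
have rp : 0 <= rpos B k by [].
have rp2 : 8 * (rpos B k + 2) <= t%:Z.
  by rewrite /rpos /par_t /par_tau; move: kK; clear; nia.
have tB : 32 * B%:Z <= t%:Z by rewrite /par_t /par_tau; move: K0; clear; nia.
have bT := par_bZ B K.
apply/fsubsetP => v; rewrite mem_sq // => /(insq_bound a0)/andP[v1 v2]; rewrite mem_boxf scaleS !PoszM.
set n := (n_ j)%:Z in n0 c1 c2 a1 a2 N1 *; set T := t%:Z in t8' a1 a2 N1 rp2 tB bT *.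
have Tb : 160 * T <= b%:Z by rewrite /T -PoszM lez_nat par_b_ge.
have NB : 8 * (2 * B%:Z * nrm1 a) <= 9 * (b%:Z * n).
  apply: (@le_trans _ _ (8 * (2 * B%:Z * (18 * T * n)))); first by rewrite ler_pM2l //; apply: ler_wpM2l.
  have -> : 8 * (2 * B%:Z * (18 * T * n)) = 9 * ((32 * B%:Z) * T * n) by ring.
  by rewrite ler_pM2l // ler_pM2r // bT expr2 ler_pM2r.
have key (x y1 : int) : `|x| <= 9 * T * n -> `|y1| <= 9 * T * n ->
    8 * `|rpos B k * x + 2 * y1| <= 9 * (b%:Z * n).
  move=> hx hy; apply: (@le_trans _ _ (8 * ((rpos B k + 2) * (9 * T * n)))).
    rewrite ler_pM2l //; apply: le_trans (ler_normD _ _) _; rewrite !normrM (ger0_norm rp) mulrDl.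
    by apply: lerD; apply: ler_wpM2l.
  have -> : 8 * ((rpos B k + 2) * (9 * T * n)) = 9 * (8 * (rpos B k + 2) * T * n) by ring.
  by rewrite ler_pM2l // ler_pM2r // bT expr2 ler_pM2r.
have fin (x y1 y2 w u : int) : 8 * `|x| <= 9 * (b%:Z * n) -> 8 * `|w| <= 9 * (b%:Z * n) ->
    `|u| <= (2 * b + 1)%N%:Z * n -> x + w + u = y1 - y2 -> `|y1 - y2| <= 5%:Z * (b%:Z * n).
  move=> h1 h2 h3 <-; rewrite PoszD PoszM mulrDl mul1r -mulrA in h3.
  apply: box_arith h1 h2 h3 _; rewrite ler_pM2r //.
  by apply: le_trans Tb; clear -t8'; lia.
have up (x : int) : `|x| <= 2 * B%:Z * nrm1 a -> 8 * `|x| <= 9 * (b%:Z * n).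
  by move=> h; apply: le_trans NB; rewrite ler_pM2l.
have v1' := up _ v1; have v2' := up _ v2.
have N2 : `|- a.1| <= 9 * T * n by rewrite normrN.
apply/andP; split.
- apply: (@fin (v.1 - (rect_ctr a y0 (rpos B k)).1) v.1 y.1 (rpos B k * a.1 + 2 * a.2) (y0.1 - y.1)) => //.
    exact: key a.1 a.2 a1 a2.
  by rewrite /rect_ctr /=; ring.
- apply: (@fin (v.2 - (rect_ctr a y0 (rpos B k)).2) v.2 y.2 (rpos B k * a.2 + 2 * - a.1) (y0.2 - y.2)) => //.
    exact: key a.2 (- a.1) a2 N2.
  by rewrite /rect_ctr /=; ring.
Qed.

Lemma short_step y j k (eta : fld R) : short B K y j.+1 k.+1 eta -> exists2 y',
  y' \in cells y (n_ j)%:Z (2 * b + 1) &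
  short B K y' j k.+1 eta \/ (short B K y' j k eta /\ straight B K y y' j eta).
Proof.
case=> z [q0 [zq0 hC0 [z1 z2] hl0 hs0]].
have n0 : 0 < (n_ j)%:Z by rewrite ltz_nat scale_gt0.
have N0 : 0 < (n_ j.+1)%:Z by rewrite ltz_nat scale_gt0.
have bT := par_bZ B K; have t8' := par_t8 B K.
have b160 : (160 <= b)%N by have := par_b_ge B K; have := par_t_ge B K; clear; lia.
have NE : (n_ j.+1)%:Z = t%:Z ^+ 2 * (n_ j)%:Z by rewrite scaleS PoszM bT.
have hn : 2 * t%:Z ^+ 2 <= (n_ j)%:Z by rewrite -bT -PoszM lez_nat scale_ge.
have eN : (2 * b + 1)%N%:Z * (n_ j)%:Z = 2 * (n_ j.+1)%:Z + (n_ j)%:Z.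
  by rewrite -PoszM (_ : (2 * b + 1) * n_ j = 2 * n_ j.+1 + n_ j)%N ?PoszD ?PoszM // scaleS; ring.
have [q [zq sq0 sub hl hb]] := path_exit N0 zq0 (vsubxx_lt N0 z) hl0.
have hC v : v \in z :: q -> diff (boxf y (5 * n_ j.+1)) eta eta v.
  by rewrite inE => /orP[/eqP->|/sub vq]; apply: hC0; rewrite inE ?eqxx // vq orbT.
have hs : (size q * (b + 4) ^ k.+1 < (b - 1) ^ k.+1 * (b + 4) ^ j.+1)%N.
  by apply: leq_ltn_trans hs0; rewrite leq_mul2r sq0 orbT.
have near v : v \in z :: q -> `|v.1 - y.1| <= (2 * b + 1)%N%:Z * (n_ j)%:Z /\
    `|v.2 - y.2| <= (2 * b + 1)%N%:Z * (n_ j)%:Z.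
  move=> /hb; have N1 : 0 <= (n_ j.+1)%:Z + 1 by clear -N0; lia.
  move=> /(coord_le N1)[v1 v2].
  have e (i i' k' : int) : `|i - i'| <= (n_ j.+1)%:Z + 1 -> `|i' - k'| <= (n_ j.+1)%:Z ->
      `|i - k'| <= (2 * b + 1)%N%:Z * (n_ j)%:Z.
    by rewrite eN; exact: near_arith.
  by split; [exact: e v1 z1|exact: e v2 z2].
have zz := vsubxx_lt n0 z; set s := marks (n_ j)%:Z z q.
have hj := marks_jump n0 zz zq; have hlm := marks_last n0 q zz; rewrite -/s in hj hlm.
have hz : (t%:Z ^+ 2 * (n_ j)%:Z) ^+ 2 <= nrm2 (vsub (last z q) z) by rewrite -NE.
have hM1 := size_marks_ge t8' hn hj hlm hz; rewrite -bT in hM1.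
have sb : (b - 1 <= size s)%N by move: hM1 b160; clear; lia.
have piece z' q' k' : z' \in z :: s -> path nb z' q' ->
    (forall w, w \in z' :: q' -> diff (boxf y (5 * n_ j.+1)) eta eta w) ->
    (n_ j)%:Z ^+ 2 <= nrm2 (vsub (last z' q') z') ->
    (size q' * (b + 4) ^ k' < (b - 1) ^ k' * (b + 4) ^ j)%N ->
    exists2 y', y' \in cells y (n_ j)%:Z (2 * b + 1) & short B K y' j k' eta.
  move=> zs' zq' hC' hl' hs'.
  have zq1 : z' \in z :: q.
    by move: zs'; rewrite !inE => /orP[->//|/marks_sub->]; rewrite orbT.
  have [c1 c2] := near _ zq1; have [y' hy' near'] := cells_cover n0 c1 c2.
  exists y' => //; exists z', q'; split=> // v /hC'; apply: diff_mono.
  have [d1 d2] := cells_bound n0 hy'.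
  have e (i i' : int) : `|i - i'| <= (2 * b + 1)%N%:Z * (n_ j)%:Z ->
      `|i - i'| + (5 * n_ j)%N%:Z <= (5 * n_ j.+1)%N%:Z.
    by rewrite eN scaleS !PoszM; apply: sub_arith.
  by apply: boxf_sub; exact: e.
(* With at most [b + 3] pieces the path is straight; there are still at least [b - 1], so one is
   short with the allowance lowered to [k]. With at least [b + 4] pieces, one is short with the
   allowance [k + 1] kept. *)
have [str|wig] := leqP (size s) (b + 3).
- have [[z' [q' [p1 p2 p3 p4 p5]]]|] :=
    @marks_piece (n_ j)%:Z _ ((b + 4) ^ k) ((b - 1) ^ k * (b + 4) ^ j) z [::] q zq hC.
    have [y' hy' hsh] := piece z' q' k p1 p2 p3 p4 p5; exists y' => //; right; split=> //.
    have [c1 c2] := near z (mem_head _ _); have [y0 hy0 [e1 e2]] := cells_cover n0 c1 c2.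
    have ht : t%:Z = 8 * (par_tau B K)%:Z by rewrite /par_t PoszM.
    have hM : (size s)%:Z <= t%:Z ^+ 2 + 3 by rewrite -bT; move: str; clear; lia.
    have [i [i' [hi hi' ha hx]]] := @straight_cross R (boxf y (5 * n_ j.+1)) eta t%:Z (n_ j)%:Z
      (par_tau B K)%:Z z q y0 (2 * B%:Z) t8' ht hn zq hC hM hz e1 e2.
    set a : site := ((n_ j)%:Z * i, (n_ j)%:Z * i') in ha hx.
    have had : a \in dirs B K j.
      by rewrite mem_filter ha andTb; apply/mapP; exists (i, i') => //; rewrite mem_box PoszM /= hi hi'.
    exists (y0, a); first by apply/allpairsP; exists (y0, a).
    move=> kk; rewrite mem_filter mem_iota => /and3P[_ _]; rewrite add0n => kK.
    apply: hx.
    + by rewrite /rpos; clear; lia.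
    + by rewrite /rpos /par_tau; move: kK; clear; nia.
    + exact: rect_in_box.
  rewrite add0n -/s => hle; exfalso.
  have : ((b - 1) ^ k * (b + 4) ^ j * (b - 1) * (b + 4) <= (b + 4) ^ k * size q * (b + 4))%N.
    by rewrite leq_mul2r; apply/orP; right; apply: leq_trans hle; rewrite leq_mul2l sb orbT.
  have -> : ((b - 1) ^ k * (b + 4) ^ j * (b - 1) * (b + 4) = (b - 1) ^ k.+1 * (b + 4) ^ j.+1)%N.
    by rewrite !expnS; ring.
  have -> : ((b + 4) ^ k * size q * (b + 4) = size q * (b + 4) ^ k.+1)%N by rewrite !expnS; ring.
  by rewrite leqNgt hs.
- have [[z' [q' [p1 p2 p3 p4 p5]]]|] :=
    @marks_piece (n_ j)%:Z _ ((b + 4) ^ k.+1) ((b - 1) ^ k.+1 * (b + 4) ^ j) z [::] q zq hC.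
    by have [y' hy' hsh] := piece z' q' k.+1 p1 p2 p3 p4 p5; exists y' => //; left.
  rewrite add0n -/s => hle; exfalso.
  have : ((b - 1) ^ k.+1 * (b + 4) ^ j * (b + 4) <= (b + 4) ^ k.+1 * size q)%N.
    by apply: leq_trans hle; rewrite leq_mul2l; apply/orP; right; move: wig; clear; lia.
  by rewrite -mulnA -expnSr [X in (_ <= X)%N]mulnC leqNgt hs.
Qed.

Variables (eps : R) (p : set (fld R) -> R) (delta : R).
Hypothesis lawp : gauss_law eps p.
Hypotheses (d0 : 0 <= delta) (d1 : delta <= 1).
Hypothesis hdelta : forall a x, 2 <= nrm1 a ->
  p [set eta | hard_cross a x (sq a x (2 * B%:Z)) eta] <= 1 - delta.

Definition ncells : R := (((2 * b + 1).*2.+1) ^ 2)%N%:R.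
(** The number of starting cells and directions, times the probability that the [K - 1] rectangles
    surely kept are all crossed. *)
Definition pstar : R := ncells * ((9 * t).*2.+1 ^ 2)%N%:R * (1 - delta) ^+ K.-1.

Lemma law_straight y y' j : p (straight B K y y' j) <= pstar.
Proof.
set s := [seq (y0, a) | y0 <- cells y (n_ j)%:Z (2 * b + 1), a <- dirs B K j].
pose F (ya : site * site) := [set eta : fld R | forall k, k \in far_rects B K y' j ya.2 ya.1 -> crossed B ya.2 ya.1 k eta].
have mF ya : ms setT (F ya) by apply: ms_forall => k _; exact: msT_sub (@ms_crossed R B ya.1 ya.2 k).
have c0 : 0 <= 1 - delta by rewrite subr_ge0.
have c1 : 1 - delta <= 1 by rewrite lerBlDr lerDl.
apply: (@le_trans _ _ ((1 - delta) ^+ K.-1 * (size s)%:R)).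
  apply: (law_union_le lawp (F := F)) => //.
  - exact: msT_sub (@ms_straight R B K y y' j).
  - move=> -[y0 a] /allpairsP[[y1 a1] /= [_ ha [-> ->]]].
    have a0 := dirs_neq0 ha; have W0 := nrm2_gt0 a0.
    apply: (@le_trans _ _ ((1 - delta) ^+ size (far_rects B K y' j a1 y1))); last first.
      by apply: ler_wiXn2l => //; have := size_far_rects y' y1 ha; clear; lia.
    apply: (@law_indep_all _ _ _ lawp _ _ (fun k => [set v | v \in sq a1 (rect_ctr a1 y1 (rpos B k)) (2 * B%:Z)])).
    + by rewrite filter_uniq // iota_uniq.
    + by move=> k _; exact: ms_crossed.
    + move=> k k' _ _ kk'; apply/seteqP; split=> v // -[/= h1 h2].
      suff /fdisjointP/(_ _ h1) : [disjoint sq a1 (rect_ctr a1 y1 (rpos B k)) (2 * B%:Z) &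
          sq a1 (rect_ctr a1 y1 (rpos B k')) (2 * B%:Z)] by rewrite h2.
      apply: sq_ru_disj => //; rewrite ru_rect.
      have -> : ru a1 y1 (rect_ctr a1 y1 (rpos B k')) = rpos B k' * nrm2 a1.
        by rewrite /ru /uu /rect_ctr /nrm2 /=; ring.
      rewrite -mulrBl normrM (gtr0_norm W0) ltr_pM2r // /rpos !PoszD !PoszM.
      have -> : 6%:Z + k'%:Z * (4%:Z * B%:Z + 1%:Z) - (6%:Z + k%:Z * (4%:Z * B%:Z + 1%:Z)) =
         (k'%:Z - k%:Z) * (4 * B%:Z + 1) by ring.
      have c2 : 0 <= 4 * B%:Z + 1 by rewrite addr_ge0 ?mulr_ge0.
      rewrite normrM (ger0_norm c2); apply: (@lt_le_trans _ _ (4 * B%:Z + 1)).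
        by clear; lia.
      by rewrite ler_peMl //; move: kk'; clear; lia.
    + by move=> k _; apply: hdelta; exact: nrm1_dirs_ge ha.
rewrite mulrC /pstar -natrM; apply: ler_wpM2r; first exact: exprn_ge0.
rewrite ler_nat size_allpairs size_cells leq_mul2l size_filter; apply/orP; right.
by apply: leq_trans (count_size _ _) _; rewrite size_map size_allpairs size_iota mulnn.
Qed.

Lemma ncells_ge1 : 1 <= ncells.
Proof. by rewrite /ncells ler1n expn_gt0. Qed.

Lemma pstar_ge0 : 0 <= pstar.
Proof.
by rewrite /pstar !mulr_ge0 ?exprn_ge0 ?subr_ge0.
Qed.

(** Induction along [short_step]: each scale costs a choice of cell and of one of two alternatives,
    and using up a straight scale brings a factor [pstar] by independence. *)
Lemma law_short y j k : p (short B K y j k) <= (2 * ncells) ^+ j * pstar ^+ k.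
Proof.
have N1 := ncells_ge1; have P0 := pstar_ge0.
have N2 : 1 <= 2 * ncells by lra.
elim: j y k => [|j IH] y k.
  by rewrite short0 (law0 lawp) expr0 mul1r exprn_ge0.
case: k => [|k].
  rewrite expr0 mulr1; apply: (@le_trans _ _ 1); last exact: exprn_ege1.
  by apply: (law_le1 lawp); exact: msT_sub (@ms_short R B K y j.+1 0).
pose F y' := (short B K y' j k.+1 `|` (short B K y' j k `&` straight B K y y' j))%classic : set (fld R).
have mS y' k' : ms setT (@short R B K y' j k') by exact: msT_sub (@ms_short R B K y' j k').
have mT y' : ms setT (@straight R B K y y' j) by exact: msT_sub (@ms_straight R B K y y' j).
have mF y' : ms setT (F y') by apply: msU => //; exact: msI.
apply: (@le_trans _ _ (2 * ((2 * ncells) ^+ j * pstar ^+ k.+1) * (size (cells y (n_ j)%:Z (2 * b + 1)))%:R)).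
  apply: (law_union_le lawp (F := F)) => //.
  - exact: msT_sub (@ms_short R B K y j.+1 k.+1).
  - move=> y' _; apply: le_trans (law_leU lawp _ _) _ => //; first exact: msI.
    rewrite mulr_natl mulr2n; apply: lerD; first exact: IH.
    rewrite (law_indep lawp (S := [set v | v \in boxf y' (5 * n_ j)])
      (S' := [set v | v \notin boxf y' (5 * n_ j)])).
    + rewrite exprSr mulrA; apply: ler_pM; try exact: law_ge0 lawp _; first exact: IH.
      exact: law_straight.
    + by apply/seteqP; split=> v // -[/= ->].
    + exact: ms_short.
    + exact: ms_straight.
  - move=> eta hsh; have [y' hy' h] := short_step hsh.
    by exists y'.
rewrite size_cells -/ncells [X in _ <= X * _]exprSr.
by rewrite [leLHS](_ : _ = (2 * ncells) ^+ j * (2 * ncells) * pstar ^+ k.+1) //; ring.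
Qed.

End Step.

(** * Growth of the disagreement set, and the hybrid argument *)

Local Notation o := ((0, 0) : site).

Section Growth.
Variables (R : realType) (D : {fset site}) (c : R) (eta : site -> R).
Hypothesis c0 : 0 <= c.
Local Notation C := (diff D eta (plus c eta)).

Definition reach (k : nat) (v : site) := exists q,
  [/\ path nb o q, last o q = v, (size q <= k)%N & forall w, w \in o :: q -> C w].

Lemma reach_step k u v : reach k u -> nb u v -> C v -> reach k.+1 v.
Proof.
move=> [q [oq hl sq hC]] uv vC; exists (rcons q v); split.
- by rewrite rcons_path oq hl.
- by rewrite last_rcons.
- by rewrite size_rcons.
- by move=> w; rewrite inE mem_rcons inE orbCA => /orP[/eqP->//|h]; apply: hC; rewrite inE.
Qed.

Lemma reach_mono k k' v : (k <= k')%N -> reach k v -> reach k' v.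
Proof. by move=> kk' [q [h1 h2 h3 h4]]; exists q; split=> //; exact: leq_trans kk'. Qed.

Lemma reach_C k v : reach k v -> C v.
Proof. by move=> [q [_ <- _ h]]; apply: h; exact: mem_last. Qed.

Lemma reach0 k : C o -> reach k o.
Proof. by move=> h; exists [::]; split=> // w; rewrite inE => /eqP->. Qed.

(** Balls of the path metric grow by the factor [1 + c / 8] at each step, so a set with few sites
    cannot hold all the points reached in [T] steps. *)
Lemma ball_growth (A : {fset site}) T : C o -> A `<=` D -> (forall v, reach T v -> v \in A) ->
  (1 + c / 8) ^+ T <= (#|` A|)%:R.
Proof.
move=> Co AD hA; pose U k := [fset v in A | `[< reach k v >]].
have UE k v : (k <= T)%N -> (v \in U k) = `[< reach k v >].
  move=> kT; rewrite inE; apply: andb_idl => /asboolP h; apply: hA; exact: reach_mono h.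
suff H k : (k <= T)%N -> (1 + c / 8) ^+ k <= (#|` U k|)%:R.
  apply: le_trans (H T (leqnn T)) _; rewrite ler_nat; apply: fsubset_leq_card.
  by apply/fsubsetP => v; rewrite inE => /andP[].
elim: k => [_|k IH kT].
  rewrite expr0 ler1n cardfs_gt0; apply/fset0Pn; exists o; rewrite UE //.
  by apply/asboolP; exact: reach0.
have kT' := ltnW kT; have := @growth_step R D c eta (U k) (U k.+1).
have UA j : U j `<=` A by apply/fsubsetP => v; rewrite inE => /andP[].
have h1 : U k `<=` D by exact: fsubset_trans (UA k) AD.
have h2 : U k `<=` U k.+1.
  by apply/fsubsetP => v; rewrite !UE // => /asboolP h; apply/asboolP; exact: reach_mono h.
have h3 v : v \in U k -> C v by rewrite UE // => /asboolP/reach_C.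
have h4 u v : u \in U k -> v \in nbrs u -> C v -> v \in U k.+1.
  by rewrite !UE // => /asboolP ru uv Cv; apply/asboolP; exact: reach_step ru uv Cv.
move=> /(_ h1 h2 h3 h4) h; have {}IH := IH kT'.
have : (1 + c / 8) * (1 + c / 8) ^+ k <= (1 + c / 8) * (#|` U k|)%:R.
  by apply: ler_wpM2l IH; rewrite addr_ge0 // divr_ge0.
by rewrite exprS => /le_trans; apply; move: h; lra.
Qed.

(** A component of the origin confined to [D] would contain all its disagreeing neighbours, and
    [growth_step] with both sets equal to it would make its size zero. *)
Lemma escape : 0 < c -> C o -> exists q, [/\ path nb o q, last o q \notin D & forall w, w \in o :: q -> C w].
Proof.
move=> cp Co; apply: contrapT => H.
pose A := [fset v in D | `[< exists k, reach k v >]].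
have rD k v : reach k v -> v \in D.
  by move=> [q [h1 h2 h3 h4]]; apply: contrapT => /negP vD; apply: H; exists q; split=> //; rewrite h2.
have AE v : (v \in A) = `[< exists k, reach k v >].
  by rewrite inE; apply: andb_idl => /asboolP[k]; exact: rD.
have := @growth_step R D c eta A A.
have h1 : A `<=` D by apply/fsubsetP => v; rewrite inE => /andP[].
have h3 v : v \in A -> C v by rewrite AE => /asboolP[k]; exact: reach_C.
have h4 u v : u \in A -> v \in nbrs u -> C v -> v \in A.
  by rewrite !AE => /asboolP[k ru] uv Cv; apply/asboolP; exists k.+1; exact: reach_step ru uv Cv.
move=> /(_ h1 (fsubset_refl _) h3 h4); rewrite subrr mulr0; apply/negP; rewrite -ltNge.
rewrite mulr_gt0 // ltr0n cardfs_gt0; apply/fset0Pn; exists o; rewrite AE.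
by apply/asboolP; exists 0%N; exact: reach0.
Qed.

End Growth.

Lemma expR_le12 (R : realType) (y : R) : 0 <= y -> y <= 2^-1 -> expR y <= 1 + 2 * y.
Proof.
move=> y0 y1; have h := expR_ge1Dx (- y); have e := expRN y.
have ey := expR_gt0 y; rewrite e in h.
have : (1 + - y) * expR y <= (expR y)^-1 * expR y by rewrite ler_pM2r.
rewrite mulVf ?gt_eqF // => h2.
have h3 : 1 <= (1 + 2 * y) * (1 - y) by nra.
have h4 : (1 - y) * expR y <= (1 - y) * (1 + 2 * y) by rewrite [leRHS]mulrC; exact: le_trans h3.
by rewrite ler_pM2l // in h4; lra.
Qed.

(** * Raising the field annulus by annulus *)

Section Hybrid.
Variables (R : realType) (eps : R).
Hypothesis eps_gt0 : 0 < eps.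
Variable p : set (fld R) -> R.
Hypothesis lawp : gauss_law eps p.

Definition Mplus (D : {fset site}) (f : fld R -> fld R) : set (fld R) :=
  [set eta | o \in ground D (fun v => - f eta v)].
Definition dis (D : {fset site}) : set (fld R) := [set eta | diff D eta eta o].

Lemma ms_Mplus S D f : mfield S D f -> ms S (Mplus D f).
Proof.
move=> mf; have m2 : mfield S D (fun eta v => - f eta v).
  by move=> v vD; apply: measurable_funN; exact: mf.
exact: (mdisc_pred (fun K : {fset site} => o \in K) (mdisc_ground m2)).
Qed.

Lemma ms_dis S D : (forall v, v \in D -> S v) -> ms S (dis D).
Proof. by move=> DS; have m := @mfield_id R S D DS; exact: (ms_diff (fun d => d o) m m). Qed.

(** Here [s] is the annulus being shifted, [s0] the part shifted already, and [D'] the ball inside.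
    The event [dis D'] is unaffected by the shift, so the cost is multiplied by its probability. *)
Lemma shift_step (D D' s0 s : {fset site}) (c a : R) : D' `<=` D ->
  [disjoint s & D'] -> [disjoint s0 & D'] -> 0 < a -> c ^+ 2 / eps ^+ 2 * (#|` s|)%:R <= a ^+ 2 ->
  p (Mplus D (fun eta => shift c s0 (shift c s eta))) - p (Mplus D (shift c s0)) <= p (dis D') * (2 * a).
Proof.
move=> D'D /fdisjointP ds /fdisjointP ds0 a0 ha.
pose F := Mplus D (shift c s0); pose G := dis D'; pose Fs := [set eta : fld R | F (shift c s eta)].
have mF : ms setT F by apply: ms_Mplus; exact: mfield_shift.
have mG : ms setT G by exact: ms_dis.
have mFs : ms setT Fs by exact: ms_shift.
have G0 := law_ge0 lawp G.
rewrite -[Mplus D (fun eta => _)]/Fs -/F -/G.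
have split H : ms setT H -> p H = p (G `&` H)%classic + p (H `\` G)%classic.
  move=> mH; rewrite -(lawU lawp); first last.
  - by apply/seteqP; split=> eta // -[[h1 h2] [h3 h4]].
  - exact: msD.
  - exact: msI.
  congr (p _); apply/seteqP; split=> [eta h|eta [[]|[]]] //.
  by have [g|g] := pselect (G eta); [left|right].
(* Off [G], the origin lies in one of the two ground sets of [D'], hence by monotonicity in the same
   one for [D], whatever the field outside [D']. *)
have eqD : (Fs `\` G = F `\` G)%classic.
  have det eta eta' : (forall v, v \in D' -> eta v = eta' v) -> ~ G eta -> F eta -> F eta'.
    move=> heq nG; rewrite /F /Mplus /=.
    have e1 (zeta : fld R) : forall v, v \in D' -> shift c s0 zeta v = zeta v.
      move=> v vD; rewrite /shift; case: ifP => [vs|]; last by rewrite addr0.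
      by move: (ds0 _ vs); rewrite vD.
    have : ~ (diff D' eta eta o) by exact: nG.
    move=> /negP; rewrite /diff negb_and !negbK => /orP[h1|h2].
      have h : o \in ground D (shift c s0 eta).
        by apply: (fsubsetP (ground_mono _ D'D)); rewrite (ground_local (e1 eta)).
      by have /fdisjointP/(_ _ h) := ground_disj D (shift c s0 eta) => /negbTE->.
    move=> _; apply: (fsubsetP (ground_mono _ D'D)).
    rewrite (@ground_local _ D' _ (fun v => - eta v)) // => v vD.
    by rewrite e1 // heq.
  have loc eta v : v \in D' -> shift c s eta v = eta v.
    move=> vD; rewrite /shift; case: ifP => [vs|]; last by rewrite addr0.
    by move: (ds _ vs); rewrite vD.
  have Gs eta : G (shift c s eta) <-> G eta.
    by rewrite /G /dis /= (diff_local o (loc eta) (loc eta)).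
  apply/seteqP; split=> eta [h nG]; split=> //.
    by apply: (det (shift c s eta)) h => [v /loc//|/Gs].
  by apply: (det eta) h => // v /loc ->.
rewrite (split Fs mFs) (split F mF) eqD.
rewrite (_ : forall x y z : R, x + z - (y + z) = x - y); last by move=> *; ring.
(* For [2^-1 <= a] the bound is at least [p G] and holds trivially; otherwise the exponential can be
   linearized. *)
have [big|small] := leP 2^-1 a.
  apply: (@le_trans _ _ (p G)).
    rewrite lerBlDr; apply: (@le_trans _ _ (p G)); last by rewrite lerDl; exact: law_ge0 lawp _.
    by apply: (law_mono lawp); [exact: msI|exact: mG|move=> eta []].
  by rewrite ler_peMr //; lra.
have us : uniq (enum_fset s) by exact: fset_uniq.
have inv c' eta : G (shift c' s eta) <-> G eta.
  have loc v : v \in D' -> shift c' s eta v = eta v.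
    move=> vD; rewrite /shift; case: ifP => [vs|]; last by rewrite addr0.
    by move: (ds _ vs); rewrite vD.
  by rewrite /G /dis /= (diff_local o loc loc).
apply: le_trans (law_shift2 eps_gt0 lawp c us mF mG a0 inv) _; apply: ler_wpM2l => //.
set x := c ^+ 2 / eps ^+ 2 * _ in ha *.
have x0 : 0 <= x by rewrite /x mulr_ge0 // divr_ge0 // sqr_ge0.
have a2 : a ^+ 2 <= 2^-1.
  by rewrite expr2; apply: (@le_trans _ _ (2^-1 * 2^-1)); [apply: ler_pM => //; exact: ltW|lra].
have hx := expR_le12 x0 (le_trans ha a2).
have h1 : (expR x - 1) / (2 * a) <= a.
  by rewrite ler_pdivrMr ?mulr_gt0 //; move: ha; rewrite expr2; lra.
by move: h1; lra.
Qed.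

(** At equal fields the two ground sets are disjoint, so their probabilities add up exactly; with
    the second field raised, subadditivity goes in the right direction. *)
Lemma dis_shift (D : {fset site}) c : p (dis D) <=
  p [set eta | diff D eta (shift c D eta) o] + (p (Mplus D (shift c D)) - p (Mplus D id)).
Proof.
pose E1 : set (fld R) := [set eta | o \in ground D eta].
have mi : mfield setT D (id : fld R -> fld R) by exact: mfield_id.
have ms' : mfield setT D (shift c D : fld R -> fld R) by exact: mfield_shift.
have m1 : ms setT E1 := mdisc_pred (fun K : {fset site} => o \in K) (mdisc_ground mi).
have m2 := ms_Mplus mi; have m3 := ms_Mplus ms'.
have -> : dis D = (~` (E1 `|` Mplus D id))%classic.
  apply/seteqP; split=> eta.
    by move=> /andP[/negP h1 /negP h2] [].
  by move=> h; apply/andP; split; apply/negP => h'; apply: h; [left|right].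
have -> : [set eta | diff D eta (shift c D eta) o] = (~` (E1 `|` Mplus D (shift c D)))%classic.
  apply/seteqP; split=> eta.
    by move=> /andP[/negP h1 /negP h2] [].
  by move=> h; apply/andP; split; apply/negP => h'; apply: h; [left|right].
rewrite !(lawC lawp); try exact: msU.
rewrite (lawU lawp m1 m2); last first.
  apply/seteqP; split=> eta // -[h1 h2].
  by have /fdisjointP/(_ _ h1) := ground_disj D eta; rewrite -/(Mplus D id eta) h2.
by have := law_leU lawp m1 m3; lra.
Qed.

(** The shift is built from the outermost annulus inwards, so the field in [Dk j] is still the
    original one when the annulus around it is raised. *)
Lemma hybrid (Dk : nat -> {fset site}) (i : nat) (c : R) (a : nat -> R) :
  Dk 0%N = fset0 -> (forall j k, (j <= k)%N -> Dk j `<=` Dk k) -> (forall k, 0 < a k) ->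
  (forall k, c ^+ 2 / eps ^+ 2 * (#|` Dk k.+1|)%:R <= a k ^+ 2) ->
  p (dis (Dk i)) <= p [set eta | diff (Dk i) eta (shift c (Dk i) eta) o] +
    \sum_(k < i) p (dis (Dk k)) * (2 * a k).
Proof.
move=> D0 mono a0 ha; apply: le_trans (dis_shift (Dk i) c) _; rewrite lerD2l.
set D := Dk i.
suff H k : (k <= i)%N -> p (Mplus D (shift c (D `\` Dk (i - k)%N))) - p (Mplus D id) <=
    \sum_((i - k)%N <= j < i) p (dis (Dk j)) * (2 * a j).
  by have := H i (leqnn i); rewrite subnn D0 fsetD0 big_mkord.
elim: k => [_|k IH ki].
  rewrite subn0 big_geq // fsetDv (_ : shift c fset0 = id) ?subrr //.
  by apply/funext => eta; apply/funext => v; rewrite /shift in_fset0 addr0.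
have ik : (i - k.+1 < i)%N by move: ki; clear; lia.
have e : (i - k = (i - k.+1).+1)%N by move: ki; clear; lia.
rewrite big_ltn //; set j := (i - k.+1)%N in ik e *.
have {}IH := IH (ltnW ki).
have jD : Dk j `<=` D by exact/mono/ltnW.
have jD' : Dk j.+1 `<=` D by exact: mono.
have fE : shift c (D `\` Dk j) = (fun eta => shift c (D `\` Dk j.+1) (shift c (Dk j.+1 `\` Dk j) eta)).
  apply/funext => eta; apply/funext => v; rewrite /shift !inE -addrA; congr (_ + _).
  have := fsubsetP jD v; have := fsubsetP jD' v; have := fsubsetP (mono _ _ (leqnSn j)) v.
  case: (v \in Dk j) => [/(_ isT)->|_]; first by rewrite /= addr0.
  case: (v \in Dk j.+1) => [/(_ isT) -> _|_ _]; first by rewrite /= addr0.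
  by rewrite /= add0r.
rewrite e in IH.
have st := @shift_step D (Dk j) (D `\` Dk j.+1) (Dk j.+1 `\` Dk j) c (a j) jD.
rewrite -fE in st.
have d1 : [disjoint Dk j.+1 `\` Dk j & Dk j] by apply/fdisjointP => v; rewrite inE => /andP[].
have d2 : [disjoint D `\` Dk j.+1 & Dk j].
  apply/fdisjointP => v; rewrite inE => /andP[h _]; apply: contra h.
  exact/fsubsetP/mono/leqnSn.
have h3 : c ^+ 2 / eps ^+ 2 * (#|` Dk j.+1 `\` Dk j|)%:R <= a j ^+ 2.
  apply: le_trans (ha j); apply: ler_wpM2l; first by rewrite divr_ge0 // sqr_ge0.
  by rewrite ler_nat fsubset_leq_card // fsubsetDl.
have {}st := st d1 d2 (a0 j) h3.
apply: le_trans (lerD st IH).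
by rewrite [leRHS]addrA subrK.
Qed.

End Hybrid.

(** * Decay along scales *)

Section RealSeq.
Variable R : realType.

Lemma bernoulli (nu : R) k : 0 <= nu -> 1 + k%:R * nu <= (1 + nu) ^+ k.
Proof.
move=> n0; elim: k => [|k IH]; first by rewrite mul0r addr0 expr0.
rewrite exprS; apply: (@le_trans _ _ ((1 + nu) * (1 + k%:R * nu))).
  rewrite -natr1; have : 0 <= k%:R * nu * nu by rewrite !mulr_ge0.
  by lra.
by apply: ler_wpM2l IH; rewrite addr_ge0.
Qed.

Lemma expr_unbounded (lam X : R) : 1 < lam -> exists k, X <= lam ^+ k.
Proof.
move=> l1; have n0 : 0 < lam - 1 by rewrite subr_gt0.
have Y0 : 0 <= Num.max X 0 / (lam - 1) by rewrite divr_ge0 ?le_max ?lexx ?orbT // ltW.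
exists (Num.bound (Num.max X 0 / (lam - 1))); have := archi_boundP Y0.
rewrite ltr_pdivrMr // => /ltW h; have := @bernoulli (lam - 1) (Num.bound (Num.max X 0 / (lam - 1))) (ltW n0).
rewrite (addrC 1 (lam - 1)) subrK => /(le_trans _); apply.
have : X <= Num.max X 0 by rewrite le_max lexx.
by move: h; lra.
Qed.

(** The index must serve all sequences at once. The products [Q] dominate [1 + \sum u]; beyond [i0]
    their factors are at most [lam], whereas the coefficient decays like [lam ^+ (2 * i)]. *)
Lemma seq_uniform (lam C omega : R) : 1 < lam -> 0 <= C -> 0 < omega ->
  exists i, forall u : nat -> R, (forall i, 0 <= u i) ->
    (forall i, u i <= C / lam ^+ (2 * i) * (1 + \sum_(k < i) u k)) -> u i <= omega.
Proof.
move=> l1 C0 w0; have l0 : 0 < lam by apply: lt_trans l1.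
pose Q := fix Q i := if i is j.+1 then Q j * (1 + C / lam ^+ (2 * j)) else 1.
have g0 i : 0 <= C / lam ^+ (2 * i) by rewrite divr_ge0 // exprn_ge0 // ltW.
have Q1 i : 0 < Q i by elim: i => //= i IH; rewrite mulr_gt0 // ltr_wpDr.
have [i0 hi0] := expr_unbounded (C / (lam - 1)) l1.
have gi i : (i0 <= i)%N -> C / lam ^+ (2 * i) <= lam - 1.
  move=> h; rewrite ler_pdivrMr ?exprn_gt0 // mulrC -ler_pdivrMr ?subr_gt0 //.
  apply: le_trans hi0 _; apply: ler_weXn2l; first exact: ltW.
  by move: h; clear; lia.
have Qk k : Q (i0 + k)%N <= Q i0 * lam ^+ k.
  elim: k => [|k IH]; first by rewrite addn0 expr0 mulr1.
  rewrite addnS /= exprSr mulrA; apply: ler_pM => //; first exact: ltW.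
    by rewrite addr_ge0.
  by have := gi (i0 + k)%N (leq_addr _ _); lra.
have [k hk] := expr_unbounded (C * Q i0 / omega) l1.
exists (i0 + k)%N => u u0 hu.
have SQ i : 1 + \sum_(k < i) u k <= Q i.
  elim: i => [|i IH]; first by rewrite big_ord0 addr0.
  rewrite big_ord_recr /=; apply: (@le_trans _ _ ((1 + \sum_(k < i) u k) * (1 + C / lam ^+ (2 * i)))).
    by have := hu i; lra.
  by apply: ler_wpM2r IH; rewrite addr_ge0.
apply: le_trans (hu _) _; apply: (@le_trans _ _ (C / lam ^+ (2 * (i0 + k)) * (Q i0 * lam ^+ k))).
  by apply: ler_wpM2l => //; exact: le_trans (SQ _) (Qk k).
rewrite ler_pdivrMr // in hk.
have E : lam ^+ (2 * (i0 + k)) = lam ^+ (2 * i0 + k) * lam ^+ k by rewrite -exprD; congr (_ ^+ _); lia.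
have lk : 0 < lam ^+ k by rewrite exprn_gt0.
rewrite (_ : _ * _ = C * Q i0 / lam ^+ (2 * i0 + k)); last first.
  by rewrite E; field; rewrite !gt_eqF // exprn_gt0.
rewrite ler_pdivrMr ?exprn_gt0 //; apply: le_trans hk _; rewrite mulrC ler_pM2l //.
by apply: ler_weXn2l; [exact: ltW|exact: leq_addl].
Qed.

Lemma poly_geom (C delta : R) d : 0 <= C -> 0 < delta -> delta <= 1 ->
  exists2 k, (0 < k)%N & C * (2 * k%:R) ^+ d * (1 - delta) ^+ k <= 1.
Proof.
(* The exponential is bounded below by a power of order [d + 1], one more than needed to beat
   [k ^+ d], which leaves [X / k]. *)
move=> C0 d0 d1; pose m : R := d.+1%:R; have m0 : 0 < m by rewrite ltr0n.
pose X := C * 2 ^+ d * (m / delta) ^+ d.+1.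
have X0 : 0 <= X by rewrite !mulr_ge0 ?exprn_ge0 ?divr_ge0 ?(ltW m0) ?(ltW d0).
exists (Num.bound X).+1 => //; set k := (Num.bound X).+1.
have hk : X <= k%:R.
  by apply: le_trans (ltW (archi_boundP X0)) _; rewrite ler_nat leqnSn.
have k0 : 0 < k%:R :> R by rewrite ltr0n.
have y0 : 0 < delta * k%:R / m by rewrite divr_gt0 ?mulr_gt0.
have h1 : (1 - delta) ^+ k <= ((delta * k%:R / m) ^+ d.+1)^-1.
  apply: (@le_trans _ _ (expR (- delta) ^+ k)).
    by apply: lerXn2r; rewrite ?nnegrE ?subr_ge0 ?expR_ge0 // expR_ge1Dx.
  rewrite -expRM_natl -[leLHS]invrK lef_pV2 ?posrE ?invr_gt0 ?expR_gt0 ?exprn_gt0 // -expRN.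
  apply: (@le_trans _ _ (expR (delta * k%:R / m) ^+ d.+1)).
    apply: lerXn2r; rewrite ?nnegrE ?expR_ge0 ?(ltW y0) //.
    by apply: le_trans (expR_ge1Dx _); rewrite lerDr.
  rewrite -expRM_natl ler_expR -/m mulrCA divff ?gt_eqF // mulr1.
  by rewrite mulrN opprK mulrC.
apply: le_trans (ler_wpM2l _ h1) _; first by rewrite mulr_ge0 // exprn_ge0 // mulr_ge0.
have -> : C * (2 * k%:R) ^+ d * ((delta * k%:R / m) ^+ d.+1)^-1 = X / k%:R.
  rewrite /X !exprMn !exprVn [k%:R ^+ d.+1]exprSr.
  have a1 : k%:R != 0 :> R by rewrite gt_eqF.
  have a2 : delta ^+ d.+1 != 0 by rewrite expf_neq0 // gt_eqF.
  have a3 : m ^+ d.+1 != 0 by rewrite expf_neq0 // gt_eqF.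
  have a4 : k%:R ^+ d != 0 :> R by rewrite expf_neq0.
  by field; rewrite a1 a2 a3 a4.
by rewrite ler_pdivrMr // mul1r.
Qed.

End RealSeq.

Section ChooseK.
Variables (R : realType) (B : nat) (delta : R).
Hypotheses (d0 : 0 < delta) (d1 : delta <= 1).

Lemma choose_K : exists2 K, (0 < K)%N &
  2 * (par_b B K)%:R ^+ 2 * ((2 * ncells R B K) ^+ 2 * pstar B K delta) <= 1.
Proof.
(* Here [25 = 5 ^ 2] because [4 * b + 3 <= 5 * t ^ 2], 19 because [18 * t + 1 <= 19 * t], and
   [18 = 4 + 12 + 2] collects the powers of [t] in [b ^ 2], the three cell counts and the number of
   directions. All grow polynomially in [K], against the geometric factor of [pstar]. *)
have [P hP] : exists P, P = 25%N by exists 25%N.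
have [Q hQ] : exists Q, Q = 19%N by exists 19%N.
have [E hE] : exists E, E = 18%N by exists 18%N.
pose T1 : nat := (8 * (4 * B + 21))%N.
pose C : R := (8 * P ^ 3 * Q ^ 2 * T1 ^ E)%N%:R.
have [k k0 hk] := @poly_geom R C delta E (ler0n _ _) d0 d1.
exists k.+1 => //; set t := par_t B k.+1; set b := par_b B k.+1.
have c0 : 0 <= 1 - delta by rewrite subr_ge0.
have bt : b = (t ^ 2)%N by [].
have t1 : (160 <= t)%N by exact: par_t_ge.
have tK : (t <= T1 * (2 * k))%N.
  by rewrite /t /par_t /par_tau /T1; move: k0; clear; nia.
apply: le_trans hk; rewrite /pstar /ncells !mulrA.
apply: ler_wpM2r; first exact: exprn_ge0.
rewrite -/b -/t /C -!(natrM, natrX) ler_nat.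
have n1 : (((2 * b + 1).*2.+1) ^ 2 <= P * t ^ 4)%N.
  apply: (@leq_trans ((5 * t ^ 2) ^ 2)); last by rewrite expnMn -expnM hP.
  by rewrite leq_exp2r // -muln2 bt; move: t1; clear; nia.
have n2 : (((9 * t).*2.+1) ^ 2 <= Q ^ 2 * t ^ 2)%N.
  by rewrite -expnMn leq_exp2r // -muln2 hQ; move: t1; clear; lia.
move: n1 n2; set x := (_.*2.+1 ^ 2)%N; set y := ((9 * t).*2.+1 ^ 2)%N => n1 n2.
have -> : (8 * P ^ 3 * Q ^ 2 * T1 ^ E * (2 * k) ^ E = 8 * P ^ 3 * Q ^ 2 * (T1 * (2 * k)) ^ E)%N.
  by rewrite (expnMn T1 (2 * k)) mulnA.
apply: (@leq_trans (8 * P ^ 3 * Q ^ 2 * t ^ E)); last first.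
  by rewrite leq_mul2l leq_exp2r ?hE // tK orbT.
apply: (@leq_trans (8 * (t ^ 2) ^ 2 * (P * t ^ 4) ^ 3 * (Q ^ 2 * t ^ 2))%N); last first.
  by apply: eq_leq; rewrite hE; ring.
rewrite [X in (X <= _)%N](_ : _ = 8 * b ^ 2 * x ^ 3 * y)%N; last by rewrite /x; ring.
by rewrite bt; apply: leq_mul n2; rewrite leq_mul2l leq_exp2r // n1 orbT.
Qed.

End ChooseK.

Lemma boxf_mono (x : site) r s : (r <= s)%N -> boxf x r `<=` boxf x s.
Proof.
move=> rs; apply: boxf_sub; rewrite subrr normr0 add0r lez_nat //.
Qed.

Section Recursion.
Variables (R : realType) (eps : R) (B K : nat) (delta : R).
Hypotheses (eps_gt0 : 0 < eps) (B0 : (0 < B)%N) (K0 : (0 < K)%N).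
Hypotheses (d0 : 0 < delta) (d1 : delta <= 1).
Local Notation b := (par_b B K).
Local Notation s := ((2 * ncells R B K) ^+ 2 * pstar B K delta).
Hypothesis hs : 2 * b%:R ^+ 2 * s <= 1.

Definition bigN (i : nat) : nat := (5 * scale B K (2 * i))%N.
(** The length threshold of [short] for [2 * i] scales of which [i] may be straight. It exceeds
    [b ^ (2 * i)] by a power, as [(b - 1) * (b + 4) = b ^ 2 + 3 * b - 4]. *)
Definition len (i : nat) : nat := (((b - 1) * (b + 4)) ^ i)%N.
(** With 640, growth at rate [gap / 8] over [len - 1] steps is at least [expR (20 * b * (i + 1))],
    more than the number of sites in the box of radius [scale (2 * i)]. *)
Definition gap (i : nat) : R := 640 * b%:R * i.+1%:R / (len i)%:R.

Lemma b_ge160 : (160 <= b)%N.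
Proof. by have := par_b_ge B K; have := par_t_ge B K; clear; lia. Qed.

Lemma len_gt0 i : (0 < len i)%N.
Proof. by rewrite expn_gt0 muln_gt0; have := b_ge160; clear; lia. Qed.

Lemma gap_gt0 i : 0 < gap i.
Proof. by rewrite divr_gt0 ?mulr_gt0 ?ltr0n ?len_gt0 //; have := b_ge160; clear; lia. Qed.

Lemma bigN0 : bigN 0 = (10 * b)%N.
Proof. by rewrite /bigN /scale muln0 expn0 muln1 mulnA. Qed.

Lemma bigNE i : bigN i = (bigN 0 * (b ^ 2) ^ i)%N.
Proof. by rewrite bigN0 /bigN /scale expnM; ring. Qed.

Lemma bigNS i : bigN i.+1 = (b ^ 2 * bigN i)%N.
Proof. by rewrite !(bigNE _.+1) (bigNE i) expnS; ring. Qed.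

Lemma bigN_gt0 i : (0 < bigN i)%N.
Proof. by rewrite muln_gt0 scale_gt0. Qed.

Lemma bigN_mono j i : (j <= i)%N -> (bigN j <= bigN i)%N.
Proof.
move=> ji; rewrite (bigNE j) (bigNE i) leq_mul2l leq_pexp2l ?orbT //.
by rewrite expn_gt0; have := b_ge160; clear; lia.
Qed.

Variable p : set (fld R) -> R.
Hypothesis lawp : gauss_law eps p.
Hypothesis hdelta : forall a x, 2 <= nrm1 a ->
  p [set eta | hard_cross a x (sq a x (2 * B%:Z)) eta] <= 1 - delta.

Local Notation m i := (p (dis (boxf o (bigN i)))).

Lemma growth_numeric i : (0 < i)%N -> gap i <= 8 ->
  ((scale B K (2 * i)).*2.+1 ^ 2)%N%:R < (1 + gap i / 8) ^+ (len i).-1.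
Proof.
move=> i0 gi; have b160 := b_ge160; have g0 := gap_gt0 i; set x := gap i / 8.
have x0 : 0 <= x by rewrite /x divr_ge0 // ltW.
have x1 : x <= 1 by rewrite /x; lra.
have L2 : (2 <= len i)%N.
  apply: (@leq_trans (2 ^ i)); first by rewrite -[X in (X <= _)%N]expn1 leq_pexp2l.
  by rewrite leq_exp2r //; move: b160; clear; nia.
have ex : expR (x / 2) <= 1 + x.
  by have := @expR_le12 R (x / 2); move=> /(_ _ _)/le_trans; apply; lra.
apply: (@lt_le_trans _ _ (expR (x / 2) ^+ (len i).-1)); last first.
  by apply: lerXn2r; rewrite ?nnegrE ?expR_ge0 ?addr_ge0.
rewrite -expRM_natl.
apply: (@lt_le_trans _ _ (expR ((5 * b)%N%:R * (4 * i.+1)%N%:R))); last first.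
  rewrite ler_expR /x /gap.
  have l0 : 0 < (len i)%:R :> R by rewrite ltr0n len_gt0.
  have l2 : (len i)%:R <= 2 * (len i).-1%:R :> R.
    by rewrite -natrM ler_nat; move: L2; clear; lia.
  rewrite (_ : _ * (_ / 2) = (40 * b%:R * i.+1%:R) * (len i).-1%:R / (len i)%:R); last first.
    by field; rewrite gt_eqF.
  rewrite ler_pdivlMr // (natrM _ 5 b) (natrM _ 4 i.+1).
  rewrite [leLHS](_ : _ = 20 * b%:R * i.+1%:R * (len i)%:R); last first.
    by move: (b%:R : R) (i.+1%:R : R) ((len i)%:R : R) => y1 y2 y3; ring.
  rewrite [leRHS](_ : _ = 20 * b%:R * i.+1%:R * (2 * (len i).-1%:R)); last first.
    by move: (b%:R : R) (i.+1%:R : R) ((len i).-1%:R : R) => y1 y2 y3; ring.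
  by apply: ler_wpM2l l2; rewrite !mulr_ge0.
rewrite mulrC expRM_natl.
apply: (@lt_le_trans _ _ ((1 + (5 * b)%N%:R) ^+ (4 * i.+1))); last first.
  by apply: lerXn2r; rewrite ?nnegrE ?expR_ge0 ?addr_ge0 // expR_ge1Dx.
rewrite -(natrD _ 1%N) -natrX ltr_nat.
apply: (@leq_ltn_trans ((5 * b) ^ (4 * i + 2))).
  rewrite (_ : 4 * i + 2 = (2 * i).+1 * 2)%N; last by clear; lia.
  rewrite expnM leq_exp2r // expnMn -muln2 /scale (expnS b).
  have h5 : (5 <= 5 ^ (2 * i).+1)%N by rewrite -[X in (X <= _)%N]expn1 leq_pexp2l.
  have bb : (0 < b * b ^ (2 * i))%N by rewrite muln_gt0 expn_gt0; move: b160; clear; lia.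
  apply: (@leq_trans (5 * (b * b ^ (2 * i)))%N); last by rewrite leq_mul2r h5 orbT.
  by rewrite -mulnA; move: bb; clear; lia.
apply: (@leq_ltn_trans ((5 * b) ^ (4 * i.+1))).
  by rewrite leq_pexp2l //; [move: b160|]; clear; lia.
by rewrite ltn_exp2r //; clear; lia.
Qed.

(** If the disagreement set let no path leave the inner box in fewer than [len i] steps, the ball of
    that many steps would have more sites than the box. *)
Lemma diff_short i (eta : fld R) : (0 < i)%N -> gap i <= 8 ->
  diff (boxf o (bigN i)) eta (shift (gap i) (boxf o (bigN i)) eta) o -> short B K o (2 * i) i eta.
Proof.
move=> i0 gi; set D := boxf o (bigN i); set c := gap i => hd.
have c0 : 0 <= c by exact/ltW/gap_gt0.
have {}hd : diff D eta (plus c eta) o.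
  by rewrite -(@diff_local _ D eta (shift c D eta)) // => u uD; rewrite /shift /plus uD.
apply: contrapT => nsh; set n := scale B K (2 * i).
have n0 : (0 < n)%N by exact: scale_gt0.
have := @ball_growth R D c eta c0 (boxf o n) (len i).-1 hd.
have sD : boxf o n `<=` D by apply: boxf_mono; rewrite /bigN -/n; clear; lia.
have hr v : reach D c eta (len i).-1 v -> v \in boxf o n.
  move=> [q [oq hl sq hC]]; rewrite mem_boxf.
  have [far|near] := leP (n%:Z ^+ 2) (nrm2 (vsub v o)); last first.
    have nz : 0 <= n%:Z by [].
    by have [h1 h2] := coord_le nz (ltW near); rewrite h1 h2.
  exfalso; apply: nsh; exists o, q; split=> //.
  - move=> w /hC; apply: diff_anti => u _ //.
    by rewrite /plus lerDl.
  - by rewrite hl.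
  - have -> : ((b - 1) ^ i * (b + 4) ^ (2 * i) = len i * (b + 4) ^ i)%N.
      by rewrite /len expnMn mul2n -addnn expnD mulnA.
    rewrite ltn_mul2r expn_gt0 addn_gt0 orbT /=.
    by apply: leq_ltn_trans sq _; rewrite prednK // len_gt0.
move=> /(_ sD hr) h; have := growth_numeric i0 gi; apply/negP; rewrite -leNgt.
by apply: le_trans h _; rewrite ler_nat card_boxf.
Qed.

Lemma main_ineq i : m i <= s ^+ i + (6 / eps + 1) * gap i *
  ((bigN 0)%:R + b%:R ^+ 2 * \sum_(k < i) (bigN k)%:R * m k).
Proof.
have g0 := gap_gt0 i; have m0 F := law_ge0 lawp F.
have s0 : 0 <= s ^+ i.
  rewrite exprn_ge0 // mulr_ge0 ?sqr_ge0 //; exact: pstar_ge0.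
have S0 : 0 <= \sum_(k < i) (bigN k)%:R * m k by apply: sumr_ge0 => k _; rewrite mulr_ge0.
have N0 : 1 <= (bigN 0)%:R :> R by rewrite ler1n bigN_gt0.
have e0 : 0 < eps^-1 by rewrite invr_gt0.
set S := \sum_(k < i) _ in S0 *.
have bS : 0 <= b%:R ^+ 2 * S by rewrite mulr_ge0 ?sqr_ge0.
(* For large [gap] the right-hand side exceeds 1. This also disposes of [i = 0]. *)
have [big|small] := ltP 8 (gap i).
  apply: (@le_trans _ _ 1); first by apply: (law_le1 lawp); exact: ms_dis.
  rewrite -[leLHS]add0r; apply: lerD => //.
  apply: (@le_trans _ _ (1 * 1 * 1)); first by rewrite !mulr1.
  apply: ler_pM; rewrite ?mul1r //; last by lra.
  by apply: (@le_trans _ _ (1 * 1)); [rewrite mulr1|apply: ler_pM => //; lra].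
have i0 : (0 < i)%N.
  case: (i) small => // ; rewrite /gap /len expn0 divr1 mulr1.
  have : 1 <= b%:R :> R by rewrite ler1n; have := b_ge160; clear; lia.
  by lra.
(* The sequence starts with the empty set, so the first annulus is the whole box of radius [bigN 0],
   weighted by a probability at most 1; it produces the term free of any [m k]. *)
pose Dk k := if k is j.+1 then boxf o (bigN j) else fset0 : {fset site}.
pose a k := 3 * gap i * (bigN k)%:R / eps.
have Nk k : 0 < (bigN k)%:R :> R by rewrite ltr0n bigN_gt0.
have g3 : 0 < 3 * gap i by apply: mulr_gt0 g0.
have a0 k : 0 < a k by apply: divr_gt0 eps_gt0; exact: mulr_gt0 g3 (Nk k).
have mono j k : (j <= k)%N -> Dk j `<=` Dk k.
  case: j k => [|j] [|k] //; rewrite /Dk ?fsub0set // ltnS => jk.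
  by apply: boxf_mono; exact: bigN_mono.
have ha k : gap i ^+ 2 / eps ^+ 2 * (#|` Dk k.+1|)%:R <= a k ^+ 2.
  have e2 : 0 < (eps ^+ 2)^-1 by rewrite invr_gt0 exprn_gt0.
  have g2 : 0 < gap i ^+ 2 by exact: exprn_gt0.
  rewrite /a (expr_div_n (3 * gap i * (bigN k)%:R) eps) [leLHS]mulrAC (ler_pM2r e2).
  rewrite [leRHS](_ : _ = gap i ^+ 2 * (3 * (bigN k)%:R) ^+ 2); last first.
    by move: (gap i) ((bigN k)%:R : R) => y1 y2; ring.
  rewrite (ler_pM2l g2) -natrM -natrX ler_nat.
  apply: leq_trans (card_boxf _ _) _; rewrite leq_exp2r // -muln2.
  by have := bigN_gt0 k; clear; lia.
have := @hybrid R eps eps_gt0 p lawp Dk i.+1 (gap i) a erefl mono a0 ha.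
move=> /le_trans; apply; apply: lerD.
  apply: (@le_trans _ _ (p (short B K o (2 * i) i))).
    apply: (law_mono lawp).
    - apply: (ms_diff (fun d => d o)); [exact: mfield_id|exact: mfield_shift].
    - exact: msT_sub (@ms_short R B K o (2 * i) i).
    - by move=> eta; exact: diff_short.
  by have := law_short K0 lawp (ltW d0) d1 hdelta o (2 * i) i; rewrite exprM -exprMn.
rewrite big_ord_recl /=; have m1 : p (dis fset0) <= 1 by apply: (law_le1 lawp); exact: ms_dis.
have -> : \sum_(j < i) p (dis (Dk (lift ord0 j))) * (2 * a (lift ord0 j)) =
    6 / eps * gap i * (b%:R ^+ 2 * S).
  rewrite /S !mulr_sumr; apply: eq_bigr => j _; rewrite /a lift0 bigNS natrM natrX.
  by rewrite /Dk /=; ring.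
have h1 : p (dis fset0) * (2 * a 0%N) <= 6 / eps * gap i * (bigN 0)%:R.
  apply: (@le_trans _ _ (1 * (2 * a 0%N))); first by apply: ler_wpM2r => //; rewrite mulr_ge0 // ltW.
  rewrite mul1r /a le_eqVlt; apply/orP; left; apply/eqP.
  by move: (gap i) ((bigN 0)%:R : R) (eps^-1) => y1 y2 y3; ring.
apply: le_trans (lerD h1 (lexx _)) _; rewrite -mulrDr; apply: ler_wpM2r; first by rewrite addr_ge0.
by apply: ler_wpM2r; [exact: ltW|rewrite lerDl].
Qed.

End Recursion.

Lemma gapE (R : realType) B K i : gap R B K i =
  640 * (par_b B K)%:R * i.+1%:R / ((par_b B K - 1) * (par_b B K + 4))%N%:R ^+ i :> R.
Proof. by rewrite /gap /len natrX. Qed.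

Opaque bigN par_b gap.

Section SmallScale.
Variables (R : realType) (eps : R) (B : nat) (delta : R).
Hypotheses (eps_gt0 : 0 < eps) (B0 : (0 < B)%N) (d0 : 0 < delta) (d1 : delta <= 1).

Lemma small_scale (omega : R) : 0 < omega -> exists2 n, (0 < n)%N &
  forall p : set (fld R) -> R, gauss_law eps p ->
    (forall a x, 2 <= nrm1 a ->
       p [set eta | hard_cross a x (sq a x (2 * B%:Z)) eta] <= 1 - delta) ->
    n%:R * p (dis (boxf o n)) <= omega.
Proof.
move=> w0; have [K K0 hs] := choose_K B d0 d1.
set b := par_b B K in hs; set s := _ * pstar _ _ _ in hs.
have b160 : (160 <= b)%N := b_ge160 B K.
have bp : 0 < b%:R :> R by rewrite ltr0n; apply: leq_trans b160.
(* The ratio [th] satisfies [th * lam ^+ 3 <= 1] since [b ^+ 2 + 1 <= b ^+ 2 + 3 * b - 4]. Two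
   powers of [lam] are the decay required by [seq_uniform]; the third absorbs the factor [i + 1] of
   [gap] by Bernoulli. *)
pose nu : R := (7 * b%:R ^+ 2)^-1.
have b2 : 1 <= b%:R ^+ 2 :> R by rewrite exprn_ege1 // ler1n; apply: leq_trans b160.
have nu0 : 0 < nu by rewrite invr_gt0; lra.
have nu1 : nu <= 7^-1 by rewrite lef_pV2 ?posrE //; lra.
pose lam := 1 + nu; have l1 : 1 < lam by rewrite ltrDl.
have l0 : 0 < lam by apply: lt_trans l1.
pose th : R := b%:R ^+ 2 / ((b - 1) * (b + 4))%N%:R.
have den : ((b - 1) * (b + 4))%N%:R = b%:R ^+ 2 + 3 * b%:R - 4 :> R.
  by rewrite natrM natrB ?natrD; [ring|apply: leq_trans b160].
have b4 : 160 <= b%:R :> R by rewrite ler_nat.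
have th0 : 0 <= th by rewrite divr_ge0 // sqr_ge0.
have hth : th * lam ^+ 3 <= 1.
  have l3 : lam ^+ 3 <= 1 + 7 * nu.
    have -> : lam ^+ 3 = 1 + 3 * nu + 3 * (nu * nu) + nu * (nu * nu) by rewrite /lam; ring.
    have q1 : nu * nu <= nu by rewrite ler_piMr ?(ltW nu0) //; lra.
    have q2 : nu * (nu * nu) <= nu by apply: le_trans (_ : nu * nu <= nu) => //; rewrite (ler_pM2l nu0).
    by lra.
  apply: (@le_trans _ _ (th * (1 + 7 * nu))); first by apply: ler_wpM2l.
  rewrite /th den mulrAC ler_pdivrMr; last by lra.
  have e7 : 7 * nu * b%:R ^+ 2 = 1 by rewrite /nu; field; rewrite gt_eqF.
  by rewrite mulrDr mulr1 [_ * (7 * nu)]mulrC e7; lra.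
pose N0 : R := (bigN B K 0)%:R.
have N00 : 0 <= N0 by exact: ler0n.
pose C7 := (6 / eps + 1) * (640 * b%:R) * N0 * (N0 + b%:R ^+ 2).
have e0 : 0 <= 6 / eps by rewrite divr_ge0 // ltW.
have H640 : 0 <= 640 * b%:R :> R by apply: mulr_ge0; [exact: ler0n|exact: ltW].
have Z0 : 0 <= 6 / eps + 1 by apply: addr_ge0 => //; exact: ler01.
have Hb : 0 <= N0 + b%:R ^+ 2 by apply: addr_ge0 => //; exact: sqr_ge0.
have C70 : 0 <= C7 by exact: mulr_ge0 (mulr_ge0 (mulr_ge0 Z0 H640) N00) Hb.
pose C := N0 + C7 / nu.
have C0 : 0 <= C by rewrite addr_ge0 // divr_ge0 // ltW.
have [i hi] := seq_uniform l1 C0 w0.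
exists (bigN B K i); first exact: bigN_gt0.
(* The recursion is for scale times probability, the quantity that Peierls needs to be small; it is
   the shift of size [gap] times the scale that decays. *)
move=> p lawp hd; apply: (hi (fun i => (bigN B K i)%:R * p (dis (boxf o (bigN B K i))))).
  by move=> j; rewrite mulr_ge0 //; exact: law_ge0 lawp _.
move=> {hi}{i} i; have := main_ineq eps_gt0 K0 d0 d1 lawp hd i; rewrite -/b -/s.
set m := p _; set S := \sum_(k < i) _ => hm.
have S0 : 0 <= S by apply: sumr_ge0 => k _; rewrite mulr_ge0 //; exact: law_ge0 lawp _.
have NE : (bigN B K i)%:R = N0 * (b%:R ^+ 2) ^+ i by rewrite bigNE natrM !natrX.
have li k : 0 < lam ^+ k by rewrite exprn_gt0.
have bern : nu * i.+1%:R <= lam ^+ i.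
  apply: le_trans (bernoulli i (ltW nu0)); rewrite -natr1; lra.
have s0 : 0 <= s by rewrite mulr_ge0 ?sqr_ge0 //; exact: pstar_ge0.
have t1 : (bigN B K i)%:R * s ^+ i <= N0 / lam ^+ (2 * i).
  rewrite NE -mulrA; apply: ler_wpM2l => //; rewrite -exprMn.
  rewrite -[X in _ <= X]mul1r ler_pdivlMr // exprM -exprMn; apply: exprn_ile1.
    by apply: mulr_ge0 (sqr_ge0 _); exact: mulr_ge0 (sqr_ge0 _) s0.
  have l2 : lam ^+ 2 <= 2 by rewrite /lam expr2; nra.
  apply: (@le_trans _ _ (b%:R ^+ 2 * s * 2)); first by apply: ler_wpM2l l2; exact: mulr_ge0 (sqr_ge0 _) s0.
  by move: hs; lra.
have gE : (bigN B K i)%:R * gap R B K i = N0 * (640 * b%:R) * (i.+1%:R * th ^+ i) :> R.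
  rewrite NE gapE -/b /th expr_div_n; move: (((b - 1) * (b + 4))%N%:R ^+ i)^-1 => z.
  by move: (b%:R : R) (i.+1%:R : R) => y1 y3; ring.
have t2 : i.+1%:R * th ^+ i <= nu^-1 / lam ^+ (2 * i).
  rewrite ler_pdivlMr // -mulrA.
  have -> : i.+1%:R * (th ^+ i * lam ^+ (2 * i)) = i.+1%:R / lam ^+ i * (th * lam ^+ 3) ^+ i.
    have E3 : (lam ^+ 3) ^+ i = lam ^+ i * lam ^+ (2 * i).
      by rewrite -exprM -exprD; congr (_ ^+ _); clear; lia.
    have := li i; rewrite [(th * _) ^+ i]exprMn E3; move: (th ^+ i) (lam ^+ i) (lam ^+ (2 * i)) (i.+1%:R : R).
    by move=> y1 y2 y3 y4 y20; field; rewrite gt_eqF.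
  rewrite -[leRHS]mulr1; apply: ler_pM.
  - by rewrite divr_ge0 // ltW.
  - by rewrite exprn_ge0 // mulr_ge0 // ltW.
  - by rewrite ler_pdivrMr // mulrC ler_pdivlMr // mulrC.
  - by apply: exprn_ile1 => //; rewrite mulr_ge0 // ltW.
have Np : 0 < (bigN B K i)%:R :> R by rewrite ltr0n bigN_gt0.
apply: (@le_trans _ _ ((bigN B K i)%:R * (s ^+ i + (6 / eps + 1) * gap R B K i * (N0 + b%:R ^+ 2 * S)))).
  by rewrite ler_pM2l.
have -> : (bigN B K i)%:R * (s ^+ i + (6 / eps + 1) * gap R B K i * (N0 + b%:R ^+ 2 * S)) =
    (bigN B K i)%:R * s ^+ i + (6 / eps + 1) * ((bigN B K i)%:R * gap R B K i) * (N0 + b%:R ^+ 2 * S).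
  by move: (gap R B K i) ((bigN B K i)%:R : R) => y1 y2; ring.
rewrite gE.
have iL : 0 <= (lam ^+ (2 * i))^-1 by rewrite invr_ge0 ltW.
have q1 : N0 + b%:R ^+ 2 * S <= (N0 + b%:R ^+ 2) * (1 + S).
  have : 0 <= N0 * S by rewrite mulr_ge0.
  by lra.
have q2 : (6 / eps + 1) * (N0 * (640 * b%:R) * (i.+1%:R * th ^+ i)) * (N0 + b%:R ^+ 2 * S) <=
    C7 / nu / lam ^+ (2 * i) * (1 + S).
  have -> : C7 / nu / lam ^+ (2 * i) * (1 + S) =
      (6 / eps + 1) * (N0 * (640 * b%:R) * (nu^-1 / lam ^+ (2 * i))) * ((N0 + b%:R ^+ 2) * (1 + S)).
    by rewrite /C7; ring.
  have X0 : 0 <= i.+1%:R * th ^+ i by rewrite mulr_ge0 // exprn_ge0.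
  have Y0 : 0 <= N0 * (640 * b%:R) by exact: mulr_ge0 N00 H640.
  apply: ler_pM q1.
  - exact: mulr_ge0 Z0 (mulr_ge0 Y0 X0).
  - exact: addr_ge0 N00 (mulr_ge0 (sqr_ge0 _) S0).
  - by apply: (ler_wpM2l Z0); exact: (ler_wpM2l Y0 t2).
apply: le_trans (lerD t1 q2) _.
have -> : C / lam ^+ (2 * i) * (1 + S) = N0 / lam ^+ (2 * i) * (1 + S) + C7 / nu / lam ^+ (2 * i) * (1 + S).
  by rewrite /C; ring.
rewrite lerD2r; apply: ler_peMr; first exact: mulr_ge0 N00 iL.
by rewrite lerDl.
Qed.

End SmallScale.

(** * Exponential decay *)

Definition dist (x v : site) : nat := maxn (absz (v.1 - x.1)) (absz (v.2 - x.2)).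

Lemma dist_step x u v : nb u v -> `|(dist x v)%:Z - (dist x u)%:Z| <= 1.
Proof.
rewrite nbE /dist; case: u v x => u1 u2 [v1 v2] [x1 x2] /= => /or4P[] /andP[/eqP-> /eqP->]; lia.
Qed.

Lemma dist_tri x y v : (dist x v <= dist x y + dist y v)%N.
Proof. rewrite /dist; case: x y v => x1 x2 [y1 y2] [v1 v2] /=; lia. Qed.

Lemma dist_sym x y : dist x y = dist y x.
Proof. rewrite /dist; case: x y => x1 x2 [y1 y2] /=; lia. Qed.

Lemma dist_le x v n : (dist x v <= n)%N = (`|v.1 - x.1| <= n%:Z) && (`|v.2 - x.2| <= n%:Z).
Proof. rewrite /dist geq_max; case: x v => x1 x2 [v1 v2] /=; lia. Qed.

Lemma mem_boxf_dist x v n : (v \in boxf x n) = (dist x v <= n)%N.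
Proof. by rewrite mem_boxf dist_le. Qed.

Section Peierls.
Variables (R : realType) (eps : R).
Hypothesis eps_gt0 : 0 < eps.
Variable p : set (fld R) -> R.
Hypothesis lawp : gauss_law eps p.
Variable n : nat.
Hypothesis n_gt0 : (0 < n)%N.

(** A local weakening of disagreement in a large domain: by [diff_mono] it follows from it as soon
    as the domain contains this box. *)
Definition opensite (z : site) : set (fld R) := [set eta | diff (boxf z n) eta eta z].

Lemma ms_opensite z : ms [set v | v \in boxf z n] (opensite z).
Proof.
have m : mfield [set v | v \in boxf z n] (boxf z n) (id : fld R -> fld R) by exact: mfield_id.
exact: (ms_diff (fun d => d z) m m).
Qed.

Lemma law_opensite z : p (opensite z) = p (dis (boxf o n)).
Proof.
have md : ms setT (@dis R (boxf o n)) by exact: ms_dis.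
rewrite -(law_perm lawp (trnK z) (trnVK z) md); congr (p _).
have bz : boxf z n = fimg (trn z) (boxf o n).
  apply/fsetP => v; rewrite -(trnVK z v) mem_fimg; last exact: can_inj (trnK z).
  by move: (trn (opps z) v) => w; rewrite !mem_boxf /trn /= !addrK !subr0.
have E (eta : fld R) : diff (boxf z n) eta eta z = diff (boxf o n) (eta \o trn z) (eta \o trn z) o.
  by rewrite bz -[X in diff _ _ _ X](trn0 z) (diff_fimg _ _ _ _ (trnK z) (trnVK z) (nb_trn z)).
by apply/seteqP; split=> eta; rewrite /opensite /= E.
Qed.

Definition route (Q : pred site) (x : site) (k : nat) (zq : site * seq site) : bool :=
  [&& path nb zq.1 zq.2, all Q (zq.1 :: zq.2), (dist x zq.1 <= n)%N &
      (10 * n * k <= dist x (last zq.1 zq.2))%N].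

Definition conn (Q : pred site) (x : site) (k : nat) : set (fld R) :=
  [set eta | exists zq, route Q x k zq /\ forall v, v \in zq.1 :: zq.2 -> opensite v eta].

Lemma ms_conn (S : set site) (Q : pred site) x k : (forall v, Q v -> forall w, w \in boxf v n -> S w) -> ms S (conn Q x k).
Proof.
move=> QS; pose F (zq : site * seq site) := if route Q x k zq then
  [set eta : fld R | forall v, v \in zq.1 :: zq.2 -> opensite v eta] else set0.
have mF zq : ms S (F zq).
  rewrite /F; case: ifP => [/and4P[_ /allP h _ _]|_]; last exact: ms0.
  apply: ms_forall => v /h Qv; apply: (ms_sub _ (@ms_opensite v)) => w /=; exact: QS.
rewrite (_ : conn Q x k = \bigcup_j (if choice.unpickle j is Some zq then F zq else set0))%classic.
  apply: (@bigcupT_measurable _ (g_sigma_algebraType (cyl S))) => j.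
  by case: (choice.unpickle j) => [zq|]; [exact: mF|exact: ms0].
apply/seteqP; split=> eta.
  move=> [zq [h1 h2]]; exists (choice.pickle zq); first exact: I.
  by rewrite choice.pickleK /F h1.
move=> [j _]; case: (choice.unpickle j) => // zq; rewrite /F; case: ifP => // h1 h2.
by exists zq.
Qed.

Definition ring_sites (x : site) : seq site := [seq trn x s | s <- shell (2 * n).-1].

Lemma ring_sitesP x w : ((2 * n).-1 <= dist x w <= 2 * n)%N -> w \in ring_sites x.
Proof.
move=> h; apply/mapP; exists (w.1 - x.1, w.2 - x.2); last first.
  by rewrite /trn /= !subrK; case: (w).
move: h; rewrite /dist; case: w x => w1 w2 [x1 x2] /= h.
by apply: in_shell; move: h n_gt0; clear; lia.
Qed.

Lemma ring_sites_dist x w : w \in ring_sites x -> (dist x w <= 2 * n)%N.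
Proof.
move=> /mapP[[i j] /mem_shell[h1 h2 _] ->]; rewrite /trn /dist /= !addrK.
by move: h1 h2 n_gt0; clear; lia.
Qed.

Definition outside (x : site) : pred site := fun v => (4 * n < dist x v)%N.

(* After its last visit to the box of radius [4 n] around [x], the path does not depend on the
   field near the site where it left the box of radius [2 n]. *)
Lemma conn_step x k eta : conn xpredT x k.+1 eta ->
  exists2 zy, zy \in [seq (z, y) | z <- ring_sites x, y <- cells x n%:Z 5] &
    (opensite zy.1 `&` conn (outside x) zy.2 k)%classic eta.
Proof.
case=> -[z q] [/and4P[/= zq _ dz dl] hO].
pose f v := (dist x v)%:Z; have hf u v : nb u v -> `|f v - f u| <= 1 by exact: dist_step.
have dl10 : (10 * n <= dist x (last z q))%N by apply: leq_trans dl; clear; lia.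
have fz : f z <= (2 * n).-1%:Z + 1 by rewrite /f; move: dz n_gt0; clear; lia.
have fl : (2 * n).-1%:Z <= f (last z q) by rewrite /f; move: dl10 n_gt0; clear; lia.
have [q1 [zq1 sub1 hl1 hb1]] := path_upto hf zq fz fl.
have w1 : last z q1 \in z :: q.
  by have := mem_last z q1; rewrite !inE => /orP[->//|/sub1->]; rewrite orbT.
have hw1 : last z q1 \in ring_sites x.
  apply: ring_sitesP; have := hb1 _ (mem_last z q1); move: hl1; rewrite /f.
  by move: (dist x (last z q1)) => d; move: n_gt0; clear; lia.
have [h|[y [q2 [yq2 sub2 hl2 fy hq2]]]] := path_from f (4 * n)%N%:Z zq.
  by have := h z (mem_head _ _); rewrite /f; move: dz; clear; lia.
case: q2 yq2 sub2 hl2 hq2 => [|w q2] /= yq2 sub2 hl2 hq2.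
  by move: fy; rewrite hl2 /f; move: dl10 n_gt0; clear; lia.
case/andP: yq2 => yw wq2.
have dw : (dist x w <= 5 * n)%N.
  have := hf _ _ yw; move: fy; rewrite /f; move: (dist x w) (dist x y) => d d'.
  by move: n_gt0; clear; lia.
have n0 : 0 < n%:Z by rewrite ltz_nat.
move: (dw); rewrite dist_le => /andP[w1' w2'].
rewrite PoszM in w1' w2'.
have [y' hy' [c1 c2]] := cells_cover n0 w1' w2'.
exists (last z q1, y'); first exact: (allpairs_f (fun a b : site => (a, b)) hw1 hy').
split; first exact: hO.
have [b1 b2] := cells_bound n0 hy'.
have dy : (dist x y' <= 5 * n)%N by rewrite dist_le PoszM b1 b2.
exists (w, q2); split; last first.
  by move=> v vq; apply: hO; apply: sub2; rewrite (in_cons y); apply/orP; right.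
apply/and4P; split=> //.
- by apply/allP => v vq; have := hq2 v vq; rewrite /f ltz_nat.
- by rewrite dist_le c1 c2.
- rewrite /= hl2; have := dist_tri x y' (last z q); move: dl dy.
  by move: (dist x (last z q)) (dist x y') (dist y' (last z q)) => e1 e2 e3; clear; lia.
Qed.

(** At most [40 * n] exit sites and [121 = 11 ^ 2] restarting cells are possible at each step. The
    exit site looks at the field within [3 * n] of [x], the later path only beyond, hence
    independence. *)
Lemma conn_prob x k : p (conn xpredT x k) <= (40 * 121 * (n%:R * p (dis (boxf o n)))) ^+ k.
Proof.
have m0 := law_ge0 lawp (dis (boxf o n)).
set th := 40 * 121 * _; have th0 : 0 <= th by rewrite mulr_ge0 ?mulr_ge0.
elim: k x => [|k IH] x.
  by rewrite expr0; apply: (law_le1 lawp); exact: ms_conn.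
pose F (zy : site * site) := (opensite zy.1 `&` conn (outside x) zy.2 k)%classic.
pose s := [seq (z, y) | z <- ring_sites x, y <- cells x n%:Z 5].
have mC Q y j : ms setT (conn Q y j) by exact: ms_conn.
have mO z : ms setT (opensite z) by exact: msT_sub (@ms_opensite z).
apply: (@le_trans _ _ (p (dis (boxf o n)) * th ^+ k * (size s)%:R)).
  apply: (law_union_le lawp (F := F)) => //.
  - by move=> zy _; exact: msI.
  - move=> -[z y] /allpairsP[[z' y'] /= [hz _ [-> _]]]; rewrite /F /=.
    rewrite (law_indep lawp (S := [set v | (dist x v <= 3 * n)%N])
      (S' := [set v | (3 * n < dist x v)%N])).
    + rewrite law_opensite; apply: ler_wpM2l => //; apply: le_trans (IH y).
      apply: (law_mono lawp) => // eta [zq [/and4P[h1 _ h3 h4] h5]].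
      by exists zq; split=> //; apply/and4P; split=> //; exact/allP.
    + by apply/seteqP; split=> v // [/= h1]; rewrite ltnNge h1.
    + apply: (ms_sub _ (@ms_opensite z')) => v /=; rewrite mem_boxf_dist => h.
      apply: leq_trans (dist_tri x z' v) _; have := ring_sites_dist hz.
      by move: h; clear; lia.
    + apply: ms_conn => v; rewrite /outside => h w; rewrite mem_boxf_dist => h' /=.
      have := dist_tri x w v; rewrite (dist_sym w v).
      by move: h h'; clear; lia.
  - by move=> eta /conn_step.
have sz : (size s <= 40 * 121 * n)%N.
  rewrite size_allpairs size_cells size_map size_shell mulnAC.
  by apply: leq_mul; [move: n_gt0; clear; lia|].
have h : (size s)%:R <= 40 * 121 * n%:R :> R by rewrite -!natrM ler_nat.
have t0 : 0 <= th ^+ k by exact: exprn_ge0.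
apply: le_trans (ler_wpM2l (mulr_ge0 m0 t0) h) _.
rewrite exprS {2}/th; move: (th ^+ k) (p (dis (boxf o n))) (n%:R : R) => y1 y2 y3.
by rewrite [leRHS](_ : _ = y2 * y1 * (40 * 121 * y3)) //; ring.
Qed.

(** Paths to the boundary come from [escape], which takes a positive shift; [key] holds for every
    such shift, with an error linear in it. *)
Lemma dis_conn (N k : nat) : (10 * n * k + n < N)%N ->
  p (dis (boxf o N)) <= p (conn xpredT o k).
Proof.
move=> hN; set D := boxf o N; have N0 : (0 < N)%N by apply: leq_ltn_trans hN.
have key c : 0 < c -> p (dis D) <= p (conn xpredT o k) + 6 * c * N%:R / eps.
  move=> c0; pose Dk j := if j is _.+1 then D else fset0 : {fset site}.
  pose a (j : nat) := 3 * c * N%:R / eps.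
  have a0 j : 0 < a j by rewrite divr_gt0 // !mulr_gt0 // ltr0n.
  have mono i j : (i <= j)%N -> Dk i `<=` Dk j by case: i j => [|i] [|j] //; rewrite /Dk ?fsub0set.
  have ha j : c ^+ 2 / eps ^+ 2 * (#|` Dk j.+1|)%:R <= a j ^+ 2.
    have e2 : 0 < (eps ^+ 2)^-1 by rewrite invr_gt0 exprn_gt0.
    rewrite /a expr_div_n [leLHS]mulrAC (ler_pM2r e2).
    rewrite [leRHS](_ : _ = c ^+ 2 * (3 * N%:R) ^+ 2); last by ring.
    rewrite ler_pM2l ?exprn_gt0 // -natrM -natrX ler_nat.
    apply: leq_trans (card_boxf _ _) _; rewrite leq_exp2r // -muln2.
    by move: N0; clear; lia.
  have := @hybrid R eps eps_gt0 p lawp Dk 1 c a erefl mono a0 ha.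
  move=> /le_trans; apply; apply: lerD.
    apply: (law_mono lawp).
    - by apply: (ms_diff (fun d => d o)); [exact: mfield_id|exact: mfield_shift].
    - exact: ms_conn.
    move=> eta /= hd.
    have {}hd : diff D eta (plus c eta) o.
      by rewrite -(@diff_local _ D eta (shift c D eta)) // => u uD; rewrite /shift /plus uD.
    have [q [oq hl hC]] := escape c0 hd.
    pose f v := (dist o v)%:Z; have hf u v : nb u v -> `|f v - f u| <= 1 by exact: dist_step.
    have fo : f o <= (N - n - 1)%N%:Z + 1 by rewrite /f /dist /= addr_ge0.
    have fl : (N - n - 1)%N%:Z <= f (last o q).
      move: hl; rewrite mem_boxf_dist /f; move: (dist o (last o q)) => d.
      by clear; lia.
    have [q1 [oq1 sub1 hl1 hb1]] := path_upto hf oq fo fl.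
    exists (o, q1); split.
      apply/and4P; split=> //=; first exact/allP.
      by move: hl1 hN; rewrite /f; move: (dist o (last o q1)) => d; clear; lia.
    move=> v vq; have vC : diff D eta (plus c eta) v.
      by apply: hC; move: vq; rewrite !inE => /orP[->//|/sub1->]; rewrite orbT.
    have dv : (dist o v <= N - n)%N.
      by have := hb1 v vq; rewrite /f; move: (dist o v) hN => d; clear; lia.
    apply: (@diff_mono _ _ D).
      apply/fsubsetP => w; rewrite !mem_boxf_dist => hw; have := dist_tri o v w.
      by move: hw dv hN; move: (dist o v) (dist v w) (dist o w) => e1 e2 e3; clear; lia.
    by apply: diff_anti vC => u _ //; rewrite /plus lerDl ltW.
  rewrite big_ord_recl big_ord0 addr0 /=.
  have m1 : p (dis fset0) <= 1 by apply: (law_le1 lawp); exact: ms_dis.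
  apply: (@le_trans _ _ (1 * (2 * a 0%N))); first by apply: ler_wpM2r => //; rewrite mulr_ge0 // ltW.
  by rewrite mul1r /a !mulrA; apply: ler_wpM2r; [rewrite invr_ge0 ltW|rewrite -!mulrA mulrA -natrM].
rewrite leNgt; apply/negP => hlt; pose g := p (dis D) - p (conn xpredT o k).
have g0 : 0 < g by rewrite subr_gt0.
have Np : 0 < N%:R :> R by rewrite ltr0n.
(* This shift makes the error half of the assumed excess [g]. *)
have c0 : 0 < g * eps / (12 * N%:R) by rewrite divr_gt0 // mulr_gt0.
have := key _ c0.
have -> : 6 * (g * eps / (12 * N%:R)) * N%:R / eps = g / 2 by field; rewrite !gt_eqF.
by move: g0; rewrite /g; lra.
Qed.

(** The assumption makes each step of [conn_prob] cost at most 1/2, which is below [expR (- 2^-1)];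
    a step advances by [10 * n], whence the rate [1 / (20 * n)]. The prefactor absorbs the
    incomplete step. *)
Lemma exp_decay N : n%:R * p (dis (boxf o n)) <= (2 * (40 * 121))^-1 ->
  p (dis (boxf o N)) <= 20 * n%:R * expR (- ((20 * n%:R)^-1 * N%:R)).
Proof.
move=> hm; have np : 0 < n%:R :> R by rewrite ltr0n.
have n1 : 1 <= n%:R :> R by rewrite ler1n.
have [k [hk1 hk2]] : exists k, (N <= 12 * n + 10 * n * k)%N /\
    (p (dis (boxf o N)) <= (2^-1) ^+ k).
  have md : ms setT (@dis R (boxf o N)) by exact: ms_dis.
  have [small|big] := leqP N (12 * n).
    by exists 0%N; rewrite muln0 addn0 expr0; split=> //; exact: (law_le1 lawp).
  exists ((N - n - 1) %/ (10 * n))%N; set k := (_ %/ _)%N.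
  have e := divn_eq (N - n - 1) (10 * n); rewrite -/k in e.
  have n10 : (0 < 10 * n)%N by move: n_gt0; clear; lia.
  have r := ltn_pmod (N - n - 1) n10; split.
    by move: e r big; rewrite mulnC; move: ((N - n - 1) %% (10 * n))%N (10 * n * k)%N => e1 e2; clear; lia.
  apply: (@le_trans _ _ (p (conn xpredT o k))).
    apply: dis_conn; move: e big n_gt0; rewrite mulnC.
    by move: ((N - n - 1) %% (10 * n))%N (10 * n * k)%N => e1 e2; clear; lia.
  apply: le_trans (conn_prob o k) _; apply: lerXn2r; rewrite ?nnegrE ?invr_ge0 //.
    by rewrite !mulr_ge0 //; exact: law_ge0 lawp _.
  by move: hm; lra.
apply: le_trans hk2 _.
have h2 : expR (2^-1) <= 2 :> R.
  by apply: le_trans (expR_le12 _ _) _; lra.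
apply: (@le_trans _ _ (expR (- (2^-1)) ^+ k)).
  have h2' : 2^-1 <= expR (- 2^-1) :> R by rewrite expRN lef_pV2 ?posrE ?expR_gt0.
  by apply: lerXn2r => //; rewrite nnegrE ?invr_ge0 ?expR_ge0.
rewrite -expRM_natl.
have h3 : expR (3 / 5) <= 20 * n%:R :> R.
  have a1 : expR (3 / 10) <= 8 / 5 :> R.
    by apply: le_trans (expR_le12 _ _) _; lra.
  have e35 : expR (3 / 5) = expR (3 / 10) * expR (3 / 10) :> R by rewrite -expRD; congr expR; lra.
  rewrite e35; apply: (@le_trans _ _ (8 / 5 * (8 / 5))); first by apply: ler_pM; rewrite ?expR_ge0.
  by lra.
apply: (@le_trans _ _ (expR (3 / 5) * expR (- ((20 * n%:R)^-1 * N%:R)))); last first.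
  by apply: ler_wpM2r; rewrite ?expR_ge0.
rewrite -expRD ler_expR.
have : (20 * n%:R)^-1 * N%:R <= 3 / 5 + k%:R / 2 :> R.
  rewrite mulrC ler_pdivrMr ?mulr_gt0 //.
  have -> : (3 / 5 + k%:R / 2) * (20 * n%:R) = (12 * n + 10 * n * k)%N%:R :> R.
    by rewrite natrD !natrM; field.
  by rewrite ler_nat.
by lra.
Qed.

End Peierls.

(** * Ground states of the random field Ising model *)

Section Hamiltonian.
Variables (R : realType) (N : nat).
Implicit Types (h : site -> R) (sigma : config).
Local Notation D := (boxf o N).

Definition vals (c : bool) sigma : {fset site} := [fset v in D | sigma v == c].

Lemma inBoxE v : inBox N v = (v \in D).
Proof. by rewrite mem_boxf !subr0. Qed.

Lemma sum_box (F : site -> R) : \sum_(u <- box N) F u = \sum_(u <- D) F u.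
Proof.
apply: perm_big; apply: uniq_perm; last by move=> v; rewrite mem_box mem_boxf !subr0.
  by apply: allpairs_uniq; rewrite ?iota_uniq // => -[i j] [k l] _ _ /= [h1 h2]; congr (_, _); lia.
exact: fset_uniq.
Qed.

Lemma sum_vals c sigma (F : site -> R) :
  \sum_(u <- vals c sigma) F u = \sum_(u <- D) (sigma u == c)%:R * F u.
Proof.
transitivity (\sum_(u <- [seq u <- enum_fset D | sigma u == c]) F u).
  apply: perm_big; apply: uniq_perm; rewrite ?filter_uniq ?fset_uniq // => u.
  by rewrite inE mem_filter andbC.
rewrite big_filter big_mkcond; apply: eq_bigr => u _.
by case: (sigma u == c); rewrite ?mul1r ?mul0r.
Qed.

(* In terms of the set [A] of spins differing from the boundary spin, the Hamiltonian is
   [const + 2 * (per A + field of A)], the sign of the field being that of the boundary spin. *)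
Lemma hamiltonian_energy bc h sigma : hamiltonian N bc h sigma =
  2 * energy (fun v => spin bc * h v) (vals (~~ bc) sigma) +
  hamiltonian N bc h (fun=> bc).
Proof.
set A := vals (~~ bc) sigma; set eta := (fun v => _).
have AE v : (v \in A) = (v \in D) && (sigma v == ~~ bc) by rewrite inE.
have perA : per R A = \sum_(u <- D) (sigma u == ~~ bc)%:R * \sum_(v <- nbrs u) (v \notin A)%:R :> R.
  by rewrite /per sum_vals.
have fldA : \sum_(u <- A) eta u = \sum_(u <- D) (sigma u == ~~ bc)%:R * eta u by rewrite sum_vals.
pose f u : R := (sigma u == ~~ bc)%:R.
have spE b : spin (sigma b) = spin bc * (1 - 2 * f b) :> R.
  by rewrite /f /spin; case: (bc); case: (sigma b) => /=; lra.
have s2 : spin bc * spin bc = 1 :> R by rewrite /spin; case: (bc); lra.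
pose I (G : site -> site -> R) := \sum_(u <- D) \sum_(v <- nbrs u | v \in D) G u v.
have intE (G : site -> site -> R) : \sum_(u <- box N) \sum_(v <- nbrs u | inBox N v) G u v = I G.
  by rewrite sum_box; apply: eq_bigr => u _; apply: eq_bigl => v; rewrite inBoxE.
have bdE (G : site -> R) : \sum_(u <- box N) \sum_(v <- nbrs u | ~~ inBox N v) G u =
    \sum_(u <- D) \sum_(v <- nbrs u | v \notin D) G u.
  by rewrite sum_box; apply: eq_bigr => u _; apply: eq_bigl => v; rewrite inBoxE.
(* The interior sum runs over ordered pairs, so its two linear terms coincide. *)
have symI (G : site -> R) : I (fun u v => G v) = I (fun u v => G u).
  have c1 (H : site -> site -> R) : I H = \sum_(u <- D) \sum_(v <- D) (nb u v)%:R * H u v.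
    apply: eq_bigr => u _; rewrite -big_filter.
    have -> : [seq v <- nbrs u | v \in D] = [seq v <- nbrs u | v \in D] by [].
    transitivity (\sum_(v <- [seq v <- enum_fset D | nb u v]) H u v).
      apply: perm_big; apply: uniq_perm; rewrite ?filter_uniq ?fset_uniq //.
        case: u => u1 u2; rewrite /nbrs /= !inE !xpair_eqE; clear; lia.
      by move=> v; rewrite !mem_filter andbC.
    by rewrite big_filter big_mkcond; apply: eq_bigr => v _; case: (nb u v); rewrite ?mul1r ?mul0r.
  rewrite !c1 exchange_big; apply: eq_bigr => u _; apply: eq_bigr => v _.
  by rewrite nb_sym.
rewrite /hamiltonian !intE !bdE !sum_box /energy fldA perA.
have -> : I (fun u v => spin (sigma u) * spin (sigma v)) =
    I (fun u v => spin bc * spin bc) - 4 * \sum_(u <- D) f u * \sum_(v <- nbrs u) (v \in D `\` A)%:R.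
  have e1 : I (fun u v => spin (sigma u) * spin (sigma v)) =
      I (fun u v => spin bc * spin bc) - 2 * (I (fun u v => f u) + I (fun u v => f v)) + 4 * I (fun u v => f u * f v).
    have lin (T : Type) (r : seq T) (Q : pred T) (g1 g2 g3 g4 : T -> R) :
        \sum_(i <- r | Q i) (g1 i - 2 * (g2 i + g3 i) + 4 * g4 i) =
        \sum_(i <- r | Q i) g1 i - 2 * (\sum_(i <- r | Q i) g2 i + \sum_(i <- r | Q i) g3 i) +
        4 * \sum_(i <- r | Q i) g4 i.
      by rewrite big_split sumrB /= -!mulr_sumr big_split.
    rewrite /I -lin; apply: eq_bigr => u _; rewrite -lin; apply: eq_bigr => v _.
    rewrite !spE; transitivity (spin bc * spin bc * ((1 - 2 * f u) * (1 - 2 * f v))); first by ring.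
    by rewrite s2; ring.
  rewrite e1 (symI f).
  have -> : \sum_(u <- D) f u * \sum_(v <- nbrs u) (v \in D `\` A)%:R = I (fun u v => f u) - I (fun u v => f u * f v).
    rewrite /I -sumrB; apply: eq_bigr => u _; rewrite -sumrB mulr_sumr [RHS]big_mkcond /=.
    apply: eq_bigr => v _; rewrite in_fsetD AE /f; case: (v \in D) => /=; last by rewrite mulr0.
    by case: (sigma v == ~~ bc) => /=; lra.
  by ring.
have -> : \sum_(u <- D) \sum_(v <- nbrs u | v \notin D) spin (sigma u) =
    spin bc * (\sum_(u <- D) \sum_(v <- nbrs u | v \notin D) 1 -
      2 * \sum_(u <- D) f u * \sum_(v <- nbrs u) (v \notin D)%:R) :> R.
  rewrite mulrBr !mulr_sumr -sumrB; apply: eq_bigr => u _; rewrite !mulr_sumr [LHS]big_mkcond [X in X - _]big_mkcond -sumrB.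
  by apply: eq_bigr => v _; rewrite spE; case: (v \in D) => /=; lra.
have -> : \sum_(u <- D) \sum_(v <- nbrs u | v \notin D) spin bc = spin bc * \sum_(u <- D) \sum_(v <- nbrs u | v \notin D) 1 :> R.
  by rewrite mulr_sumr; apply: eq_bigr => u _; rewrite mulr_sumr; apply: eq_bigr => v _; rewrite mulr1.
have -> : \sum_(u <- D) spin (sigma u) * h u = \sum_(u <- D) spin bc * h u - 2 * \sum_(u <- D) f u * eta u.
  by rewrite mulr_sumr -sumrB; apply: eq_bigr => u _; rewrite spE /eta; ring.
have -> : \sum_(u <- D) (sigma u == ~~ bc)%:R * \sum_(v <- nbrs u) (v \notin A)%:R =
    \sum_(u <- D) f u * \sum_(v <- nbrs u) (v \in D `\` A)%:R + \sum_(u <- D) f u * \sum_(v <- nbrs u) (v \notin D)%:R :> R.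
  rewrite -big_split; apply: eq_bigr => u _; rewrite /= -mulrDr; congr (_ * _); rewrite -big_split.
  apply: eq_bigr => v _ /=; rewrite in_fsetD AE; case: (v \in D) => /=; last by rewrite add0r.
  by rewrite andbT addr0.
have s2' x : spin bc * (spin bc * x) = x :> R by rewrite mulrA s2 mul1r.
rewrite mulrBr !s2' s2.
rewrite -/(\sum_(u <- D) f u * eta u).
lra.
Qed.

End Hamiltonian.

Section Link.
Variables (R : realType) (N : nat).
Local Notation D := (boxf o N).

Lemma origin_in_boxf : o \in D.
Proof. by rewrite mem_boxf !subrr normr0. Qed.

Lemma mem_vals c sigma v : (v \in vals N c sigma) = (v \in D) && (sigma v == c).
Proof. by rewrite inE. Qed.

Lemma vals_sub c sigma : vals N c sigma `<=` D.
Proof. by apply/fsubsetP => v; rewrite mem_vals => /andP[]. Qed.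

Lemma ground_stateE bc (h : site -> R) sigma : ground_state N bc h sigma <->
  energy (fun v => spin bc * h v) (vals N (~~ bc) sigma) <=
  energy (fun v => spin bc * h v) (ground D (fun v => spin bc * h v)).
Proof.
set eta := (fun v => _); split=> [H|H tau].
  pose tau v := if v \in ground D eta then ~~ bc else bc.
  have := H tau; rewrite (hamiltonian_energy N bc h sigma) (hamiltonian_energy N bc h tau) lerD2r ler_pM2l // => /le_trans; apply.
  rewrite (_ : vals N (~~ bc) tau = ground D eta) //; apply/fsetP => v; rewrite mem_vals /tau.
  case: ifP => [vg|_]; first by rewrite eqxx andbT; exact: (fsubsetP (ground_sub D eta)).
  by case: (bc); rewrite /= andbF.
rewrite (hamiltonian_energy N bc h sigma) (hamiltonian_energy N bc h tau) lerD2r ler_pM2l //; apply: le_trans H _.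
by apply: ground_min; exact: vals_sub.
Qed.

(** If the origin were in an extremal ground set, [ground_disj_min] would force every plus and minus
    ground state to share its spin there. Conversely the extremal states themselves are a
    witness. *)
Lemma disagreeE (h : site -> R) :
  (exists sp sm : config, ground_state N true h sp /\ ground_state N false h sm /\
     sp origin != sm origin) <-> diff D h h o.
Proof.
have e1 : (fun v => spin true * h v) = h by apply/funext => v; rewrite /spin mul1r.
have e2 : (fun v => spin false * h v) = (fun v => - h v) by apply/funext => v; rewrite /spin mulN1r.
split=> [[sp [sm []]]|/andP[h1 h2]].
  rewrite ground_stateE e1 /= => hp []; rewrite ground_stateE e2 /= => hm neq.
  have [s1 s2] := ground_disj_min (vals_sub false sp) (vals_sub true sm) hp hm.
  apply/andP; split; apply/negP.
    move=> /(fsubsetP s1); rewrite in_fsetD !mem_vals origin_in_boxf /= => /andP[a1 a2].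
    by move: neq a1; rewrite (eqP a2 : sp origin = false) -[origin]/o; case: (sm o).
  move=> /(fsubsetP s2); rewrite in_fsetD !mem_vals origin_in_boxf /= => /andP[a1 a2].
  by move: neq a1; rewrite (eqP a2 : sm origin = true) -[origin]/o; case: (sp o).
have gv (b : bool) eta : vals N b (fun v => (v \in ground D eta) == b) = ground D eta.
  apply/fsetP => v; rewrite mem_vals.
  have := fsubsetP (ground_sub D eta) v.
  by case: (v \in ground D eta) => [->//|_]; case: b; rewrite ?andbF.
exists (fun v => (v \in ground D h) == false), (fun v => (v \in ground D (fun v => - h v)) == true).
split; [|split].
- by rewrite ground_stateE e1 /= gv.
- by rewrite ground_stateE e2 /= gv.
- by rewrite -[origin]/o (negbTE h1) (negbTE h2).
Qed.

End Link.

(** All estimates concern the law of the whole field; this carries them back to the given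
    probability space. *)
Lemma model_law (R : realType) (d : measure_display) (Omega : measurableType d)
    (P : probability Omega R) (h : site -> Omega -> R) (eps : R) : iid_gaussian P h eps ->
  exists2 p, gauss_law eps p & forall F, ms setT F ->
    measurable ((fun w => (fun v => h v w) : fld R) @^-1` F) /\
    P ((fun w => (fun v => h v w) : fld R) @^-1` F) = (p F)%:E.
Proof.
move=> [mh [marg ind]]; pose X w : g_sigma_algebraType (cyl setT : set (set (fld R))) := fun v => h v w.
have mX : measurable_fun setT X by apply: measurable_to_field => v _; exact: mh.
pose L := image_measure P mX.
have LE A : L A = P (X @^-1` A) by [].
have hL : gaussian_rect eps L.
  move=> s B us mB; rewrite LE.
  rewrite (_ : X @^-1` _ = \bigcap_(v in [set x | x \in s]) (h v @^-1` B v))%classic; last first.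
    by apply/seteqP; split=> w H v /= vs; exact: H.
  by rewrite ind //; apply: eq_bigr => v _; rewrite marg.
exists (pr L); first by exists L.
move=> F mF; split; first by have := mX measurableT F mF; rewrite setTI.
by rewrite -[LHS]/(L F) (prE hL).
Qed.

Theorem theorem2p1 (R : realType) (eps : R) (heps : 0 < eps) :
  exists c : R, 0 < c /\
    forall (d : measure_display) (Omega : measurableType d)
           (P : probability Omega R) (h : site -> Omega -> R),
      iid_gaussian P h eps ->
      forall N : nat, (1 <= N)%N ->
        (P (disagree_at_origin h N) <= (c^-1 * expR (- (c * N%:R)))%:E)%E.
Proof.
have [q [q0 hq]] : exists q, (0 < q)%N /\ (2 * size (shell (9 * q)) <= size (inner q))%N.
  (* The shell count 11544 is linear in [q] and the inner count 25281 quadratic, so a fixed [q] does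
     for all [eps]. *)
  by exists 80%N; rewrite size_shell size_inner; vm_compute.
have d0 := ring_delta_gt0 eps q.
have d1 : ring_delta eps q <= 1.
  have t4 := ring_tau_ge4 eps q; rewrite /ring_delta invf_le1.
    have k1 : 1 <= (size (inner q))%:R :> R by rewrite ler1n k_gt0.
    by apply: (@le_trans _ _ (1 * 1 * 4)); [lra|apply: ler_pM => //; apply: ler_pM => //; lra].
  by rewrite -invr_gt0.
have B0 : (0 < 9 * q + 6)%N by clear; lia.
(* The threshold of [exp_decay], at which one Peierls step costs 1/2. *)
have w0 : 0 < (2 * (40 * 121))^-1 :> R by rewrite invr_gt0 !mulr_gt0.
have [n n0 hn] := @small_scale R eps (9 * q + 6) (ring_delta eps q) heps d0 d1 _ w0.
have np : 0 < 20 * n%:R :> R by rewrite mulr_gt0 // ltr0n.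
exists (20 * n%:R)^-1; split; first by rewrite invr_gt0.
move=> d Omega P h iid N _; have [p lawp hp] := model_law iid.
have md : ms setT (@dis R (boxf o N)) by exact: ms_dis.
have [_ hP] := hp _ md.
rewrite (_ : disagree_at_origin h N = (fun w => (fun v => h v w) : fld R) @^-1` dis (boxf o N))%classic; last first.
  by apply/seteqP; split=> w /=; rewrite /disagree_at_origin /= disagreeE.
rewrite hP lee_fin invrK; apply: (exp_decay heps lawp n0 N).
by apply: hn => // a x ha; exact: hard_cross_prob.
Qed.
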